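(* Let $(I,\mathbf\Lambda)$ be a Bruhat–Tits index, let $i_1<\dots<i_s$ be the elements of $I$, and assume $i_1\neq0$. Let $V=V_{\Lambda_0^{i_1}}^0=\Lambda_0^{i_1}/\pi(\Lambda_0^{i_1})^\vee$, and write $\dim V=t(\Lambda_0^{i_1})=2(l-1)+h_{i_1}+1$ with $l\ge1$. Let $X_{\mathbf\Lambda_0}^{\mathbf h_0}=\overline{X_J\{s_ls_{l+1}\cdots s_{2(l-1)+h_{i_1}}\}}$, where $J=\mathbf S\setminus\{s_{k_1+1},\dots,s_{k_r+1}\}$ with $k_1<\dots<k_r$ is the set of simple reflections defined in the context and the closure is taken inside the flag variety of type $J$ for $\mathrm U(V)$. Then $$X_{\mathbf\Lambda_0}^{\mathbf h_0}=\bigsqcup_{w_1,\dots,w_r}X_J\{w_1w_2\cdots w_r\},$$ where $w_1,\dots,w_r$ run over all the permutations of the form $w_i=s_{k_i+1}s_{k_i+2}\cdots s_{k_i+t_i}$ for some $0\le t_i\le k_{i+1}-k_i$ when $1\le i\le r-1$, and where $w_r=s_{k_r+1}\cdots s_{k_r+t_r}$ for some $0\le t_r\le 2(l-1)+h_{i_1}-k_r$.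
   Context: Lattices. $p$ is an odd prime, $F/\mathbb Q_p$ a finite extension with uniformizer $\pi$ and residue field of order $q$, $E/F$ the unramified quadratic extension with non-trivial automorphism $x\mapsto x^*$, $n\ge1$, $m\ge1$, and $\mathbf h=(h_1<\dots<h_m)$ are integers in $[0,n]$ of the same parity. Let $\mathbb X$ be a supersingular strict formal $\mathcal O_F$-module over $\mathbb F_{q^2}$ (a formal $p$-divisible group with an $\mathcal O_F$-action inducing the natural one on its Lie algebra) of relative height $2n$, with a compatible $\mathcal O_E$-action such that $x\in\mathcal O_E$ has characteristic polynomial $(T-x)(T-x^* )^{n-1}$ on $\mathrm{Lie}(\mathbb X)$, and an $\mathcal O_E$-linear polarization whose kernel lies in $\mathbb X[\pi]$ and has order $q^{2h_1}$. Let $\mathbb N$ be its rational relative Dieudonné module, with Frobenius $\mathcal F$, Verschiebung $\mathcal V$, alternating form $\langle\cdot,\cdot\rangle$ given by the polarization, and $\mathbb Z/2$-grading $\mathbb N=\mathbb N_0\oplus\mathbb N_1$ given by $\mathcal O_E$. Let $W=W_{\mathcal O_F}(\mathbb F_{q^2})$ (relative Witt vectors), with fraction field $\simeq E$. Over an algebraically closed field $k\supset\overline{\mathbb F}_q$ put $\tau=\pi\mathcal V^{-2}$ and $C=\mathbb N_{k,0}^{\tau}$ (independent of $k$), an $n$-dimensional $\mathrm{Frac}(W)$-vector space with non-degenerate hermitian form $\{v,w\}=\delta\langle v,\mathcal Fw\rangle$, $\delta\in W^\times$ fixed with $\delta^\sigma=-\delta$, where $\sigma$ is the non-trivial automorphism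 of $\mathrm{Frac}(W)/F$. For a $W$-lattice $\Lambda\subset C$, $\Lambda^\vee$ is its dual for $\{\cdot,\cdot\}$. For $i=0,1$, $\mathcal L_i$ is the set of lattices with $\pi^{i+1}\Lambda^\vee\subset\Lambda\subset\pi^i\Lambda^\vee$ (vertex lattices), of type $t(\Lambda)=[\Lambda:\pi^{i+1}\Lambda^\vee]$ (length of the quotient), and $\mathcal L_i^{\ge x}$ is the subset with $t(\Lambda)\ge x$. Bruhat–Tits index. A pair $(I,\mathbf\Lambda)$ where $I\subset\{0,\dots,m\}$ is non-empty, $0\notin I$ if $h_1=0$, $m\notin I$ if $h_m=n$, and $\mathbf\Lambda$ consists of $\Lambda_0^i\in\mathcal L_0^{\ge h_i+1}$ for $i\in I\setminus\{0\}$ and $\Lambda_1^j\in\mathcal L_1^{\ge n-h_{j+1}+1}$ for $j\in I\setminus\{m\}$, such that, $i_1<\dots<i_s$ being the elements of $I$, $\Lambda_0^i\subset\pi\Lambda_1^{i\vee}$ for $i\in I\setminus\{0,m\}$ and $\pi\Lambda_1^{i_a\vee}\subset\Lambda_0^{i_{a+1}}$ for $1\le a\le s-1$. When $i_1\ne0$, put $\mathbf\Lambda_0=\{\Lambda_0^{i_1}\}$ and $\mathbf h_0=(h_1,\dots,h_{i_1})$. Deligne–Lusztig varieties. $V=\Lambda_0^{i_1}/\pi(\Lambda_0^{i_1})^\vee$ carries the non-degenerate $\mathbb F_{q^2}/\mathbb F_q$-hermitian form induced by $\{\cdot,\cdot\}$; put $d=\dim V=2(l-1)+h_{i_1}+1$.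 $\mathbf G=\mathrm{GL}(V_{\overline{\mathbb F}_q})$ has the Frobenius $\Phi(u)=(u^{-1})^{*,(q)}$ ($*$ the adjoint for the form, $(q)$ the $q$-Frobenius twist), so $\mathbf G^\Phi=\mathrm U(V)$. A complete flag of $V$ stable under orthogonality defines a $\Phi$-stable Borel subgroup $\mathbf B$ containing a $\Phi$-stable maximal torus; the Weyl group is $\mathbf W=S_d$ with simple reflections $\mathbf S=\{s_1,\dots,s_{d-1}\}$, $s_i=(i\ \ i+1)$, and $\Phi(s_i)=s_{d-i}$. For $J\subset\mathbf S$, $\mathbf P_J\supset\mathbf B$ is the standard parabolic subgroup and $\mathbf G/\mathbf P_J$ (the flag variety of type $J$) parametrizes partial flags whose proper non-zero members have dimensions $\{x:s_x\notin J\}$; $\mathbf W_J$ is generated by $J$ and ${}^J\mathbf W$ is the set of $w$ with $\ell(vw)=\ell(v)+\ell(w)$ for all $v\in\mathbf W_J$. For $w\in{}^J\mathbf W$ the fine Deligne–Lusztig variety is $X_J\{w\}=\{g\mathbf P_J:g^{-1}\Phi(g)\in\mathbf P_J\cdot_\Phi\mathbf Bw\mathbf B\}$, with $x\cdot_\Phi y=xy\Phi(x)^{-1}$; equivalently the image in $\mathbf G/\mathbf P_J$ of $\{g\mathbf B:g^{-1}\Phi(g)\in\mathbf Bw\mathbf B\}$. Empty products are the identity. The set $J$. It corresponds to flags $U_{i_1}\subset\dots\subset U_1\subset W_1\subset\dots\subset W_{i_1}\subset V$ with $\dim U_i=l+\frac{h_{i_1}-h_i}2$ and $\dim W_i=l+\frac{h_{i_1}+h_i}2$;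 i.e. $J=\mathbf S\setminus\{s_{k_1+1},\dots,s_{k_r+1}\}$, where $k_1+1<\dots<k_r+1$ are the distinct elements of $\{1,\dots,d-1\}$ of the form $l+\frac{h_{i_1}-h_i}2$ or $l+\frac{h_{i_1}+h_i}2$, $1\le i\le i_1$. (The two middle terms coincide if $h_1=0$, and the last term $l+h_{i_1}$ is absent if $l=1$.) *)

(* Defs.v *)
(* Only the canonical structures of mpoly are imported: its notations clash with
   those of topology. *)
From HB Require Import structures.
From mathcomp Require Import all_boot all_order all_algebra all_fingroup all_field.
From mathcomp Require Import all_classical topology.
From mathcomp Require mpoly.
Import (canonicals) mpoly.

Set Implicit Arguments.
Unset Strict Implicit.
Unset Printing Implicit Defensive.

Import Order.TTheory GRing.Theory Num.Theory.
Local Open Scope classical_set_scope.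
Local Open Scope ring_scope.

Section PadicFields.

(* The value of v at 0 is irrelevant. *)
Definition vclose (K : fieldType) (v : K -> int) (N : int) (x y : K) : Prop :=
  x = y \/ N <= v (x - y).

(* K is the completion of the rationals for the p-adic valuation. *)
Record is_padic_numbers (p : nat) (K : fieldType) (v : K -> int) : Prop := {
  padic_char0 : [pchar K] =i pred0;
  padic_valM : forall x y, x != 0 -> y != 0 -> v (x * y) = v x + v y;
  padic_valD : forall x y, x != 0 -> y != 0 -> x + y != 0 ->
    Num.min (v x) (v y) <= v (x + y);
  padic_valp : v p%:R = 1;
  padic_dense : forall (x : K) (N : int), exists r : rat, vclose v N x (ratr r);
  padic_complete : forall u : nat -> K,
    (forall N : int, exists n0 : nat, forall i j : nat,
       (n0 <= i)%N -> (n0 <= j)%N -> vclose v N (u i) (u j)) ->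
    exists x : K, forall N : int, exists n0 : nat, forall i : nat,
      (n0 <= i)%N -> vclose v N (u i) x
}.

Definition padic_integers (K : fieldType) (v : K -> int) : set K :=
  [set x | x = 0 \/ 0 <= v x].

Definition integral_closure (K : fieldType) (A : set K) (L : fieldExtType K) :
    set L :=
  [set x | exists P : {poly K}, [/\ P \is monic, (forall i, A P`_i)
                                  & root (map_poly (in_alg L) P) x]].

(* pi generates the ideal of the non-units of the ring O. *)
Definition uniformizer (L : fieldType) (O : set L) (pi : L) : Prop :=
  O pi /\ forall x, O x ->
    (x != 0 /\ O x^-1) <-> ~ (exists2 y, O y & x = pi * y).

(* red restricts to a surjective ring morphism O -> k with kernel pi O, i.e. it
   presents k as O / pi O; its values outside O are irrelevant. *)
Record residue_map (L : fieldType) (O : set L) (pi : L) (k : fieldType)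
    (red : L -> k) : Prop := {
  residue1 : red 1 = 1;
  residueD : forall x y, O x -> O y -> red (x + y) = red x + red y;
  residueM : forall x y, O x -> O y -> red (x * y) = red x * red y;
  residue_surj : forall c, exists2 x, O x & red x = c;
  residue_ker : forall x, O x -> red x = 0 <-> exists2 y, O y & x = pi * y
}.

End PadicFields.

Arguments integral_closure {K} A L _.

Section Lattices.
Variables (E : fieldType) (O : set E) (pi : E).
Variables (C : vectType E) (sigma : {rmorphism E -> E}).
Variable form : {hermitian C for false & sigma}.

Definition is_submodule (M : set C) : Prop :=
  [/\ M 0, (forall x y, M x -> M y -> M (x + y))
    & forall a x, O a -> M x -> M (a *: x)].

Definition is_lattice (L : set C) : Prop :=
  exists s : seq C, <<s>>%VS = fullv /\
    L = [set x | exists2 a : 'I_(size s) -> E,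
           (forall i, O (a i)) & x = \sum_(i < size s) a i *: s`_i].

Definition scale_set (a : E) (L : set C) : set C := [set a *: x | x in L].

Definition dual (L : set C) : set C :=
  [set x | forall y, L y -> O (form x y)].

(* The O-module B / A has a composition series of length t. *)
Definition quotient_length (A B : set C) (t : nat) : Prop :=
  exists M : nat -> set C,
    [/\ M 0%N = A, M t = B,
        forall i, (i <= t)%N -> is_submodule (M i)
      & forall i, (i < t)%N ->
          [/\ M i `<=` M i.+1, M i <> M i.+1
            & forall N, is_submodule N -> M i `<=` N -> N `<=` M i.+1 ->
                N = M i \/ N = M i.+1]].

Definition vertex_lattice (i : nat) (L : set C) : Prop :=
  [/\ is_lattice L, scale_set (pi ^+ i.+1) (dual L) `<=` L
    & L `<=` scale_set (pi ^+ i) (dual L)].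

Definition lattice_type (i : nat) (L : set C) (t : nat) : Prop :=
  quotient_length (scale_set (pi ^+ i.+1) (dual L)) L t.

Definition vertex_lattice_ge (i x : nat) (L : set C) : Prop :=
  vertex_lattice i L /\ exists2 t, lattice_type i L t & (x <= t)%N.

(* The sequence h = [:: h_1; ...; h_m] is numbered from 1. *)
Definition hidx (h : seq nat) (i : nat) : nat := nth 0%N h i.-1.

Record admissible_h (n m : nat) (h : seq nat) : Prop := {
  adm_size : size h = m;
  adm_sorted : sorted ltn h;
  adm_le : forall i, i \in h -> (i <= n)%N;
  adm_parity : forall i j, i \in h -> j \in h -> odd i = odd j
}.

(* The set I is given by the increasing sequence I of its elements, and only
   the values L0 i, for i in I, i <> 0, and L1 j, for j in I, j <> m, matter. *)
Record bruhat_tits_index (n m : nat) (h : seq nat) (I : seq nat)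
    (L0 L1 : nat -> set C) : Prop := {
  bt_sorted : sorted ltn I;
  bt_le : forall i, i \in I -> (i <= m)%N;
  bt_nonempty : I != [::];
  bt_0 : hidx h 1 = 0%N -> 0%N \notin I;
  bt_m : hidx h m = n -> m \notin I;
  bt_L0 : forall i, i \in I -> i != 0%N ->
    vertex_lattice_ge 0 (hidx h i + 1) (L0 i);
  bt_L1 : forall j, j \in I -> j != m ->
    vertex_lattice_ge 1 (n - hidx h j.+1 + 1) (L1 j);
  bt_01 : forall i, i \in I -> i != 0%N -> i != m ->
    L0 i `<=` scale_set pi (dual (L1 i));
  bt_10 : forall a, (a.+1 < size I)%N ->
    scale_set pi (dual (L1 (nth 0%N I a))) `<=` L0 (nth 0%N I a.+1)
}.

(* pr restricts to a surjection L -> V with kernel L', semilinear over the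
   reduction red : O -> k, i.e. it presents the k-vector space V as L / L'. *)
Record quotient_map (k : fieldType) (red : E -> k) (V : vectType k)
    (L L' : set C) (pr : C -> V) : Prop := {
  quotD : forall x y, L x -> L y -> pr (x + y) = pr x + pr y;
  quotZ : forall a x, O a -> L x -> pr (a *: x) = red a *: pr x;
  quot_surj : forall u, exists2 x, L x & pr x = u;
  quot_ker : forall x, L x -> pr x = 0 <-> L' x
}.

End Lattices.

(* e is a basis adapted to a complete flag of V stable under orthogonality. *)
Definition self_dual_flag_basis (k : fieldType) (theta : {rmorphism k -> k})
    (V : vectType k) (form : {hermitian V for false & theta}) (d : nat)
    (e : d.-tuple V) : Prop :=
  basis_of fullv e /\
  forall i, (i <= d)%N -> orthov form <<take i e>>%VS = <<take (d - i) e>>%VS.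

Section GeneralLinearGroup.
Variables (k : fieldType) (d : nat).

Definition GL := {g : 'M[k]_d | g \in unitmx}.
HB.instance Definition _ := Choice.copy GL {g : 'M[k]_d | g \in unitmx}.

Definition zariski_open (U : set GL) : Prop :=
  exists S : set (mpoly.mpoly (d * d) k),
    U = [set g | exists2 f, S f &
           mpoly.meval (fun i => mxvec (val g) 0 i) f <> 0].

Let zariski_openT : zariski_open setT.
Proof.
exists [set (1 : mpoly.mpoly (d * d) k)]; apply/seteqP; split=> // g _.
exists (1 : mpoly.mpoly (d * d) k) => //.
by rewrite mpoly.meval1; apply/eqP; rewrite oner_eq0.
Qed.

Let zariski_openI : setI_closed zariski_open.
Proof.
move=> U U' [S ->] [S' ->].
exists [set fg.1 * fg.2 | fg in S `*` S']; apply/seteqP; split=> g /=.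
  move=> [[f Sf f0] [f' Sf' f'0]]; exists (f * f'); first by exists (f, f').
  by rewrite mpoly.mevalM; apply/eqP; rewrite mulf_neq0 //; apply/eqP.
move=> [_ [[f f'] /= [Sf Sf'] <-]]; rewrite mpoly.mevalM => /eqP.
by rewrite mulf_eq0 negb_or => /andP[/eqP ? /eqP ?]; split; [exists f|exists f'].
Qed.

Let zariski_open_bigU (I : Type) (f : I -> set GL) :
  (forall i, zariski_open (f i)) -> zariski_open (\bigcup_i f i).
Proof.
move=> fo.
pose S := [set P : mpoly.mpoly (d * d) k | exists i,
  [set g | mpoly.meval (fun i => mxvec (val g) 0 i) P <> 0] `<=` f i].
exists S; apply/seteqP; split=> g /=.
  move=> [i _ fig]; have [T fiE] := fo i; move: (fig); rewrite fiE.
  move=> [P TP Pg]; exists P => //; exists i => x Px; rewrite fiE; by exists P.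
by move=> [P [i Pi] Pg]; exists i => //; apply: Pi.
Qed.

HB.instance Definition _ :=
  isOpenTopological.Build GL zariski_openT zariski_openI zariski_open_bigU.

(* GL acts on columns, and a set J of simple reflections
   s_x, 0 < x < d, is given by the sequence of the indices x. The standard
   parabolic P_J is the stabilizer of the subspaces spanned by the first x
   basis vectors, for s_x not in J. *)
Definition parabolic (J : seq nat) (g : 'M[k]_d) : bool :=
  (g \in unitmx) && [forall x : 'I_d, (0 < x)%N && ((x : nat) \notin J) ==>
    [forall i : 'I_d, forall j : 'I_d, (j < x <= i)%N ==> (g i j == 0)]].

Definition borel : 'M[k]_d -> bool := parabolic [::].

Lemma parabolicP (J : seq nat) (g : 'M[k]_d) :
  reflect (g \in unitmx /\ forall x : 'I_d, (0 < x)%N -> (x : nat) \notin J ->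
            forall i j : 'I_d, (j < x <= i)%N -> g i j = 0)
          (parabolic J g).
Proof.
apply: (iffP andP) => -[gU H]; split=> //.
  move=> x x0 xJ i j ij.
  move/forallP: H => /(_ x); rewrite x0 xJ /= => /forallP/(_ i)/forallP/(_ j).
  by rewrite ij => /eqP.
apply/forallP => x; apply/implyP => /andP[x0 xJ].
by apply/forallP => i; apply/forallP => j; apply/implyP => ij; apply/eqP/H/ij.
Qed.

Lemma parabolic1 J : parabolic J 1%:M.
Proof.
apply/parabolicP; split; first exact: unitmx1.
move=> x _ _ i j /andP[jx xi]; rewrite mxE; case: eqP => // ij.
by move: (leq_trans jx xi); rewrite ij ltnn.
Qed.

Lemma parabolicM J g h : parabolic J g -> parabolic J h -> parabolic J (g *m h).
Proof.
move=> /parabolicP[gU gP] /parabolicP[hU hP]; apply/parabolicP.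
split; first by rewrite unitmx_mul gU.
move=> x x0 xJ i j /andP[jx xi]; rewrite mxE big1 // => l _.
have [lx|xl] := ltnP l x.
  by rewrite (gP x) ?mul0r // lx.
by rewrite (hP x) ?mulr0 // jx.
Qed.

Lemma parabolicV J g : parabolic J g -> parabolic J (invmx g).
Proof.
move=> /parabolicP[gU gP]; apply/parabolicP; split; first by rewrite unitmx_inv.
move=> x x0 xJ.
pose D : 'M[k]_d := pid_mx x.
have DE i j : D i j = ((i == j) && (i < x)%N)%:R by rewrite mxE.
have sub : (D *m g^T <= D)%MS.
  have -> : D *m g^T = (D *m g^T) *m D.
    apply/matrixP => i j; rewrite [RHS]mxE (bigD1 j) //= big1 ?addr0.
      rewrite DE eqxx /=; have [jx|xj] := ltnP j x; first by rewrite mulr1.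
      rewrite mulr0 mxE big1 // => l _; rewrite DE mxE.
      have [ix|xi] := ltnP i x; last by rewrite andbF mul0r.
      have [<-|] := eqVneq i l; last by rewrite mul0r.
      by rewrite (gP x) ?mulr0 // ix.
    by move=> l /negPf lj; rewrite DE lj mulr0.
  exact: submxMl.
have eqD : (D <= D *m g^T)%MS.
  by rewrite -(geq_leqif (mxrank_leqif_sup sub)) mxrankMfree // row_free_unit unitmx_tr.
have [X XE] := submxP eqD.
move=> i j /andP[jx xi].
have : (D *m (invmx g)^T) j i = 0.
  rewrite XE; have -> : X *m (D *m g^T) *m (invmx g)^T = X *m D.
    by rewrite !mulmxA -[X *m D *m _ *m _]mulmxA -trmx_mul mulVmx // trmx1 mulmx1.
  by rewrite mxE big1 // => l _; rewrite DE; case: eqP => [->|]; rewrite ?ltnNge ?xi mulr0.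
rewrite mxE (bigD1 j) //= big1 ?addr0; first by rewrite DE eqxx jx mul1r mxE.
by move=> l /negPf lj; rewrite DE eq_sym lj mul0r.
Qed.

Definition same_flag (J : seq nat) (g h : GL) : bool :=
  parabolic J (invmx (val g) *m val h).

Lemma same_flag_refl J : reflexive (same_flag J).
Proof. by move=> g; rewrite /same_flag mulVmx ?(valP g) // parabolic1. Qed.

Lemma same_flag_sym J : symmetric (same_flag J).
Proof.
suff sub g h : same_flag J g h -> same_flag J h g by move=> g h; apply/idP/idP; apply: sub.
have -> : same_flag J h g = parabolic J (invmx (invmx (val g) *m val h)).
  rewrite /same_flag; congr parabolic.
  have U : invmx (val g) *m val h \in unitmx.
    by rewrite unitmx_mul unitmx_inv (valP g) (valP h).
  rewrite -[LHS](mulmxK U) -[invmx (val h) *m val g *m _]mulmxA.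
  by rewrite mulKVmx ?(valP g) // mulVmx ?(valP h) // mul1mx.
exact: parabolicV.
Qed.

Lemma same_flag_trans J : transitive (same_flag J).
Proof.
move=> h g f gh hf; have := parabolicM gh hf.
by rewrite -mulmxA mulKVmx ?(valP h).
Qed.

Canonical same_flag_equiv J := EquivRel (same_flag J)
  (@same_flag_refl J) (@same_flag_sym J) (@same_flag_trans J).

Local Open Scope quotient_scope.

Definition flag_variety (J : seq nat) :=
  quotient_topology {eq_quot same_flag_equiv J}.

Variables (q : nat) (H : 'M[k]_d).

(* H is the Gram matrix of the hermitian form: {x, y} = x^T H y^(q). The adjoint
   of an endomorphism u of the q-Frobenius twist of the space is defined by
   {u^* x, y} = {x, u y}; hence {Phi g x, g y} = {x, y} for all columns x, y. *)
Definition adjoint (u : 'M[k]_d) : 'M[k]_d := invmx H^T *m u^T *m H^T.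

Definition Phi (g : 'M[k]_d) : 'M[k]_d :=
  adjoint (map_mx (fun x : k => x ^+ q) (invmx g)).

(* The product of 'S_d composes permutations from left to right, whereas
   perm_mx s sends the j-th basis vector to the (s^-1 j)-th one: perm_mx is a
   group morphism sending each simple reflection to its usual matrix, so that
   words in the simple reflections have their usual meaning. The definition is
   meant for w of minimal length in W_J w, but makes sense for every w. *)
Definition fine_DL (J : seq nat) (w : 'S_d) : set (flag_variety J) :=
  [set \pi_(flag_variety J) g | g in [set g : GL |
    exists x b b' : 'M[k]_d, [/\ parabolic J x, borel b, borel b' &
      invmx (val g) *m Phi (val g) =
        x *m (b *m perm_mx w *m b') *m invmx (Phi x)]]].

End GeneralLinearGroup.

Arguments fine_DL {k d} q H J w _.

Section Words.
Variable d : nat.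

(* s_i = (i i+1) for 0 < i < d, on ordinals numbered from 0. *)
Definition simple_refl (i : nat) : 'S_d :=
  match insub i.-1, insub i with
  | Some a, Some b => tperm a b
  | _, _ => 1%g
  end.

(* s_a s_(a+1) ... s_(a+t-1) *)
Definition refl_word (a t : nat) : 'S_d :=
  (\prod_(a <= j < a + t) simple_refl j)%g.

(* The sequence k_1 + 1 < ... < k_r + 1. *)
Definition flag_dims (h : seq nat) (i1 l : nat) : seq nat :=
  sort leq (undup [seq x <-
      [seq (l + (hidx h i1 - hidx h i)./2)%N | i <- iota 1 i1] ++
      [seq (l + (hidx h i1 + hidx h i)./2)%N | i <- iota 1 i1]
    | (0 < x < d)%N]).

Definition type_J (h : seq nat) (i1 l : nat) : seq nat :=
  [seq x <- iota 1 d.-1 | x \notin flag_dims h i1 l].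

(* The tuples (w_1, ..., w_r), for K = [:: k_1; ...; k_r], where N is the largest
   index of the letters allowed in w_r. *)
Definition word_tuples (K : seq nat) (N : nat) :
    set ((size K).-tuple 'S_d) :=
  [set w | forall i : 'I_(size K), exists2 t,
     (t <= (if i.+1 < size K then nth 0 K i.+1 else N) - nth 0 K i)%N &
     tnth w i = refl_word (nth 0%N K i).+1 t].

End Words.

Arguments word_tuples d K N _ : clear implicits.

(* Main.v *)
(* For g in GL put A = g^-1 Phi(g), let E be the complete flag of g, and let C be
   the set of dimensions of the flags of type J. For an increasing word T in the
   simple reflections, B w_T B consists of the invertible upper Hessenberg matrices
   whose subdiagonal is non-zero exactly at the positions in T. So A lies in it if
   and only if perp E_(d-j) is contained in E_(j+1) for all j, and differs from E_j
   exactly for j in T. The words w_1 ... w_r are those for which every letter j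
   satisfies j in C or j-1 in T.

   The flags F of type J with perp F_(d+1-x) in F_x for x in C form a closed set,
   which contains the strata of these words. Conversely such an F refines to a
   complete flag as above: its gaps come in dual pairs and are filled
   simultaneously, a gap which is its own dual by means of an isotropic vector,
   given by Lang's theorem. The word T depends only on F. So the closed set is the
   disjoint union of the strata.

   The stratum of s_l s_(l+1) ... s_(d-1) is dense in it: if g0^-1 Phi(g0) is in
   B w_T B, replace the letters missing from w_T by transvections 1 + t E_(j,j-1)
   to get a matrix A_t, and solve g^-1 Phi(g) = A_t in power series in t by
   successive approximation; the entries of the solution can be specialized to k,
   as in the Nullstellensatz, with t non-zero and outside of a given hypersurface
   which does not contain g0. *)
Require Import Defs.
From HB Require Import structures.
From mathcomp Require Import all_boot all_order all_algebra all_fingroup all_field.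
From mathcomp Require Import all_classical topology.
From mathcomp Require mpoly.
Import (canonicals) mpoly.
From mathcomp Require Import ring zify.

Set Implicit Arguments.
Unset Strict Implicit.
Unset Printing Implicit Defensive.

Import Order.TTheory GRing.Theory Num.Theory.
Local Open Scope classical_set_scope.
Local Open Scope ring_scope.

(** * Specialization to points over an algebraically closed field *)

(** Words and flags are linked by the fact that the flag of [Phi g] consists of the orthogonals of
    the terms of the flag of [g]. The form is linear in one variable and Frobenius-linear in the
    other, so that taking the orthogonal twice is the [q^2]-Frobenius, and a partial flag need not
    be stable under it. The dual of a gap is thus not given in advance: the terms added to [F] are
    kept in the form [F_i + perp E_(d-j)], and this forces the gaps to match. The equation
    [g^-1 Phi(g) = A_t] involves [g] and the inverse of its Frobenius twist. Applied twice, it says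
    that [g] is its own [q^2]-twist times a matrix depending on [A_t] only. Raising to the power
    [q^2] increases the order in [t] of a difference, whence convergence. The series only serve as a
    domain containing a solution: the points over [k] are those of the [k]-algebra generated by [t]
    and the entries of this solution. *)

Section Specialization.
Variable k : closedFieldType.

Lemma closed_field_nonroot (P : {poly k}) : P != 0 -> exists x, P.[x] != 0.
Proof.
move=> P0; have [/size_poly1P[a a0 ->]|s1] := boolP (size P == 1%N).
  by exists 0; rewrite hornerC.
(* A root of [X P + 1] is not a root of [P]. *)
have: size ('X * P + 1) != 1%N.
  rewrite mulrC size_polyDl ?size_poly1 ?size_mulX //.
    by rewrite eqSS size_poly_eq0.
  by rewrite ltnS size_poly_gt0.
case/closed_rootP => x /rootP; rewrite hornerD hornerM hornerX hornerC => hx.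
by exists x; apply: contra_eq_neq hx => ->; rewrite mulr0 add0r oner_neq0.
Qed.

(** The Nullstellensatz for the image of [psi]: its points over [k] are dense. They are given as
    morphisms from [A] killing the kernel of [psi], so that neither the subring [psi(A)] nor a
    quotient of [A] has to be formed. *)
Definition specializable (A : comNzRingType) (L : idomainType)
    (c : {rmorphism k -> A}) (psi : {rmorphism A -> L}) : Prop :=
  forall h, psi h != 0 -> exists phi : {rmorphism A -> k},
    [/\ cancel c phi, forall P, psi P = 0 -> phi P = 0 & phi h != 0].

Variables (A : comNzRingType) (L : idomainType) (c : {rmorphism k -> A}).
Variables (psi : {rmorphism A -> L}) (b : L).
Hypothesis psi_spec : specializable c psi.

Let ev (P : {poly A}) : L := (map_poly psi P).[b].
Let evM P Q : ev (P * Q) = ev P * ev Q.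
Proof. by rewrite /ev rmorphM hornerM. Qed.
Let evD P Q : ev (P + Q) = ev P + ev Q.
Proof. by rewrite /ev rmorphD hornerD. Qed.
Let evZ a P : ev (a *: P) = psi a * ev P.
Proof. by rewrite /ev map_polyZ hornerZ. Qed.
Let psiX a n : psi a != 0 -> psi (a ^+ n) != 0.
Proof. by move=> a0; rewrite rmorphXn expf_neq0. Qed.

(** Minimality is for the degree after [psi]. Truncating [P] at this degree changes it by a
    polynomial killed by [psi] and makes its leading coefficient survive, as pseudo-division over
    [A] requires. *)
Let min_lead (S : {poly A} -> Prop) :
  (forall P P', map_poly psi P = map_poly psi P' -> S P -> S P') ->
  (exists2 P, S P & map_poly psi P != 0) ->
  exists P, [/\ S P, psi (lead_coef P) != 0, size (map_poly psi P) = size P &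
    forall R, S R -> (size (map_poly psi R) < size P)%N -> map_poly psi R = 0].
Proof.
move=> Sext exS.
have {exS}: exists n, `[< exists P, [/\ S P, map_poly psi P != 0 &
    size (map_poly psi P) = n] >].
  have [P SP P0] := exS.
  by exists (size (map_poly psi P)); apply/asboolP; exists P.
move=> exn; case: (ex_minnP exn) => n /asboolP[P [SP P0 Pn]] nmin.
pose P' := \poly_(i < n) P`_i.
have PP' : map_poly psi P = map_poly psi P'.
  apply/polyP => i; rewrite !coef_map coef_poly /=; case: ltnP => // ni.
  by rewrite rmorph0 -coef_map nth_default // Pn.
have sP' : size P' = n.
  apply/eqP; rewrite eqn_leq size_poly /= -{1}Pn PP'.
  exact: size_poly.
exists P'; split.
- exact: Sext SP.
- by rewrite lead_coefE sP' -coef_map -PP' -Pn -lead_coefE lead_coef_eq0.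
- by rewrite -PP' Pn.
move=> R SR; rewrite sP' => sR; apply/eqP/negPn/negP => R0.
have := nmin (size (map_poly psi R)); rewrite leqNgt sR => /(_ _)/negP; apply=> //.
by apply/asboolP; exists R.
Qed.

(** Adjunction of one generator [b]. If [b] is transcendental over [psi(A)], specialize so that one
    coefficient of [h] survives, and take a non-root of the resulting polynomial. If [b] is
    algebraic, with polynomial [P] of least degree, a Bezout relation [U h + V P = a] holds modulo
    the kernel, with [a] constant and [psi a] nonzero; specialize so that [a] and the leading
    coefficient of [P] survive, and take a root of [P]. *)
Lemma specializable_horner :
  specializable (polyC \o c) (horner_eval b \o map_poly psi).
Proof.
move=> h; rewrite -[X in X != 0]/(ev h) => hb.
have coef0 (P : {poly A}) i : map_poly psi P = 0 -> psi P`_i = 0.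
  by move=> P0; rewrite -coef_map P0 coef0.
have h0 : map_poly psi h != 0.
  by apply: contraNneq hb => h0; rewrite /ev h0 horner0.
pose alg P := ev P = 0.
have [alg_b|tr_b] := pselect (exists2 P, alg P & map_poly psi P != 0); last first.
  have tr P i : ev P = 0 -> psi P`_i = 0.
    move=> P0; apply: coef0; apply/eqP/negPn/negP => P0'.
    by case: tr_b; exists P.
  have [i hi] : exists i, psi h`_i != 0.
    by exists (size (map_poly psi h)).-1; rewrite -coef_map -lead_coefE lead_coef_eq0.
  have [phi [phic phi0 phih]] := psi_spec hi.
  have [x xh] : exists x, (map_poly phi h).[x] != 0.
    apply: closed_field_nonroot; apply: contraNneq phih => E.
    by rewrite -coef_map E polyseq0 nth_nil.
  exists (horner_eval x \o map_poly phi); split=> [a|P P0|//] /=.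
    by rewrite /horner_eval map_polyC hornerC /= phic.
  rewrite /horner_eval (_ : map_poly phi P = 0) ?horner0 //; apply/polyP => j.
  by rewrite coef_map polyseq0 nth_nil; apply/phi0/tr.
have [||P [P0 lP sP minP]] := @min_lead alg; [|by []|].
  by move=> P P' E; rewrite /alg /ev E.
have mP0 : map_poly psi P != 0.
  by rewrite -size_poly_eq0 sP size_poly_eq0; apply: contraNneq lP => ->; rewrite lead_coef0 rmorph0.
(* The ideal of [h] and [P] modulo the kernel. Up to a nonzero factor, an element [R] of least
   degree divides [h], hence does not vanish at [b]; it also divides [P], so that the quotient
   vanishes at [b], and [R] is constant by minimality of [P]. *)
pose ideal R := exists U V S, R = U * h + V * P + S /\ map_poly psi S = 0.
have idealB (R T U : {poly A}) a : ideal R -> ideal T -> ideal (a *: R - U * T).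
  move=> [V1 [V2 [S [-> S0]]]] [W1 [W2 [S' [-> S'0]]]].
  exists (a *: V1 - U * W1), (a *: V2 - U * W2), (a *: S - U * S'); split.
    by rewrite !mulrDl !mulrDr !scalerDr !mulNr -!scalerAl !mulrA; ring.
  by rewrite rmorphB /= map_polyZ rmorphM /= S0 S'0 scaler0 mulr0 subr0.
have idh : ideal h by exists 1, 0, 0; rewrite mul1r mul0r !addr0 rmorph0.
have idP : ideal P by exists 0, 1, 0; rewrite mul1r mul0r add0r addr0 rmorph0.
have [||R [idR lR sR minR]] := @min_lead ideal.
- move=> R R' E [U [V [S [RE S0]]]]; exists U, V, (S + (R' - R)); split.
    by rewrite [R in R' - R]RE; ring.
  by rewrite rmorphD rmorphB /= S0 E subrr addr0.
- by exists h.
have Rn0 : R != 0 by apply: contraNneq lR => ->; rewrite lead_coef0 rmorph0.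
have idmod T : ideal T -> let l := lead_coef R ^+ Pdiv.Ring.rscalp T R in
    psi l *: map_poly psi T = map_poly psi (Pdiv.Ring.rdivp T R) * map_poly psi R.
  move=> idT l; have := Pdiv.ComRing.rdivp_eq R T; rewrite -/l => E.
  have m0 : map_poly psi (Pdiv.Ring.rmodp T R) = 0.
    apply: minR; last by apply: leq_ltn_trans (size_poly _ _) _; rewrite Pdiv.Ring.ltn_rmodp.
    have -> : Pdiv.Ring.rmodp T R = l *: T - Pdiv.Ring.rdivp T R * R.
      by rewrite E addrC addKr.
    exact: idealB.
  by rewrite -rmorphM -map_polyZ E rmorphD /= m0 addr0.
have evidmod T : ideal T -> exists2 l, psi l != 0 &
    psi l * ev T = ev (Pdiv.Ring.rdivp T R) * ev R.
  move=> idT; exists (lead_coef R ^+ Pdiv.Ring.rscalp T R); first exact: psiX.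
  by rewrite -evZ -evM /ev map_polyZ idmod // rmorphM.
have evR : ev R != 0.
  have [l l0 E] := evidmod _ idh.
  by apply: contra_neq hb => R0; move/eqP: E; rewrite R0 mulr0 mulf_eq0 (negPf l0) => /eqP.
set q := Pdiv.Ring.rdivp P R.
have algq : alg q.
  have [l l0 E] := evidmod _ idP; move: E; rewrite P0 mulr0 => /esym/eqP.
  by rewrite mulf_eq0 (negPf evR) orbF => /eqP.
have qR := idmod _ idP; rewrite -/q /= in qR.
have q0 : map_poly psi q != 0.
  apply/eqP => q0; move/eqP: qR.
  by rewrite q0 mul0r scale_poly_eq0 (negPf mP0) orbF (negPf (psiX _ lR)).
have [a RE] : exists a, R = a%:P.
  have /(congr1 (fun P : {poly L} => size P)) := qR.
  rewrite size_scale ?psiX // size_mul // ?sP; last first.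
    by rewrite -size_poly_eq0 sR size_poly_eq0.
  rewrite sR => sE; suff: (size R <= 1)%N by move/size1_polyC => ->; eexists.
  rewrite leqNgt; apply/negP => sR1; case/eqP: q0; apply: minP => //.
  rewrite sE; move: sR1; case: (size R) => [|[|s]] // _.
  by rewrite addnS /= addnS ltnS leq_addr.
rewrite {}RE lead_coefC in lR evR idR *.
have [U [V [S [aE S0]]]] := idR.
have [phi [phic phi0 phial]] : exists phi : {rmorphism A -> k},
    [/\ cancel c phi, forall P, psi P = 0 -> phi P = 0 & phi (a * lead_coef P) != 0].
  by apply: psi_spec; rewrite rmorphM mulf_neq0.
have mphi0 (T : {poly A}) : map_poly psi T = 0 -> map_poly phi T = 0.
  move=> T0; apply/polyP => i; rewrite coef_map polyseq0 nth_nil.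
  exact/phi0/coef0.
have [phia phil] : phi a != 0 /\ phi (lead_coef P) != 0.
  by apply/andP; rewrite -negb_or -mulf_eq0 -rmorphM.
have [x xP] : exists x, root (map_poly phi P) x.
  apply/closed_rootP; rewrite size_map_poly_id0 //.
  apply/eqP => /eqP/size_poly1P[a' a'0 PE]; move: P0.
  rewrite /alg /ev PE map_polyC hornerC /= => a0.
  by move: lP; rewrite PE lead_coefC a0 eqxx.
exists (horner_eval x \o map_poly phi); split=> [a'|T T0|] /=.
- by rewrite /horner_eval map_polyC hornerC /= phic.
- rewrite /horner_eval; set r := Pdiv.Ring.rmodp T P.
  have := Pdiv.ComRing.rdivp_eq P T; set l := lead_coef P ^+ _ => E.
  have r0 : map_poly psi r = 0.
    apply: minP; last first.
      apply: leq_ltn_trans (size_poly _ _) _; rewrite Pdiv.Ring.ltn_rmodp.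
      by apply: contraNneq mP0 => ->; rewrite rmorph0.
    have -> : r = l *: T - Pdiv.Ring.rdivp T P * P by rewrite E addrC addKr.
    rewrite /alg -scaleN1r -[-1 *: _]mul1r evD evZ; move: T0 => /=.
    rewrite -[horner_eval _ _]/(ev T) => ->; rewrite mulr0 add0r mul1r evZ evM P0.
    by rewrite !mulr0.
  have /(congr1 (fun P : {poly A} => (map_poly phi P).[x])) := E.
  rewrite map_polyZ hornerZ rmorphD rmorphM /= (mphi0 _ r0) addr0 hornerM (rootP xP) mulr0.
  by move/eqP; rewrite mulf_eq0 rmorphXn expf_eq0 (negPf phil) andbF => /eqP.
rewrite /horner_eval; apply: contraNneq phia => hx.
have /(congr1 (fun P : {poly A} => (map_poly phi P).[x])) := aE.
rewrite map_polyC hornerC /= => ->; rewrite !rmorphD !rmorphM /= (mphi0 _ S0) addr0.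
by rewrite hornerD !hornerM hx (rootP xP) !mulr0 addr0.
Qed.

End Specialization.

Lemma specializable_points (k : closedFieldType) (L : idomainType)
    (j : {rmorphism k -> L}) (z : seq L) :
  exists (A : comNzRingType) (c : {rmorphism k -> A}) (psi : {rmorphism A -> L})
    (x : nat -> A), [/\ specializable c psi, forall a, psi (c a) = j a &
    forall i, (i < size z)%N -> psi (x i) = z`_i].
Proof.
elim: z => [|b z [A [c [psi [x [sp psic psix]]]]]].
  exists k, idfun, j, (fun=> 0); split=> // h h0; exists idfun; split=> //=.
    by move=> P /eqP; rewrite fmorph_eq0 => /eqP.
  by rewrite -(fmorph_eq0 j).
exists {poly A}, (polyC \o c), (horner_eval b \o map_poly psi).
exists (fun i => if i is i'.+1 then (x i')%:P else 'X); split.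
- exact: specializable_horner.
- by move=> a; rewrite /= /horner_eval map_polyC hornerC /= psic.
- case=> [|i] /= iz; first by rewrite /horner_eval map_polyX hornerX.
  by rewrite /horner_eval map_polyC hornerC /= psix.
Qed.

(** * Formal power series *)

Section PowerSeries.
Variable k : fieldType.

Definition series := nat -> k.
HB.instance Definition _ := gen_eqMixin series.
HB.instance Definition _ := gen_choiceMixin series.

Implicit Types x y z : series.

Definition series_add x y : series := fun i => x i + y i.
Definition series_opp x : series := fun i => - x i.
Definition series_poly (p : {poly k}) : series := fun i => p`_i.
Definition series_trunc x n : {poly k} := \poly_(i < n.+1) x i.
(** The coefficient [n] is read off a product of truncations, so that the ring laws follow from
    those of polynomials through [series_mulE]. *)
Definition series_mul x y : series :=
  fun n => (series_trunc x n * series_trunc y n)`_n.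

Lemma series_addA : associative series_add.
Proof. by move=> x y z; apply/funext => i; apply: addrA. Qed.
Lemma series_addC : commutative series_add.
Proof. by move=> x y; apply/funext => i; apply: addrC. Qed.
Lemma series_add0 : left_id (series_poly 0) series_add.
Proof. by move=> x; apply/funext => i; rewrite /series_add /series_poly coef0 add0r. Qed.
Lemma series_addN : left_inverse (series_poly 0) series_opp series_add.
Proof. by move=> x; apply/funext => i; rewrite /series_add /series_poly coef0 addNr. Qed.

HB.instance Definition _ :=
  GRing.isZmodule.Build series series_addA series_addC series_add0 series_addN.

Definition agree n x y := forall i, (i < n)%N -> x i = y i.

Lemma series_mulE x y n p r : agree n.+1 x (series_poly p) ->
  agree n.+1 y (series_poly r) -> series_mul x y n = (p * r)`_n.
Proof.
move=> xp yr; rewrite /series_mul !coefM; apply: eq_bigr => i _.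
by rewrite !coef_poly ltn_ord ltnS leq_subr xp ?yr // ltnS leq_subr.
Qed.

Lemma agree_trunc x n m : (m <= n.+1)%N -> agree m x (series_poly (series_trunc x n)).
Proof. by move=> mn i im; rewrite /series_poly coef_poly (leq_trans im). Qed.

Lemma series_mulC : commutative series_mul.
Proof. by move=> x y; apply/funext => n; rewrite /series_mul mulrC. Qed.

Let agree_mul x y n : agree n.+1 (series_mul x y)
  (series_poly (series_trunc x n * series_trunc y n)).
Proof.
move=> i; rewrite ltnS => ni.
by apply: series_mulE; apply: agree_trunc; rewrite ltnS.
Qed.

Lemma series_mulA : associative series_mul.
Proof.
move=> x y z; apply/funext => n.
rewrite (series_mulE (@agree_trunc x n n.+1 _) (@agree_mul y z n)) //.
by rewrite (series_mulE (@agree_mul x y n) (@agree_trunc z n n.+1 _)) // mulrA.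
Qed.

Lemma series_mul1 : left_id (series_poly 1) series_mul.
Proof.
move=> x; apply/funext => n.
rewrite (@series_mulE _ _ _ 1 (series_trunc x n)) //; last exact: agree_trunc.
by rewrite mul1r /series_trunc coef_poly ltnSn.
Qed.

Lemma series_mulDl : left_distributive series_mul series_add.
Proof.
move=> x y z; apply/funext => n.
rewrite /series_add /series_mul -coefD -mulrDl; apply: series_mulE.
  by move=> i; rewrite /series_poly coefD !coef_poly => ->.
exact: agree_trunc.
Qed.

Lemma series_1neq0 : series_poly 1 != 0.
Proof.
apply/eqP => /(congr1 (fun x => x 0%N)).
rewrite -[RHS]/((0 : {poly k})`_0) /series_poly coef1 coef0.
by move/eqP; rewrite oner_eq0.
Qed.

HB.instance Definition _ := GRing.Zmodule_isComNzRing.Build series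
  series_mulA series_mulC series_mul1 series_mulDl series_1neq0.

Lemma series_addE x y n : (x + y) n = x n + y n. Proof. by []. Qed.
Lemma series_oppE x n : (- x) n = - x n. Proof. by []. Qed.
Lemma series_0E n : (0 : series) n = 0.
Proof. by rewrite -[LHS]/((0 : {poly k})`_n) coef0. Qed.

Lemma series_coefM x y n : (x * y) n = \sum_(i < n.+1) x i * y (n - i)%N.
Proof.
rewrite -[LHS]/(series_mul x y n) /series_mul coefM; apply: eq_bigr => i _.
by rewrite !coef_poly ltn_ord ltnS leq_subr.
Qed.

Lemma series_integral x y : x * y = 0 -> (x == 0) || (y == 0).
Proof.
move=> xy0; apply/norP => -[x0 y0].
have low z : z != 0 -> exists2 n, z n != 0 & forall i, (i < n)%N -> z i = 0.
  move=> z0; have exn : exists n, z n != 0.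
    apply: contrapT => nz; case/eqP: z0; apply/funext => n; rewrite series_0E.
    by apply/eqP/negPn/negP => zn; apply: nz; exists n.
  case: (ex_minnP exn) => n zn nmin; exists n => // i ni.
  by apply/eqP/negPn/negP => /nmin; rewrite leqNgt ni.
have [m xm xlt] := low _ x0; have [n yn ylt] := low _ y0.
have : (x * y) (m + n)%N != 0.
  have mmn : (m < (m + n).+1)%N by rewrite ltnS leq_addr.
  rewrite series_coefM (bigD1 (Ordinal mmn)) //= big1 => [|i im].
    by rewrite addr0 addKn mulf_neq0.
  have [lim|] := ltnP i m; first by rewrite xlt // mul0r.
  rewrite leq_eqVlt => /predU1P[E|mi]; first by case/eqP: im; apply: val_inj.
  by rewrite ylt ?mulr0 // ltn_subLR ?ltn_add2r // -ltnS.
by rewrite xy0 series_0E eqxx.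
Qed.

(** Inverses are chosen classically; the unit ring structure gives access to [invmx] on matrices of
    series. *)
Let series_unit : {pred series} := [pred x | `[< exists y, y * x = 1 >]].
Let series_inv x : series := xget x [set y | y * x = 1]%classic.

Let series_mulVr : {in series_unit, left_inverse 1 series_inv *%R}.
Proof.
move=> x /asboolP[y yx].
by have := @xgetI _ x [set y | y * x = 1]%classic y yx.
Qed.
Let series_unitP x y : y * x = 1 -> series_unit x.
Proof. by move=> yx; apply/asboolP; exists y. Qed.
Let series_inv_out : {in [predC series_unit], series_inv =1 id}.
Proof.
move=> x /asboolPn nx; rewrite /series_inv; case: xgetP => // y _ yx.
by case: nx; exists y.
Qed.
HB.instance Definition _ := GRing.ComNzRing_hasMulInverse.Build series
  series_mulVr series_unitP series_inv_out.
HB.instance Definition _ :=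
  GRing.ComUnitRing_isIntegral.Build series series_integral.

Lemma series_poly_is_zmod_morphism : zmod_morphism series_poly.
Proof. by move=> p r; apply/funext => i; rewrite series_addE series_oppE /series_poly coefB. Qed.
Lemma series_poly_is_monoid_morphism : monoid_morphism series_poly.
Proof. by split=> // p r; apply/funext => n; apply/esym/series_mulE. Qed.
HB.instance Definition _ :=
  GRing.isZmodMorphism.Build {poly k} series series_poly series_poly_is_zmod_morphism.
HB.instance Definition _ :=
  GRing.isMonoidMorphism.Build {poly k} series series_poly series_poly_is_monoid_morphism.

Definition series_coef0 (x : series) : k := x 0%N.
Lemma series_coef0_is_zmod_morphism : zmod_morphism series_coef0.
Proof. by move=> x y; rewrite /series_coef0 series_addE series_oppE. Qed.
Lemma series_coef0_is_monoid_morphism : monoid_morphism series_coef0.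
Proof.
split=> [|x y]; first by rewrite /series_coef0 -[LHS]/((1 : {poly k})`_0) coef1.
by rewrite /series_coef0 series_coefM big_ord1 subnn.
Qed.
HB.instance Definition _ :=
  GRing.isZmodMorphism.Build series k series_coef0 series_coef0_is_zmod_morphism.
HB.instance Definition _ :=
  GRing.isMonoidMorphism.Build series k series_coef0 series_coef0_is_monoid_morphism.

End PowerSeries.

(** * Bruhat cells of Hessenberg matrices *)

Section Hessenberg.
Variables (k : fieldType) (d : nat).
Implicit Types (A M y b : 'M[k]_d) (T : seq nat).

Lemma borelP b : reflect (b \in unitmx /\ forall i j : 'I_d, (j < i)%N -> b i j = 0)
  (borel b).
Proof.
apply: (iffP (parabolicP _ _)) => -[bU bB]; split=> //.
  move=> i j ji; apply: (bB i) => //; first exact: leq_ltn_trans ji.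
  by rewrite ji leqnn.
by move=> x _ _ i j /andP[jx xi]; apply/bB/(leq_trans jx).
Qed.

Lemma borel_diag b i : borel b -> b i i != 0.
Proof.
move=> /borelP[bU bB]; move: bU; rewrite unitmxE -det_tr det_trig.
  by rewrite unitfE => /prodf_neq0/(_ i isT); rewrite mxE.
by apply/is_trig_mxP => m n mn; rewrite mxE bB.
Qed.

(* A is the matrix of a bijection moving every term of the standard flag into
   the next one, and not stabilizing exactly the terms of dimension in T. *)
Definition hessenberg T A : Prop :=
  [/\ A \in unitmx, forall i j : 'I_d, (j.+1 < i)%N -> A i j = 0
    & forall i j : 'I_d, i = j.+1 :> nat -> (A i j != 0) = ((i : nat) \in T)].

(** Only the diagonals of [b] and [b'] act below the diagonal: for [j < i] the entry [(i, j)] of the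
    product is [b i i * A i j * b' j j]. *)
Lemma hessenberg_borel T A b b' :
  borel b -> borel b' -> hessenberg T A -> hessenberg T (b *m A *m b').
Proof.
move=> Bb Bb' [AU A0 AT].
have [bU b0] := borelP _ Bb; have [b'U b'0] := borelP _ Bb'.
have bA (i j : 'I_d) : (j < i)%N -> (b *m A) i j = b i i * A i j.
  move=> ji; rewrite mxE (bigD1 i) //= big1 ?addr0 // => l li.
  have [il|il] := ltnP l i; first by rewrite b0 ?mul0r.
  have {}il : (i < l)%N.
    by rewrite ltn_neqAle il andbT; apply: contra_neq li => il'; apply: val_inj.
  by rewrite A0 ?mulr0 // (leq_trans _ il).
have bA0 (i j : 'I_d) : (j.+1 < i)%N -> (b *m A) i j = 0.
  by move=> ji; rewrite bA ?A0 ?mulr0 // ltnW.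
have bAb (i j : 'I_d) : (j < i)%N -> (b *m A *m b') i j = (b *m A) i j * b' j j.
  move=> ji; rewrite mxE (bigD1 j) //= big1 ?addr0 // => l lj.
  have [jl|jl] := ltnP j l; first by rewrite b'0 ?mulr0.
  rewrite bA0 ?mul0r //; apply: leq_ltn_trans ji.
  by rewrite ltn_neqAle jl andbT; apply: contra_neq lj => lj'; apply: val_inj.
split.
- by rewrite !unitmx_mul bU b'U AU.
- by move=> i j ji; rewrite bAb ?bA0 ?mul0r // ltnW.
move=> i j ij; rewrite bAb ?ij // bA ?ij // !mulf_eq0 !negb_or.
by rewrite !borel_diag // andbT AT -?ij.
Qed.

(** A common form of the matrix of [s_j] and of the transvection [1 + t E_(j, j-1)], rows being
    numbered from 0: upper triangular apart from one entry, with no condition on the diagonal in the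
    rows [j - 1] and [j], where that of [s_j] is zero. *)
Definition elementary (j : nat) y : Prop :=
  (forall i l : 'I_d, (l < i)%N -> ~ (i = j :> nat /\ l.+1 = j) -> y i l = 0) /\
  (forall i : 'I_d, i != j :> nat -> i.+1 != j -> y i i != 0).

(* Multiplying from the left by factors of decreasing positions creates the
   subdiagonal entries one by one; the last clause records that the leading
   diagonal entries are still those of a triangular matrix. *)
Definition partial_hessenberg (m : nat) (P : pred nat) M : Prop :=
  [/\ forall i j : 'I_d, (j.+1 < i)%N -> M i j = 0,
      forall i j : 'I_d, i = j.+1 :> nat -> (M i j != 0) = P i,
      forall x : nat, P x -> (m < x)%N
    & forall i : 'I_d, (i < m)%N -> M i i != 0].

(** As [M] is upper triangular in the rows up to [m], the entry [(c, a)] of [y] creates the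
    subdiagonal entry [y c a * M a a] in row [c], while the other subdiagonal entries are rescaled
    by diagonal entries of [y] or remain zero. *)
Lemma partial_hessenberg_mul m P M (a c : 'I_d) y :
  partial_hessenberg m P M -> (c : nat) = a.+1 -> (c <= m)%N -> elementary c y ->
  partial_hessenberg a (fun x => (x == c) && (y c a != 0) || P x) (y *m M).
Proof.
move=> [M0 MP Pm Md] ca cm [y0 yd].
have sub0 (i j : 'I_d) : (j < i)%N -> (i <= m)%N -> M i j = 0.
  move=> ji im; have [/eqP ij|ij] := boolP (i == j.+1 :> nat).
    apply/eqP; rewrite -[_ == _]negbK MP //; apply/negP => /Pm.
    by rewrite ltnNge im.
  by apply: M0; rewrite ltn_neqAle eq_sym ij.
have eqI (i j : 'I_d) : (i == j) = (i == j :> nat) by [].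
have low (i j : 'I_d) : (j < i)%N ->
    (y *m M) i j = y i i * M i j + (if i == c then y c a * M a j else 0).
  move=> ji; rewrite mxE (bigD1 i) //=; congr (_ + _).
  case: (eqVneq i c) ji => [-> ji|ic ji].
    rewrite (bigD1 a) /=; last by rewrite eqI ca; lia.
    rewrite big1 ?addr0 // => l /andP[lc la].
    have [l_lt|l_ge] := ltnP l c.
      by rewrite y0 ?mul0r // => -[_]; move: la; rewrite eqI; lia.
    by rewrite M0 ?mulr0 //; move: lc ji l_ge; rewrite eqI => lc ji l_ge; lia.
  rewrite big1 // => l li; have [l_lt|l_ge] := ltnP l i.
    by rewrite y0 ?mul0r // => -[] E; move: ic; rewrite eqI E eqxx.
  by rewrite M0 ?mulr0 //; move: li ji l_ge; rewrite eqI => li ji l_ge; lia.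
split.
- move=> i j ji; rewrite low ?(ltnW ji) // M0 // mulr0 add0r.
  by case: eqP => // ic; rewrite ic in ji; rewrite sub0 ?mulr0 //; lia.
- move=> i j ij; rewrite low; last by rewrite ij.
  have [ic|ic] := eqVneq i c.
    have -> : j = a by apply/val_inj; rewrite /= -ic in ca *; lia.
    rewrite ic sub0 ?ca // ?mulr0 ?add0r ?mulf_eq0; last by rewrite -ca.
    rewrite -ca eqxx negb_or Md; last by lia.
    rewrite andbT /=; have [/Pm|_] := boolP (P c); last by rewrite orbF.
    by rewrite ltnNge cm.
  rewrite addr0; have -> : (nat_of_ord i == c) = false by apply/negbTE; rewrite -eqI.
  rewrite /= -(MP i j ij) mulf_eq0 negb_or.
  have [/eqP ia|ia] := boolP (i == a).
    by rewrite [M i j]sub0 ?eqxx ?andbF //; move/(congr1 val): ia => /=; lia.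
  rewrite yd //; rewrite ?ca ?eqSS //; by rewrite -eqI.
- move=> x /orP[/andP[/eqP-> _]|/Pm]; first by rewrite ca.
  by rewrite ca in cm; move=> mx; lia.
move=> i ia; rewrite mxE (bigD1 i) //= big1 ?addr0.
  rewrite mulf_neq0 //; last by apply: Md; lia.
  by apply: yd; lia.
move=> l li; have [l_lt|l_ge] := ltnP l i.
  by rewrite y0 ?mul0r //; lia.
move: li; rewrite eqI => li; have [lm|lm] := leqP l m.
  by rewrite sub0 ?mulr0 //; lia.
by rewrite M0 ?mulr0 //; lia.
Qed.

Definition word T : 'S_d := (\prod_(j <- T) simple_refl d j)%g.

Lemma simple_reflE (a c : 'I_d) : (c : nat) = a.+1 -> simple_refl d c = tperm a c.
Proof.
by move=> ca; rewrite /simple_refl {1}ca /= (valK a) (valK c).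
Qed.

Lemma elementary_simple_refl (c : 'I_d) :
  (0 < c)%N -> elementary c (perm_mx (simple_refl d c) : 'M[k]_d).
Proof.
move=> c0; have ad : (c.-1 < d)%N by rewrite (leq_ltn_trans (leq_pred _)).
have ca : (c : nat) = (Ordinal ad).+1 by rewrite /= prednK.
rewrite (simple_reflE ca); split=> [i l li nil|i ic ic'].
  rewrite !mxE /=; case: tpermP => [/(congr1 val) /= E|/(congr1 val) /= E|_ _];
    case: eqP => // /(congr1 val) /= E'; [lia| |lia].
  by case: nil; lia.
rewrite !mxE /= tpermD ?eqxx ?oner_eq0 //.
  by rewrite eq_sym; apply: contra ic' => /eqP ->; rewrite /= prednK.
by rewrite eq_sym.
Qed.

(** Stated for elementary factors, so as to cover both a word in the simple reflections and a word
    some letters of which are replaced by transvections. *)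
Lemma hessenberg_prod (f : nat -> 'M[k]_d) (S : seq nat) m :
  path ltn m S -> (forall j, j \in S -> (j < d)%N /\ elementary j (f j)) ->
  (forall j, f j \in unitmx) ->
  hessenberg [seq j <- S | [exists i : 'I_d, [exists l : 'I_d,
      [&& i == j :> nat, l.+1 == j & f j i l != 0]]]]
    (\big[mulmx/1%:M]_(j <- S) f j).
Proof.
move=> Sm Sf fU.
pose E j := [exists i : 'I_d, [exists l : 'I_d,
      [&& i == j :> nat, l.+1 == j & f j i l != 0]]].
pose P (S0 : seq nat) : pred nat := fun j => (j \in S0) && E j.
have [M0 MP _ _] : partial_hessenberg m (P S) (\big[mulmx/1%:M]_(j <- S) f j).
  elim: S m Sm Sf => [|j S IH] m /= Sm Sf.
    rewrite big_nil; split=> // [i l il|i l il|i _].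
    - by rewrite !mxE; case: eqP => // E'; move: il; rewrite E'; lia.
    - rewrite mxE (_ : (i == l) = false) ?eqxx //.
      by apply/negbTE/eqP => E'; move: il; rewrite E'; lia.
    - by rewrite !mxE eqxx oner_eq0.
  case/andP: Sm => mj Sj.
  have [jd jel] := Sf j (mem_head _ _).
  have j0 : (0 < j)%N by apply: leq_ltn_trans mj.
  have ad : (j.-1 < d)%N by rewrite (leq_ltn_trans (leq_pred _)).
  have Sf' j' : j' \in S -> (j' < d)%N /\ elementary j' (f j').
    by move=> j'S; apply: Sf; rewrite inE j'S orbT.
  have := @partial_hessenberg_mul _ _ _ (Ordinal ad) (Ordinal jd) (f j) (IH _ Sj Sf').
  rewrite /= prednK // leqnn => /(_ erefl isT jel).
  rewrite big_cons; set M := (f j *m _) => -[M0 MP Pm Md].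
  have PE x : (x == j) && (f j (Ordinal jd) (Ordinal ad) != 0) || P S x = P (j :: S) x.
    rewrite /P inE andb_orl; congr (_ || _); have [->|//] := eqVneq x j.
    apply/idP/existsP => [fj|[i /existsP[l /and3P[/eqP ij /eqP lj fj]]]].
      exists (Ordinal jd); apply/existsP; exists (Ordinal ad).
      by rewrite /= prednK // !eqxx.
    have -> : Ordinal jd = i by apply: val_inj.
    by have -> : Ordinal ad = l by apply: val_inj; rewrite /= -lj.
  split=> // [i l il|x|i im].
  - by rewrite MP // PE.
  - rewrite -PE => /Pm /= jx; lia.
  - by apply: Md => /=; lia.
split=> // [|i j ij].
  by elim/big_ind: _ => [|x y xU yU|i _]; rewrite ?unitmx1 ?unitmx_mul ?xU.
by rewrite MP // /P /= mem_filter andbC.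
Qed.

Lemma perm_mx_word T :
  perm_mx (word T) = \big[mulmx/1%:M]_(j <- T) perm_mx (simple_refl d j) :> 'M[k]_d.
Proof.
rewrite /word; elim: T => [|j T IH]; first by rewrite !big_nil perm_mx1.
by rewrite !big_cons perm_mxM IH.
Qed.

Definition bruhat_cell (w : 'S_d) A : Prop :=
  exists b b', [/\ borel b, borel b' & A = b *m perm_mx w *m b'].

Lemma bruhat_hessenberg T A : path ltn 0%N T -> all (gtn d) T ->
  bruhat_cell (word T) A -> hessenberg T A.
Proof.
move=> T0 Td [b [b' [Bb Bb' ->]]]; apply: hessenberg_borel => //.
rewrite perm_mx_word.
have Tel j : j \in T -> (j < d)%N /\ (0 < j)%N.
  move=> jT; split; first by move/allP: Td; apply.
  by have /allP/(_ j jT) := order_path_min ltn_trans T0.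
have := @hessenberg_prod (fun j => perm_mx (simple_refl d j)) _ _ T0.
rewrite (all_filterP _) //; first apply.
- move=> j /Tel[jd j0]; split=> //.
  exact: (@elementary_simple_refl (Ordinal jd)).
- by move=> j; apply: unitmx_perm.
apply/allP => j /Tel[jd j0].
have ad : (j.-1 < d)%N by rewrite (leq_ltn_trans (leq_pred _)).
apply/existsP; exists (Ordinal jd); apply/existsP; exists (Ordinal ad).
rewrite /= prednK // !eqxx /= -[X in simple_refl _ X]/(nat_of_ord (Ordinal jd)).
rewrite (@simple_reflE (Ordinal ad)) /= ?prednK //.
by rewrite !mxE tpermR eqxx oner_eq0.
Qed.

Let transvection (a c : 'I_d) (t : k) : 'M[k]_d := 1%:M + t *: delta_mx a c.

Let transvectionE a c t A i l :
  (transvection a c t *m A) i l = A i l + (if i == a then t * A c l else 0).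
Proof.
rewrite mulmxDl mul1mx -scalemxAl !mxE; congr (_ + _).
rewrite (bigD1 c) //= big1 ?addr0 => [|m mc]; last by rewrite mxE (negPf mc) andbF mul0r.
by rewrite mxE eqxx andbT; case: eqP; rewrite ?mul1r // mul0r mulr0.
Qed.

Let transvectionK a c t A : a != c ->
  transvection a c (- t) *m (transvection a c t *m A) = A.
Proof.
move=> ac; apply/matrixP => i l; rewrite !transvectionE.
case: eqP => [->|]; last by rewrite !addr0.
by rewrite [c == a]eq_sym (negPf ac) addr0 mulNr addrK.
Qed.

Let borel_transvection (a c : 'I_d) t : (a < c)%N -> borel (transvection a c t).
Proof.
move=> ac; have ac' : a != c by apply: contraTneq ac => ->; rewrite ltnn.
apply/borelP; split=> [|i j ji].
  suff /mulmx1_unit[] : transvection a c (- t) *m transvection a c t = 1%:M by [].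
  by rewrite -[X in _ *m X]mulmx1 transvectionK.
rewrite -[transvection _ _ _]mulmx1 transvectionE !mxE.
have -> : (i == j) = false by apply/negbTE; apply: contraTneq ji => ->; rewrite ltnn.
case: eqP => [ia|]; rewrite ?addr0 // add0r.
by case: eqP => [cj|]; rewrite ?mulr0 //; move: ji; rewrite ia -cj; lia.
Qed.

(* By induction on the word: a row operation followed by s_j clears the first
   subdiagonal entry, and s_j moves past a factor of the Borel subgroup whose
   rows up to j are those of the identity. *)
Let hessenberg_bruhat_rows T m A : path ltn m T -> all (gtn d) T ->
  hessenberg T A ->
  exists b b', [/\ borel b, borel b', A = b *m perm_mx (word T) *m b' &
    forall i l : 'I_d, (i < m)%N -> b i l = (i == l)%:R].
Proof.
elim: T m A => [|j T IH] m A /=.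
  move=> _ _ [AU A0 A1]; exists 1%:M, A; split.
  - exact: parabolic1.
  - apply/borelP; split=> // i l; rewrite leq_eqVlt => /predU1P[E|/A0//].
    by apply/eqP; rewrite -[_ == _]negbK A1.
  - by rewrite /word big_nil perm_mx1 !mul1mx.
  - by move=> i l _; rewrite mxE.
move=> /andP[mj jT] /andP[jd Td] [AU A0 A1].
have j0 : (0 < j)%N by apply: leq_ltn_trans mj.
have ad : (j.-1 < d)%N by rewrite (leq_ltn_trans (leq_pred _)).
pose a := Ordinal ad; pose c := Ordinal jd.
have caE : (c : nat) = a.+1 by rewrite /= prednK.
have aclt : (a < c)%N by rewrite caE.
have ac : a != c by apply/eqP => /(congr1 val) /=; lia.
have b0 : A c a != 0 by rewrite A1 // mem_head.
have jT' x : x \in T -> (j < x)%N.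
  by move=> xT; have /allP/(_ x xT) := order_path_min ltn_trans jT.
have aT : (a : nat) \notin j :: T.
  rewrite inE negb_or; apply/andP; split; first by rewrite /=; lia.
  by apply/negP => /jT' /=; lia.
(* [t] clears the entry [(a, a)], which the exchange of the rows [a] and [c] brings to the
   subdiagonal position [(c, a)]: the letter [j] disappears from the word of [A']. *)
pose t := - (A a a / A c a); pose s := tperm a c.
pose A' := row_perm s (transvection a c t *m A).
have A'E i l : A' i l = if i == a then A c l else
    if i == c then A a l + t * A c l else A i l.
  rewrite /A' mxE transvectionE /s; case: tpermP => [->|->|/eqP ia /eqP ic].
  - by rewrite eq_sym (negPf ac) addr0 eqxx.
  - by rewrite eqxx eq_sym (negPf ac) eqxx.
  - by rewrite (negPf ia) (negPf ic) addr0.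
have lowA (i l : 'I_d) : (l < i)%N -> (i <= a)%N -> A i l = 0.
  move=> li ia; have [E|E] := eqVneq (i : nat) l.+1; last by apply: A0; lia.
  apply/eqP; rewrite -[_ == _]negbK A1 //; apply/negP.
  rewrite inE => /orP[/eqP iE|/jT' iE]; move: ia; rewrite /=; lia.
have /(IH j A' jT Td)[b [b' [Bb Bb' A'b bI]]] : hessenberg T A'.
  split.
  - rewrite /A' row_permE !unitmx_mul unitmx_perm AU.
    by have [-> _] := borelP _ (borel_transvection t aclt).
  - move=> i l li; rewrite A'E; case: eqP => [ia|_].
      by rewrite A0 // caE -ia ltnW.
    case: eqP => [ic|_]; last exact: A0.
    rewrite ic caE in li; rewrite lowA // add0r [A c l]A0 ?mulr0 //.
    by rewrite caE.
  - move=> i l il; rewrite A'E; have [ia|ia] := eqVneq i a.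
      rewrite A0 ?eqxx; last by rewrite caE -ia il.
      by apply/esym/negbTE; move: aT; rewrite ia inE negb_or => /andP[].
    have [ic|ic] := eqVneq i c.
      have -> : l = a by apply/val_inj/esym; move: il; rewrite ic caE => -[].
      rewrite /t mulNr divfK // subrr eqxx; apply/esym/negbTE.
      by apply/negP; rewrite ic => /jT' /=; rewrite ltnn.
    by rewrite A1 // inE -[j]/(nat_of_ord c) (inj_eq val_inj) (negPf ic).
pose b1 := row_perm s (col_perm s b).
have b1E i l : b1 i l = b (s i) (s l) by rewrite !mxE.
have sE : perm_mx (simple_refl d j) = perm_mx s :> 'M[k]_d.
  by rewrite -[j]/(nat_of_ord c) (simple_reflE caE).
have b1s : b1 *m perm_mx s = perm_mx s *m b.
  rewrite /b1 row_permE col_permE tpermV -!mulmxA -perm_mxM tperm2 perm_mx1.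
  by rewrite mulmx1.
have AE : A = transvection a c (- t) *m b1 *m perm_mx (word (j :: T)) *m b'.
  rewrite /word big_cons perm_mxM sE -/(word T) !mulmxA -[_ *m b1 *m _]mulmxA b1s.
  rewrite -!mulmxA [b *m _]mulmxA -A'b /A' row_permE [perm_mx s *m (perm_mx s *m _)]mulmxA.
  by rewrite -perm_mxM tperm2 perm_mx1 mul1mx transvectionK.
have [bU bB] := borelP _ Bb.
exists (transvection a c (- t) *m b1), b'; split=> //.
- apply: parabolicM; first exact: borel_transvection.
  apply/borelP; split.
    by rewrite /b1 row_permE col_permE !unitmx_mul !unitmx_perm bU.
  move=> i l li; rewrite b1E.
  case: (tpermP a c i) li => [->|->|/eqP ia /eqP ic] li;
    case: (tpermP a c l) li => [->|->|/eqP la /eqP lc] li.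
  - by rewrite ltnn in li.
  - by move: li; rewrite caE ltnNge leqnSn.
  - exact/bB/(ltn_trans li).
  - by rewrite (bI _ _ aclt) (negPf ac).
  - by rewrite ltnn in li.
  - by apply: bB; rewrite ltn_neqAle -ltnS -caE li andbT; exact: la.
  - by apply: bB; rewrite ltn_neqAle caE li andbT -caE eq_sym; exact: ic.
  - exact/bB/(ltn_trans aclt).
  - exact: bB.
move=> i l im; rewrite transvectionE.
have ia : (i < a)%N by rewrite /=; move: im mj; clear; lia.
have [ia' ic'] : i != a /\ i != c.
  by split; apply: contraTneq ia => ->; rewrite -leqNgt ?caE ?leqnSn.
rewrite (negPf ia') addr0 b1E /s tpermD 1?eq_sym // bI; last exact: ltn_trans ia aclt.
by rewrite [l == i]eq_sym; case: tpermP => // ->; rewrite (negPf ia') (negPf ic').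
Qed.

Lemma bruhatP T A : path ltn 0%N T -> all (gtn d) T ->
  bruhat_cell (word T) A <-> hessenberg T A.
Proof.
move=> T0 Td; split; first exact: bruhat_hessenberg.
by case/(hessenberg_bruhat_rows T0 Td) => b [b' [? ? ? _]]; exists b, b'.
Qed.

End Hessenberg.

(** * Fixed vectors of Frobenius-semilinear maps *)

Section SemilinearFixedVector.
Variables (k : closedFieldType) (Q : nat) (phi : {rmorphism k -> k}).
Hypotheses (Q_gt1 : (1 < Q)%N) (phiE : forall x, phi x = x ^+ Q).
Variables (V : vectType k) (rho : V -> V).
Hypotheses (rhoD : {morph rho : x y / x + y}).
Hypotheses (rhoZ : forall a v, rho (a *: v) = phi a *: rho v).
Hypotheses (rho_inj : forall v, rho v = 0 -> v = 0).

Let rho0 : rho 0 = 0. Proof. by rewrite -[in LHS](scale0r 0) rhoZ rmorph0 scale0r. Qed.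

(* The coefficients of a fixed vector on v, rho v, ..., rho^(n-1) v are the
   values at z of the polynomials p_i, where z is a nonzero root of p_(n-1) - X. *)
Fixpoint lang_poly (c : nat -> k) (i : nat) : {poly k} :=
  if i is i'.+1 then lang_poly c i' ^+ Q + c i *: 'X^Q else c 0%N *: 'X^Q.

Let size_lang_poly c i : (Q < size (lang_poly c i))%N \/
  forall j, (j <= i)%N -> c j = 0.
Proof.
have sX a : a != 0 -> size (a *: 'X^Q : {poly k}) = Q.+1.
  by move=> a0; rewrite size_scale // size_polyXn.
elim: i => [|i [IH|IH]] /=.
- have [c0|c0] := eqVneq (c 0%N) 0; last by left; rewrite sX.
  by right=> j; rewrite leqn0 => /eqP->.
- left; rewrite size_polyDl.
    rewrite (leq_trans IH) //; case: (size (lang_poly c i)) IH (size_exp (lang_poly c i) Q) => // s.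
    rewrite /= ltnS => Qs; case: (size _) => [|u] /= ->; nia.
  apply: (@leq_ltn_trans Q.+1); first by apply: leq_trans (size_scale_leq _ _) _; rewrite size_polyXn.
  case: (size (lang_poly c i)) IH (size_exp (lang_poly c i) Q) => // s.
  rewrite /= ltnS => Qs; case: (size _) => [|u] /= ->; nia.
have -> : lang_poly c i = 0.
  elim: i IH => [|i IHi] IH /=; first by rewrite IH ?scale0r.
  rewrite IHi => [|j ji]; last by rewrite IH // ltnW.
  by rewrite IH // scale0r addr0 expr0n -leqn0 leqNgt ltnW.
rewrite expr0n (_ : (Q == 0)%N = false) ?add0r; last by apply/negbTE; lia.
have [ci|ci] := eqVneq (c i.+1) 0; last by left; rewrite sX.
by right=> j; rewrite leq_eqVlt => /predU1P[->|/IH].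
Qed.

(** Divisibility by [X^2] gives [lang_poly c i - X = X (X r - 1)], whose second factor has a root,
    necessarily nonzero, when [r] is nonzero. *)
Let dvd_lang_poly c i : exists r, lang_poly c i = 'X^2 * r.
Proof.
have XQ : 'X^Q = 'X^2 * 'X^(Q - 2) :> {poly k} by rewrite -exprD subnKC.
elim: i => [|i [r IH]] /=; first by exists (c 0%N *: 'X^(Q - 2)); rewrite XQ scalerAr.
exists (lang_poly c i ^+ Q.-1 * r + c i.+1 *: 'X^(Q - 2)).
rewrite mulrDr mulrCA -IH XQ scalerAr -exprSr; congr (_ ^+ _ + _); lia.
Qed.

(** Let the [c i] express the first dependent iterate of [v]. Being fixed amounts to
    [a 0 = c 0 * a m ^ Q] and [a i = a (i-1) ^ Q + c i * a m ^ Q]: with [z = a m] this is the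
    recursion of [lang_poly], closed by the equation saying that [lang_poly c m] takes the value [z]
    at [z]. The expansion of [w] is part of the conclusion since it makes [w] inherit linear
    conditions stable under [rho]. *)
Lemma semilinear_fixed_vector v : v != 0 -> exists w n (a : nat -> k),
  [/\ w != 0, rho w = w & w = \sum_(i < n) a i *: iter i rho v].
Proof.
move=> v0; pose s n := mkseq (fun i => iter i rho v) n.
have sS n : s n.+1 = rcons (s n) (iter n rho v) by rewrite /s /mkseq -[n.+1]addn1 iotaD map_cat cats1.
have s_free n : (forall m, (m < n)%N -> iter m rho v \notin <<s m>>%VS) -> free (s n).
  elim: n => [_|n IH H]; first by rewrite nil_free.
  rewrite sS (perm_free (_ : perm_eq _ (iter n rho v :: s n))) ?perm_rcons //.
  by rewrite free_cons H ?IH // => m mn; apply/H/ltnW.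
have exn : exists n, iter n rho v \in <<s n>>%VS.
  apply: contrapT => nex; have := s_free (\dim {:V}).+1.
  move=> /(_ _)/wrap[m _|]; first by apply/negP => H; apply: nex; exists m.
  rewrite /free size_mkseq => /eqP E.
  by have := dimvS (subvf <<s (\dim {:V}).+1>>%VS); rewrite E ltnn.
case: (ex_minnP exn) => -[|m] vm mmin.
  by move: vm; rewrite span_nil memv0 (negPf v0).
have fm : free (s m.+1).
  by apply: s_free => i im; apply/negP => /mmin; rewrite leqNgt im.
pose X := [tuple of s m.+1].
have X_i (i : 'I_m.+1) : X`_i = iter i rho v by rewrite nth_mkseq.
pose c i := if insub i is Some j then coord X j (iter m.+1 rho v) else 0.
have c_i (i : 'I_m.+1) : c i = coord X i (iter m.+1 rho v) by rewrite /c valK.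
have vE : iter m.+1 rho v = \sum_(i < m.+1) c i *: iter i rho v.
  rewrite {1}(coord_span (X := X) vm); apply: eq_bigr => i _.
  by rewrite c_i X_i.
have [|c0] := size_lang_poly c m; last first.
  have/eqP := vE; rewrite big1 => [|i _]; last by rewrite c0 ?scale0r // -ltnS.
  by elim: m.+1 => [|n IH] /= => [|/eqP/rho_inj/eqP//]; rewrite (negPf v0).
move=> sp; have [r rE] := dvd_lang_poly c m.
have r0 : r != 0 by apply: contraTneq sp => r0; rewrite rE r0 mulr0 size_poly0.
have [z zr] : exists z, root ('X * r - 1) z.
  apply/closed_rootP; rewrite size_polyDl; rewrite ?size_polyN ?size_poly1 mulrC size_mulX //.
    by rewrite eqSS size_poly_eq0.
  by rewrite ltnS size_poly_gt0.
have {}zr : z * r.[z] = 1.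
  by move/rootP: zr; rewrite hornerD hornerN hornerC hornerM hornerX => /eqP; rewrite subr_eq0 => /eqP.
have z0 : z != 0 by apply: contra_eq_neq zr => ->; rewrite mul0r eq_sym oner_neq0.
have pz : (lang_poly c m).[z] = z.
  by rewrite rE hornerM hornerXn expr2 -mulrA zr mulr1.
pose a i := (lang_poly c i).[z].
exists (\sum_(i < m.+1) a i *: iter i rho v), m.+1, a; split=> //.
  apply: contra_neq z0 => w0; rewrite -pz.
  have /freeP/(_ (fun i : 'I_m.+1 => a i)) H : free X by exact: fm.
  apply: (H _ ord_max); rewrite -[RHS]w0; apply: eq_bigr => i _.
  by rewrite X_i.
rewrite (big_morph rho rhoD rho0).
under eq_bigr do rewrite rhoZ -iterS.
rewrite big_ord_recr /= -iterS vE (pz : a m = z) phiE scaler_sumr.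
rewrite [X in _ + X]big_ord_recl [RHS]big_ord_recl /= addrCA; congr (_ + _).
  by rewrite scalerA /a /= hornerZ hornerXn mulrC.
rewrite -big_split /=; apply: eq_bigr => i _.
rewrite scalerA -scalerDl /a /= hornerD horner_exp hornerZ hornerXn phiE.
by rewrite [_ * z ^+ Q]mulrC.
Qed.

End SemilinearFixedVector.

(** * Refinement of self-dual partial flags *)

Section SesquilinearForm.
Variables (k : closedFieldType) (q : nat) (Fr : {rmorphism k -> k}).
Hypotheses (q_gt1 : (1 < q)%N) (FrE : forall x, Fr x = x ^+ q).

Let unitmx_inj n (G : 'M[k]_n) :
  (forall x : 'rV_n, x *m G = 0 -> x = 0) -> G \in unitmx.
Proof.
move=> G_inj; rewrite -row_free_unit -kermx_eq0; apply/eqP/row_matrixP => i.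
by rewrite row0; apply: G_inj; rewrite -row_mul mulmx_ker row0.
Qed.

(** The form is hermitian on the vectors fixed by [rho]. From two orthogonal non-isotropic fixed
    vectors [u] and [w], one forms [l u + w] with [l^(q+1) = - h(w,w) / h(u,u)]; the right side is
    fixed by the Frobenius, which gives [l^(q^2) = l], so that this vector is again fixed. *)
Lemma isotropic_fixed_vector (V : vectType k) (rho : V -> V) (h : V -> V -> k) :
  {morph rho : x y / x + y} -> (forall a v, rho (a *: v) = Fr (Fr a) *: rho v) ->
  (forall v, rho v = 0 -> v = 0) ->
  (forall z, {morph h^~ z : x y / x + y}) -> (forall a x z, h (a *: x) z = a * h x z) ->
  (forall x z, h (rho x) z = Fr (h z x)) -> (1 < \dim {:V})%N ->
  exists x, [/\ x != 0, rho x = x & h x x = 0].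
Proof.
move=> rhoD rhoZ rho_inj hD hZ h_rho V_gt1.
have fix_h x y : rho x = x -> h x y = Fr (h y x) by move=> xE; rewrite -h_rho xE.
have fixed v : v != 0 -> exists w n (a : nat -> k),
    [/\ w != 0, rho w = w & w = \sum_(i < n) a i *: iter i rho v].
  apply: (@semilinear_fixed_vector _ (q * q) (Fr \o Fr)) => //; first nia.
  by move=> x; rewrite /= !FrE exprM.
have h0 z : h 0 z = 0 by rewrite -[in LHS](scale0r (0 : V)) hZ mul0r.
have [u0 u00] : exists u : V, u != 0.
  exists (vpick {:V}); rewrite vpick0 -dimv_eq0 -lt0n; exact: ltnW.
have [u [_ [_ [u_neq0 uE _]]]] := fixed _ u00.
have [huu|huu] := eqVneq (h u u) 0; first by exists u.
have [v0 v00 hv0] : exists2 v, v != 0 & h v u = 0.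
  have /subvPn[v _ vu] : ~~ (fullv <= <[u]>)%VS.
    by apply/negP => /dimvS; rewrite leqNgt (leq_trans _ V_gt1) // ltnS dim_vline leq_b1.
  exists (v - (h v u / h u u) *: u).
    by apply: contraNneq vu => /eqP; rewrite subr_eq0 => /eqP ->; rewrite memvZ ?memv_line.
  by rewrite hD -scaleNr hZ mulNr divfK // subrr.
have [w [n [a [w0 wE w_v]]]] := fixed _ v00.
have hwu : h w u = 0.
  rewrite w_v (big_morph (h^~ u) (hD u) (h0 u)) big1 // => i _.
  rewrite hZ (_ : h _ u = 0) ?mulr0 //.
  elim: (i : nat) => //= m IH.
  by rewrite h_rho fix_h // IH !rmorph0.
have huw : h u w = 0 by rewrite fix_h // hwu rmorph0.
have [hww|hww] := eqVneq (h w w) 0; first by exists w.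
pose c := - (h w w / h u u).
have c0 : c != 0 by rewrite oppr_eq0 mulf_neq0 ?invr_eq0.
have Frc : Fr c = c by rewrite rmorphN fmorph_div -!fix_h.
have [l lc] : exists l, l * Fr l = c.
  have: size ('X^(q.+1) - c%:P) != 1%N by rewrite size_XnsubC.
  case/closed_rootP => l /rootP; rewrite hornerD hornerN hornerC hornerXn => /eqP.
  by rewrite subr_eq0 exprS -FrE => /eqP; exists l.
have l0 : l != 0 by apply: contraNneq c0 => l0; rewrite -lc l0 mul0r.
have FrFrl : Fr (Fr l) = l.
  apply: (@mulfI _ (Fr l)); first by rewrite fmorph_eq0.
  by rewrite -rmorphM lc Frc -lc mulrC.
exists (l *: u + w); have xE : rho (l *: u + w) = l *: u + w.
  by rewrite rhoD rhoZ uE wE FrFrl.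
split=> //.
  apply/eqP => x0; have := h0 u; rewrite -x0 hD hZ hwu addr0 => /eqP.
  by rewrite mulf_eq0 (negPf l0) (negPf huu).
have hl z : h (l *: u + w) z = l * h u z + h w z by rewrite hD hZ.
rewrite hl [h u _]fix_h // [h w (_ + _)]fix_h // !hl hwu huw mulr0 addr0 add0r.
rewrite rmorphM -!fix_h // mulrA lc /c mulNr divfK // addNr //.
Qed.

Variables (V : vectType k) (B : V -> V -> k).
Hypotheses (BDl : forall z, {morph B^~ z : x y / x + y})
  (BZl : forall a x z, B (a *: x) z = a * B x z)
  (BDr : forall x, {morph B x : y z / y + z})
  (BZr : forall a x z, B x (a *: z) = Fr a * B x z)
  (B_nondeg : forall x, (forall y, B x y = 0) -> x = 0).
Implicit Types U W : {vspace V}.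

Let B0l z : B 0 z = 0.
Proof. by rewrite -(scale0r (0 : V)) BZl mul0r. Qed.
Let B0r x : B x 0 = 0.
Proof. by rewrite -(scale0r (0 : V)) BZr rmorph0 mul0r. Qed.
Let Bsumr x (I : Type) (r : seq I) (P : pred I) (f : I -> V) :
  B x (\sum_(i <- r | P i) f i) = \sum_(i <- r | P i) B x (f i).
Proof. exact: (big_morph (B x) (BDr x) (B0r x)). Qed.
Let Bsuml z (I : Type) (r : seq I) (P : pred I) (f : I -> V) :
  B (\sum_(i <- r | P i) f i) z = \sum_(i <- r | P i) B (f i) z.
Proof. exact: (big_morph (B^~ z) (BDl z) (B0l z)). Qed.

Let gram_fun U (x : V) : 'rV[k]_(\dim U) := \row_i B x (vbasis U)`_i.
Let gram_fun_linear U : linear (gram_fun U).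
Proof. by move=> a x y; apply/rowP => i; rewrite !mxE BDl BZl. Qed.
HB.instance Definition _ U :=
  GRing.isLinear.Build k V 'rV[k]_(\dim U) _ (gram_fun U) (gram_fun_linear U).

(** The left orthogonal. [B] is not assumed to be reflexive, and [perp] is in general not an
    involution. *)
Definition perp U : {vspace V} := lker (linfun (gram_fun U)).

Lemma perpP U x : reflect (forall u, u \in U -> B x u = 0) (x \in perp U).
Proof.
rewrite memv_ker lfunE /=; apply: (iffP eqP) => [xU u uU|xU].
  rewrite (coord_vbasis uU) Bsumr big1 // => i _; rewrite BZr.
  by have /rowP/(_ i) := xU; rewrite !mxE => ->; rewrite mulr0.
by apply/rowP => i; rewrite !mxE xU // vbasis_mem // mem_nth // size_tuple.
Qed.

Lemma perpS U W : (U <= W)%VS -> (perp W <= perp U)%VS.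
Proof.
move=> UW; apply/subvP => x /perpP xW; apply/perpP => u uU.
by apply/xW/(subvP UW).
Qed.

Lemma perpD U W : perp (U + W) = (perp U :&: perp W)%VS.
Proof.
apply/eqP; rewrite eqEsubv subv_cap !perpS ?addvSl ?addvSr //=.
apply/subvP => x /memv_capP[/perpP xU /perpP xW]; apply/perpP => _ /memv_addP[u uU [w wW ->]].
by rewrite BDr xU ?xW ?addr0.
Qed.

Lemma perpf : perp fullv = 0%VS.
Proof.
apply/eqP; rewrite -subv0; apply/subvP => x /perpP xV; rewrite memv0.
by apply/eqP/B_nondeg => y; apply/xV/memvf.
Qed.

(** Counting equations gives one inequality for every subspace; applied to [U] and to a complement,
    whose orthogonals meet only in 0, it gives equality. *)
Lemma dim_perp U : \dim (perp U) = (\dim {:V} - \dim U)%N.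
Proof.
have ge W : (\dim {:V} <= \dim (perp W) + \dim W)%N.
  rewrite -(limg_ker_dim (linfun (gram_fun W)) fullv) capfv leq_add2l.
  by apply: leq_trans (dimvS (subvf _)) _; rewrite dimvf /dim /= mul1n.
have := ge U; have := ge (U^C)%VS.
have : (\dim (perp U) + \dim (perp U^C) <= \dim {:V})%N.
  rewrite -dimv_sum_cap -perpD addv_complf perpf dimv0 addn0.
  exact/dimvS/subvf.
have := dimv_compl U; have := dimvS (subvf U); lia.
Qed.

Lemma perp0 : perp 0 = fullv.
Proof. by apply/eqP; rewrite eqEdim subvf dim_perp dimv0 subn0 leqnn. Qed.

(* Two segments A < B', Y < Y' of a flag on which U |-> Y + perp U and
   U' |-> A + perp U' are order-reversing maps. *)
Definition dual_segments (A B' Y Y' : {vspace V}) : Prop :=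
  [/\ (perp Y + A = B')%VS, (perp Y :&: A = perp Y')%VS,
      (perp A + Y = Y')%VS & (perp A :&: Y = perp B')%VS].

(** Complements [M] of [perp Y'] in [perp Y] and [M'] of [perp B'] in [perp A] represent [B'/A] and
    [Y'/Y], and [B] pairs them perfectly on both sides. Hence [B (rho x) z = Fr (B z x)], for [x] in
    [M] and [z] in [M'], defines an injective semilinear [rho] on [M]. A fixed vector [v] gives
    [U = A + <v>] and [U' = Y + perp U], and being fixed makes it orthogonal to [U']. When the two
    segments coincide, an isotropic [v] gives the inclusion of [U] in [U']. *)
Lemma refine_dual_segments A B' Y Y' :
  dual_segments A B' Y Y' -> ((\dim A).+1 < \dim B')%N ->
  exists U U', [/\ (A <= U <= B')%VS, (Y <= U' <= Y')%VS,
    \dim U = (\dim A).+1 /\ (\dim U').+1 = \dim Y',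
    U = (A + perp U')%VS /\ U' = (Y + perp U)%VS &
    A = Y -> B' = Y' -> (U <= U')%VS].
Proof.
move=> [YA YA' AY AY'] AB.
pose M := (perp Y :\: perp Y')%VS; pose M' := (perp A :\: perp B')%VS.
have dV W : (\dim W <= \dim {:V})%N := dimvS (subvf W).
have Y'Y : (perp Y' <= perp Y)%VS by rewrite -YA' capvSl.
have B'A : (perp B' <= perp A)%VS by rewrite -AY' capvSl.
have Y'A : (perp Y' <= A)%VS by rewrite -YA' capvSr.
have B'Y : (perp B' <= Y)%VS by rewrite -AY' capvSr.
have dYA := dimv_sum_cap (perp Y) A; rewrite YA YA' !dim_perp in dYA.
have dAY := dimv_sum_cap (perp A) Y; rewrite AY AY' !dim_perp in dAY.
have dM : (\dim M + \dim (perp Y') = \dim (perp Y))%N.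
  by have := dimv_cap_compl (perp Y) (perp Y'); rewrite (capv_idPr Y'Y) addnC.
have dM' : (\dim M' + \dim (perp B') = \dim (perp A))%N.
  by have := dimv_cap_compl (perp A) (perp B'); rewrite (capv_idPr B'A) addnC.
rewrite !dim_perp in dM dM'.
have := dV A; have := dV B'; have := dV Y; have := dV Y' => dVY' dVY dVB' dVA.
have dMM' : \dim M' = \dim M by clear -dM dM' dYA dAY dVY dVY' dVA dVB'; lia.
have YM' : (Y + M')%VS = Y'.
  apply/eqP; rewrite eqEsubv -{1}AY addvC addvS ?diffvSl //= -AY.
  rewrite -{1}(addv_diff_cap (perp A) (perp B')) (capv_idPr B'A).
  by rewrite -addvA [(_ + Y)%VS](addv_idPr B'Y).
have AM : (A + M)%VS = B'.
  apply/eqP; rewrite eqEsubv -{1}YA addvC addvS ?diffvSl //= -YA.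
  rewrite -{1}(addv_diff_cap (perp Y) (perp Y')) (capv_idPr Y'Y).
  by rewrite -addvA [(_ + A)%VS](addv_idPr Y'A).
have MY : (M <= perp Y)%VS := diffvSl _ _.
have M'A : (M' <= perp A)%VS := diffvSl _ _.
have pair1 m : m \in M -> (forall z, z \in M' -> B m z = 0) -> m = 0.
  move=> mM mM'; apply/eqP; rewrite -memv0 -(capv_diff (perp Y) (perp Y')).
  rewrite memv_cap mM -YM' perpD memv_cap (subvP MY) //=.
  by apply/perpP.
have pair2 m : m \in M' -> (forall z, z \in M -> B m z = 0) -> m = 0.
  move=> mM mM'; apply/eqP; rewrite -memv0 -(capv_diff (perp A) (perp B')).
  rewrite memv_cap mM -AM perpD memv_cap (subvP M'A) //=.
  by apply/perpP.
pose X (i : 'I_(\dim M)) := (vbasis M)`_i; pose X' (i : 'I_(\dim M)) := (vbasis M')`_i.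
have XM i : X i \in M by apply/vbasis_mem/mem_nth; rewrite size_tuple.
have XM' i : X' i \in M' by apply/vbasis_mem/mem_nth; rewrite size_tuple dMM'.
pose vX (x : 'rV[k]_(\dim M)) := \sum_i x 0 i *: X i.
pose vX' (x : 'rV[k]_(\dim M)) := \sum_i x 0 i *: X' i.
have vXM x : vX x \in M by apply: rpred_sum => i _; apply: rpredZ.
have vXM' x : vX' x \in M' by apply: rpred_sum => i _; apply: rpredZ.
have vXsurj m : m \in M -> exists x, m = vX x.
  move=> mM; exists (\row_i coord (vbasis M) i m); rewrite {1}(coord_vbasis mM).
  by apply: eq_bigr => i _; rewrite mxE.
have vXsurj' m : m \in M' -> exists x, m = vX' x.
  rewrite /vX' /X' -dMM' => mM; exists (\row_i coord (vbasis M') i m); rewrite {1}(coord_vbasis mM).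
  by apply: eq_bigr => i _; rewrite mxE.
have vX0 x : vX x = 0 -> x = 0.
  move=> x0; apply/rowP => i; rewrite mxE.
  by have /freeP/(_ (fun i => x 0 i) x0 i) := basis_free (vbasisP M).
have vX0' x : vX' x = 0 -> x = 0.
  move: x; rewrite /vX' /X' -dMM' => x x0; apply/rowP => i; rewrite mxE.
  by have /freeP/(_ (fun i => x 0 i) x0 i) := basis_free (vbasisP M').
pose G1 := \matrix_(i, j) B (X i) (X' j); pose G2 := \matrix_(i, j) B (X' i) (X j).
have BX x z : B (vX x) (vX' z) = (x *m G1 *m (map_mx Fr z)^T) 0 0.
  rewrite Bsumr mxE; apply: eq_bigr => j _; rewrite BZr Bsuml !mxE mulrC.
  by congr (_ * _); apply: eq_bigr => i _; rewrite BZl mxE.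
have BX' x z : B (vX' x) (vX z) = (x *m G2 *m (map_mx Fr z)^T) 0 0.
  rewrite Bsumr mxE; apply: eq_bigr => j _; rewrite BZr Bsuml !mxE mulrC.
  by congr (_ * _); apply: eq_bigr => i _; rewrite BZl mxE.
have G1U : G1 \in unitmx.
  apply: unitmx_inj => x x0; apply/vX0/pair1 => // _ /vXsurj'[z ->].
  by rewrite BX x0 mul0mx mxE.
have G2U : G2 \in unitmx.
  apply: unitmx_inj => x x0; apply/vX0'/pair2 => // _ /vXsurj[z ->].
  by rewrite BX' x0 mul0mx mxE.
pose rho (x : 'rV_(\dim M)) := map_mx Fr (G2 *m (map_mx Fr x)^T)^T *m invmx G1.
have rhoD : {morph rho : x y / x + y}.
  by move=> x y; rewrite /rho map_mxD linearD /= mulmxDr linearD /= map_mxD mulmxDl.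
have rhoZ a x : rho (a *: x) = Fr (Fr a) *: rho x.
  by rewrite /rho map_mxZ linearZ /= -scalemxAr linearZ /= map_mxZ scalemxAl.
have rhoB x z : B (vX (rho x)) (vX' z) = Fr (B (vX' z) (vX x)).
  rewrite BX BX' mulmxKV // -[in RHS]mulmxA; move: (G2 *m _) => y.
  by rewrite -map_trmx -trmx_mul -map_mxM mxE mxE.
have rho_inj x : rho x = 0 -> x = 0.
  move/(congr1 (mulmx^~ G1)); rewrite mulmxKV // mul0mx => /eqP.
  rewrite map_mx_eq0 trmx_eq0 => /eqP/(congr1 (mulmx (invmx G2))).
  by rewrite mulKmx // mulmx0 => /eqP; rewrite trmx_eq0 map_mx_eq0 => /eqP.
have [w [w0 wE w_iso]] : exists w, [/\ w != 0, rho w = w &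
    A = Y -> B' = Y' -> B (vX w) (vX w) = 0].
  have dN : \dim {:'rV[k]_(\dim M)} = \dim M by rewrite dimvf /dim /= mul1n.
  have dM2 : (1 < \dim M)%N by clear -dM dYA AB dVY dVY'; lia.
  have [[eA eB]|ne] := pselect (A = Y /\ B' = Y').
    have vXX' x : vX' x = vX x by rewrite /vX' /X' /M' /vX /X /M eA eB.
    have [||x z||w [w0 wE ww]] := @isotropic_fixed_vector _ rho
        (fun x z => B (vX x) (vX z)) rhoD rhoZ rho_inj.
    - move=> z x y; rewrite -BDl; congr (B _ _).
      by rewrite -big_split; apply: eq_bigr => i _; rewrite mxE scalerDl.
    - move=> a x z; rewrite -BZl; congr (B _ _).
      by rewrite scaler_sumr; apply: eq_bigr => i _; rewrite mxE scalerA.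
    - by rewrite -(vXX' z) rhoB.
    - by rewrite dN.
    - by exists w.
  have [|||w [_ [_ [w0 wE _]]]] := @semilinear_fixed_vector _ (q * q) (Fr \o Fr) _ _ _ rho
      rhoD rhoZ rho_inj (const_mx 1).
  - by clear -q_gt1; nia.
  - by move=> x; rewrite /= !FrE exprM.
  - apply/eqP => /rowP/(_ (Ordinal (ltnW dM2))); rewrite !mxE => /eqP.
    by rewrite oner_eq0.
  by exists w; split=> // eA eB; case: ne.
set v := vX w in w_iso; have vM : v \in M := vXM w.
have v0 : v != 0 by apply: contra_neq w0 => /vX0.
have Bv z : z \in M' -> B v z = Fr (B z v) by move=> /vXsurj'[x ->]; rewrite /v -rhoB wE.
have MA : (M :&: A = 0)%VS.
  apply/eqP; rewrite -subv0 -(capv_diff (perp Y) (perp Y')) subv_cap capvSl /=.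
  by rewrite -YA' subv_cap capvSr andbT (subv_trans (capvSl _ _)).
have vA : v \notin A.
  by apply: contra v0 => vA; rewrite -memv0 -MA memv_cap vM.
pose U := (A + <[v]>)%VS; pose U' := (Y + perp U)%VS.
have dU : \dim U = (\dim A).+1.
  rewrite dimv_disjoint_sum ?dim_vline ?v0 ?addn1 //.
  by apply/eqP; rewrite capvC -subv0; apply/subvP => _ /memv_capP[/vlineP[a ->] aA];
    rewrite memv0 scaler_eq0; apply: contraR vA; rewrite negb_or => /andP[a0 _];
    rewrite -[v](scalerK a0) memvZ.
have AU : (A <= U)%VS := addvSl _ _.
have UB : (U <= B')%VS by rewrite -AM addvS // -memvE.
have YU' : (Y <= U')%VS := addvSl _ _.
have U'Y : (U' <= Y')%VS by rewrite -AY addvC addvS // perpS.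
have BU : (perp B' <= perp U)%VS := perpS UB.
have YU : (Y :&: perp U)%VS = perp B'.
  apply/eqP; rewrite eqEsubv subv_cap B'Y BU -AY' subv_cap capvSl andbT /= andbT.
  by rewrite (subv_trans (capvSr _ _)) ?perpS.
have dU' : (\dim U').+1 = \dim Y'.
  have := dimv_sum_cap Y (perp U); rewrite YU !dim_perp -/U' dU.
  by clear -dAY AB dVA dVB' dVY dVY'; lia.
(* An element of [perp U] lies in [perp A = M' + perp B']. Its part in [perp B'] is in [Y], to which
   [v] is orthogonal; for its part [z] in [M'], [Bv] reduces to [B z v], which is 0 as [z] is in
   [perp U]. *)
have vU' : v \in perp U'.
  rewrite perpD memv_cap (subvP MY) //=; apply/perpP => u uU.
  have : u \in perp A by apply: (subvP (perpS AU)).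
  rewrite -(addv_diff_cap (perp A) (perp B')) (capv_idPr B'A).
  case/memv_addP => z zM' [u1 u1B uE]; rewrite uE BDr.
  have /perpP vY : v \in perp Y := subvP MY _ vM.
  rewrite [B v u1]vY ?addr0; last exact: (subvP B'Y).
  rewrite Bv //; have -> : z = u - u1 by rewrite uE addrK.
  have /perpP := (rpredB uU (subvP BU _ u1B) : u - u1 \in perp U).
  by move=> ->; rewrite ?rmorph0 // memvE addvSr.
exists U, U'; split=> //; rewrite ?AU ?YU' //.
  split=> //; apply/eqP; rewrite eqEdim subv_add addvSl /= -memvE.
  rewrite (subvP (addvSr _ _) _ vU') dU /=.
  have AU' : (perp U' :&: A)%VS = perp Y'.
    apply/eqP; rewrite eqEsubv subv_cap perpS //= Y'A andbT -YA' subv_cap capvSr andbT.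
    by rewrite (subv_trans (capvSl _ _)) ?perpS.
  have := dimv_sum_cap (perp U') A; rewrite AU' !dim_perp addvC.
  by move: (dV U'); clear -dU' dVY'; lia.
move=> eA eB; rewrite subv_add {1}eA addvSl /= -memvE.
apply: (subvP (addvSr _ _)); rewrite perpD memv_cap.
rewrite -{1}eA in MY; rewrite (subvP MY) //=; apply/perpP => _ /vlineP[a ->].
by rewrite BZr w_iso ?mulr0.
Qed.

(** * Completion of a partial flag by hulls *)

Let d := \dim {:V}.
Variables (C : pred nat) (F : nat -> {vspace V}).
Hypotheses (C_range : forall x, C x -> (0 < x < d)%N)
  (C_sym : forall x, C x -> x = 1%N \/ C (d.+1 - x)%N)
  (F0 : F 0%N = 0%VS) (Fd : F d = fullv)
  (F_dim : forall x, C x -> \dim (F x) = x)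
  (F_mono : forall x y, C x -> C y -> (x <= y)%N -> (F x <= F y)%VS)
  (F_perp : forall x, C x -> (perp (F (d.+1 - x)%N) <= F x)%VS).

Let core x := x = 0%N \/ x = d \/ C x.

Definition floor_dim (n : nat) : nat := \max_(x < n.+1 | C x) x.

Lemma floor_dim_le n : (floor_dim n <= n)%N.
Proof. by apply/bigmax_leqP => i _; rewrite -ltnS. Qed.

Lemma floor_dim_ge x n : C x -> (x <= n)%N -> (x <= floor_dim n)%N.
Proof.
by rewrite -ltnS => Cx xn; exact: (leq_bigmax_cond (Ordinal xn) (Cx : C (Ordinal xn))).
Qed.

Lemma floor_dimP n : floor_dim n = 0%N \/ C (floor_dim n).
Proof.
rewrite /floor_dim; elim/big_ind: _ => [|x y Px Py|i Ci]; [by left| |by right].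
by rewrite maxnE; case: (leqP x y) => [/subnKC|/ltnW/eqP] ->; rewrite ?addn0.
Qed.

Let core_floor n : core (floor_dim n).
Proof. by have [|] := floor_dimP n; [left|right; right]. Qed.

Let core_le x : core x -> (x <= d)%N.
Proof. by case=> [->//|[->//|/C_range/andP[_ /ltnW]]]. Qed.

Let core_dim x : core x -> \dim (F x) = x.
Proof. by case=> [->|[->|/F_dim//]]; rewrite ?F0 ?dimv0 ?Fd. Qed.

Let core_mono x y : core x -> core y -> (x <= y)%N -> (F x <= F y)%VS.
Proof.
move=> [->|[->|Cx]] cy xy; first by rewrite F0 sub0v.
  by rewrite (_ : y = d) //; apply/eqP; rewrite eqn_leq core_le.
case: cy xy => [->|[->|Cy]] xy.
- by move: (C_range Cx); rewrite leqn0 in xy; rewrite (eqP xy).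
- by rewrite Fd subvf.
- exact: F_mono.
Qed.

Lemma floor_dim_mono m n : (m <= n)%N -> (floor_dim m <= floor_dim n)%N.
Proof.
have [->//|Cm] := floor_dimP m => mn.
exact: (floor_dim_ge Cm (leq_trans (floor_dim_le m) mn)).
Qed.

Let F_floor m n : (m <= n)%N -> (F (floor_dim m) <= F (floor_dim n))%VS.
Proof. by move=> mn; apply: core_mono => //; apply: floor_dim_mono. Qed.

(** A completion must satisfy [perp E_(d-j) <= E_(j+1)] and contain [F (floor_dim j)] in [E_j]: the
    hull is the part of [E_(j+1)] forced by [E_(d-j)]. Its dimension is [j] or [j + 1], according to
    whether or not [perp E_(d-j)] contains [F (floor_dim j)]. *)
Definition hull (E : nat -> {vspace V}) (j : nat) : {vspace V} :=
  (F (floor_dim j) + perp (E (d - j)%N))%VS.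

(* The invariant of the completion of F: every new term is the hull of another
   one, so that the remaining gaps still come in dual pairs. *)
Record hull_flag (D : pred nat) (E : nat -> {vspace V}) : Prop := HullFlag {
  hull_flag_core : forall x, core x -> D x /\ E x = F x;
  hull_flag_le : forall x, D x -> (x <= d)%N;
  hull_flag_dim : forall x, D x -> \dim (E x) = x;
  hull_flag_mono : forall x y, D x -> D y -> (x <= y)%N -> (E x <= E y)%VS;
  hull_flagP : forall y, D y -> core y \/
    exists j, [/\ (j <= d)%N, D (d - j)%N, (j <= y <= j.+1)%N & E y = hull E j]
}.

Section HullFlag.
Variables (D : pred nat) (E : nat -> {vspace V}).
Hypothesis DE : hull_flag D E.

Let D0 : D 0%N. Proof. by have [] := hull_flag_core DE (or_introl (erefl 0%N)). Qed.
Let Dd : D d. Proof. by have [] := hull_flag_core DE (or_intror (or_introl (erefl d))). Qed.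
Let DC x : C x -> D x.
Proof. by move=> Cx; have [] := hull_flag_core DE (or_intror (or_intror Cx)). Qed.
Let EF x : core x -> E x = F x. Proof. by move=> cx; have [] := hull_flag_core DE cx. Qed.
Let E_dim := hull_flag_dim DE.
Let E_mono := hull_flag_mono DE.
Let D_le := hull_flag_le DE.

Lemma hull_mono i j : (i <= j)%N -> D (d - i)%N -> D (d - j)%N ->
  (hull E i <= hull E j)%VS.
Proof.
by move=> ij Di Dj; rewrite addvS ?F_floor // perpS // E_mono // leq_sub2l.
Qed.

Lemma sub_hull y j : D y -> (j <= d)%N -> D (d - j)%N -> (y <= j)%N ->
  (E y <= hull E j)%VS.
Proof.
move=> Dy jd Dj yj; have [cy|[i [id Di /andP[iy _] ->]]] := hull_flagP DE Dy; last first.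
  by apply: hull_mono => //; apply: leq_trans yj.
rewrite EF //; case: (cy) => [->|[yd|Cy]]; first by rewrite F0 sub0v.
  have -> : j = d by apply/eqP; rewrite eqn_leq jd -yd.
  rewrite /hull subnn (EF (or_introl erefl)) F0 perp0.
  exact: subv_trans (subvf _) (addvSr _ _).
apply: subv_trans (addvSl _ _); apply: core_mono => //.
exact: floor_dim_ge.
Qed.

Let perp_core x : C x -> exists2 y, (d.+1 - x)%N = y & core y /\ D y.
Proof.
move=> Cx; exists (d.+1 - x)%N => //; suff c : core (d.+1 - x)%N.
  by have [] := hull_flag_core DE c.
by have [->|] := C_sym Cx; right; [left; rewrite subn1|right].
Qed.

(** For a core term in [C] this comes from [F_perp] and monotony of orthogonals; a new term is
    itself a hull, of index at least [j]. *)
Lemma hull_sub y j : D y -> D (d - j)%N -> (j < y)%N -> (hull E j <= E y)%VS.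
Proof.
move=> Dy Dj jy; have jd : (j <= d)%N by apply: leq_trans (ltnW jy) (D_le Dy).
have [cy|[i [id Di /andP[_ yi] ->]]] := hull_flagP DE Dy; last first.
  by apply: hull_mono => //; rewrite -ltnS (leq_trans jy).
have Fy : (F (floor_dim j) <= F y)%VS.
  by apply: core_mono => //; apply: leq_trans (floor_dim_le j) (ltnW jy).
rewrite subv_add EF // Fy; case: (cy) => [y0|[->|Cy]].
- by rewrite y0 in jy.
- by rewrite Fd subvf.
apply: subv_trans (F_perp Cy); have [y' y'E [cy' Dy']] := perp_core Cy.
by rewrite y'E perpS // -EF // E_mono //; rewrite -y'E; clear -jy jd; lia.
Qed.

(** With [c = floor_dim j] nonzero, [perp (F (d + 1 - c))] has dimension [c - 1] and lies in both
    summands, so that adding [F c] gains at most one dimension. *)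
Lemma dim_hull j : (j <= d)%N -> D (d - j)%N -> (j <= \dim (hull E j) <= j.+1)%N.
Proof.
move=> jd Dj; have dP : \dim (perp (E (d - j)%N)) = j by rewrite dim_perp E_dim // subKn.
apply/andP; split; first by rewrite -{1}dP dimvS ?addvSr.
have [c0|Cc] := floor_dimP j; first by rewrite /hull c0 F0 add0v dP.
have := dimv_sum_cap (F (floor_dim j)) (perp (E (d - j)%N)).
rewrite -/(hull E j) dP F_dim //.
have [e eE [ce De]] := perp_core Cc.
have /dimvS : (perp (F e) <= F (floor_dim j) :&: perp (E (d - j)%N))%VS.
  rewrite subv_cap -{1}eE F_perp //= perpS // -EF // E_mono // -eE.
  by move: (floor_dim_le j); clear -jd; lia.
rewrite dim_perp core_dim // -/d -eE; have /andP[] := C_range Cc.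
by clear; lia.
Qed.

Lemma hull_flag_extend j : (j <= d)%N -> D (d - j)%N -> ~~ D (\dim (hull E j)) ->
  let m := \dim (hull E j) in
  hull_flag (fun x => (x == m) || D x) (fun x => if x == m then hull E j else E x).
Proof.
move=> jd Dj Dm m; have /andP[jm mj] := dim_hull jd Dj; rewrite -/m in jm mj Dm.
have neqm x : D x -> (x == m) = false.
  by move=> Dx; apply: contraNF Dm => /eqP <-.
have hullE i : D (d - i)%N ->
    hull (fun x => if x == m then hull E j else E x) i = hull E i.
  by move=> Di; rewrite /hull neqm.
split=> [x cx|x|x|x y|y].
- by have [Dx <-] := hull_flag_core DE cx; rewrite neqm ?Dx.
- case/predU1P => [->|]; last exact: D_le.
  by have := dimvS (subvf (hull E j)).
- by have [->|xm /= Dx] := eqVneq x m; rewrite ?E_dim.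
- have [->|xm] := eqVneq x m; have [->|ym] := eqVneq y m; rewrite /= ?subvv // => Dx Dy xy.
  + by apply: hull_sub => //; apply: leq_ltn_trans jm _; rewrite ltn_neqAle eq_sym ym.
  + apply: sub_hull => //; rewrite -ltnS; apply: leq_trans mj.
    by rewrite ltn_neqAle xm.
  + exact: E_mono.
case/predU1P=> [->|Dy].
  by right; exists j; rewrite Dj orbT eqxx jm mj hullE.
have [|[i [id Di iy Ey]]] := hull_flagP DE Dy; [by left|right; exists i].
by rewrite (neqm y) // hullE // Di orbT.
Qed.

End HullFlag.

Definition is_gap (D : pred nat) (a b : nat) : Prop :=
  [/\ D a, D b, (a < b)%N & forall x, (a < x < b)%N -> ~~ D x].

Lemma gap_at (D : pred nat) n z : D 0%N -> D n -> (z < n)%N ->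
  exists a b, is_gap D a b /\ (a <= z < b)%N.
Proof.
move=> D0 Dn zn.
have exa : exists a, D a && (a <= z)%N by exists 0%N; rewrite D0.
have exb : exists b, D b && (z < b)%N by exists n; rewrite Dn.
have lea a : D a && (a <= z)%N -> (a <= z)%N by case/andP.
case: (ex_maxnP exa lea) => a /andP[Da az] amax.
case: (ex_minnP exb) => b /andP[Db zb] bmin.
exists a, b; split; last by rewrite az.
split=> //; first exact: leq_ltn_trans az zb.
move=> x /andP[ax xb]; apply/negP => Dx; have [xz|zx] := leqP x z.
  by have := amax x; rewrite Dx xz leqNgt ax => /(_ isT).
by have := bmin x; rewrite Dx zx leqNgt xb => /(_ isT).
Qed.

(** * Duality of the gaps of a flag closed under hulls *)

Section ClosedHullFlag.
Variables (D : pred nat) (E : nat -> {vspace V}).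
Hypotheses (DE : hull_flag D E)
  (D_closed : forall j, (j <= d)%N -> D (d - j)%N -> D (\dim (hull E j))).

Let D0 : D 0%N. Proof. by have [] := hull_flag_core DE (or_introl (erefl 0%N)). Qed.
Let Dd : D d. Proof. by have [] := hull_flag_core DE (or_intror (or_introl (erefl d))). Qed.
Let DC x : C x -> D x.
Proof. by move=> Cx; have [] := hull_flag_core DE (or_intror (or_intror Cx)). Qed.
Let E_dim := hull_flag_dim DE.
Let E_mono := hull_flag_mono DE.
Let D_le := hull_flag_le DE.

Local Notation gap := (is_gap D).

Let hull_closed j : (j <= d)%N -> D (d - j)%N -> E (\dim (hull E j)) = hull E j.
Proof.
move=> jd Dj; have Dm := D_closed jd Dj; have /andP[jm mj] := dim_hull DE jd Dj.
apply/eqP; have [mE|mE] := leqP (\dim (hull E j)) j.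
  by rewrite eqEdim (sub_hull DE) ?E_dim /=.
by rewrite eq_sym eqEdim (hull_sub DE) ?E_dim /=.
Qed.

Let hull_perp j : (j <= d)%N -> D (d - j)%N ->
  (F (floor_dim j) <= perp (E (d - j)%N))%VS -> hull E j = perp (E (d - j)%N).
Proof. by move=> jd Dj /addv_idPr. Qed.

Let dim_perpE j : (j <= d)%N -> D (d - j)%N -> \dim (perp (E (d - j)%N)) = j.
Proof. by move=> jd Dj; rewrite dim_perp E_dim // subKn. Qed.

Let floor_gap a b j : gap a b -> (a <= j < b)%N -> (F (floor_dim j) <= E a)%VS.
Proof.
move=> [Da _ _ gab] /andP[aj jb].
have [Df <-] := hull_flag_core DE (core_floor j); apply: E_mono => //.
rewrite leqNgt; apply/negP => af; have := gab (floor_dim j).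
by rewrite af (leq_ltn_trans (floor_dim_le j)) // Df => /(_ isT).
Qed.

Let gap_hull a b j : gap a b -> (a <= j < b)%N -> D (d - j)%N ->
  (j = a /\ \dim (hull E j) = a) \/ (j.+1 = b /\ \dim (hull E j) = b).
Proof.
move=> [Da Db ab gab] /andP[aj jb] Dj.
have jd : (j <= d)%N := ltnW (leq_trans jb (D_le Db)).
have Dm := D_closed jd Dj; have /andP[jm mj] := dim_hull DE jd Dj.
have gm := gab (\dim (hull E j)).
have [E1|E1] : \dim (hull E j) = j \/ \dim (hull E j) = j.+1.
  by clear -jm mj; lia.
  left; rewrite E1 in Dm gm *; suff -> : j = a by [].
  by apply/eqP; apply: contraTT Dm => ja; apply: gm; rewrite jb andbT ltn_neqAle eq_sym ja.
right; rewrite E1 in Dm gm *; suff -> : j.+1 = b by [].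
by apply/eqP; apply: contraTT Dm => ja; apply: gm; rewrite ltnS aj ltn_neqAle ja.
Qed.

(** The two kinds of gaps of length at least 2. For [type0] the flag agrees with its dual at the
    lower end, and the dual gap goes from [d - b] to [d - a]; for [type1] the hull of index [b - 1]
    gains a dimension, and the dual gap goes from [d - b + 1] to [d - a + 1]. *)
Let type0 a b := [/\ gap a b, (a.+1 < b)%N, D (d - a)%N & \dim (hull E a) = a].
Let type1 a b := [/\ gap a b, (a.+1 < b)%N, D (d - b.-1)%N & \dim (hull E b.-1) = b].

Let gap_le a b : gap a b -> (b <= d)%N.
Proof. by move=> [_ Db _ _]; apply: D_le. Qed.

Let type0_perp a b : type0 a b -> E a = perp (E (d - a)%N).
Proof.
move=> [gab ab Da da]; have bd := gap_le gab.
have ad : (a <= d)%N by clear -ab bd; lia.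
apply/esym/eqP; rewrite eqEdim dim_perpE // E_dim; last by case: gab.
by rewrite -{2}da hull_closed // addvSr leqnn.
Qed.

(** Otherwise [F (floor_dim b.-1) <= E a = perp E_(d-a) <= perp E_(d-b+1)], and the hull of index
    [b - 1] would have dimension [b - 1] instead of [b]. *)
Let type01 a b : type0 a b -> ~~ D (d - b.-1)%N.
Proof.
move=> t0; have [gab ab Da da] := t0; have bd := gap_le gab.
apply/negP => Db; have b1 : (a <= b.-1 < b)%N by clear -ab; lia.
have [[bE _]|[_ dE]] := gap_hull gab b1 Db; first by clear -bE ab; lia.
have b1d : (b.-1 <= d)%N by clear -bd; lia.
have := dim_perpE b1d Db; rewrite -hull_perp //.
  by rewrite dE; clear -ab; lia.
apply: subv_trans (floor_gap gab b1) _; rewrite (type0_perp t0) perpS // E_mono //.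
by clear -ab; lia.
Qed.

(** If neither holds, the gap around [d - b] reaches beyond [d - a]. Since [a] and [b] are in [D],
    the hulls of indices [d - b] and [d - a] put its ends at [d - b] and [d - a + 1]: it has
    [type0], and yet the hull at its upper end gains a dimension, which is excluded as in
    [type01]. *)
Let gap_type a b : gap a b -> (a.+1 < b)%N -> type0 a b \/ type1 a b.
Proof.
move=> gab ab; have bd := gap_le gab.
suff [Da|Db] : D (d - a)%N \/ D (d - b.-1)%N.
- left; split=> //; have aab : (a <= a < b)%N by clear -ab; lia.
  by have [[]|[bE]] := gap_hull gab aab Da => //; move: ab; rewrite bE ltnn.
- right; split=> //; have aab : (a <= b.-1 < b)%N by clear -ab; lia.
  by have [[bE]|[]] := gap_hull gab aab Db => //; move: ab; rewrite -bE; clear; lia.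
have [Da|nDa] := boolP (D (d - a)%N); first by left.
have [Db|nDb] := boolP (D (d - b.-1)%N); first by right.
have zd : (d - b < d)%N by clear -ab bd; lia.
have [y [y' [gyy /andP[yz zy']]]] := gap_at D0 Dd zd.
have [Dy Dy' _ _] := gyy; have y'd := D_le Dy'.
have y'a : (d - a < y')%N.
  rewrite ltnNge; apply/negP => y'a.
  have j1 : (a <= d - y' < b)%N by clear -y'a zy' y'd bd ab; lia.
  have Dj : D (d - (d - y'))%N by rewrite subKn.
  have [[jE _]|[jE _]] := gap_hull gab j1 Dj; first by rewrite -jE Dj in nDa.
  by case/negP: nDb; rewrite -jE /= Dj.
have yy' : (y.+1 < y')%N by clear -yz y'a ab bd; lia.
have jb : (y <= d - b < y')%N by rewrite yz.
have [Dja Djb] : D (d - (d - a))%N /\ D (d - (d - b))%N.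
  by have [Da Db _ _] := gab; rewrite !subKn //; clear -ab bd; lia.
have [[yE dy]|[jE _]] := gap_hull gyy jb Djb; last by clear -jE y'a ab bd; lia.
have ja : (y <= d - a < y')%N by clear -yz y'a ab bd; lia.
have [[jE _]|[jE dE]] := gap_hull gyy ja Dja; first by clear -jE yE ab bd; lia.
have t0 : type0 y y' by split=> //; [rewrite -yE|rewrite -{1}yE].
have jad : (d - a <= d)%N := leq_subr _ _.
have := dim_perpE jad Dja; rewrite -hull_perp //; first by rewrite dE -jE; clear; lia.
apply: subv_trans (floor_gap gyy ja) _; rewrite (type0_perp t0) perpS // E_mono //.
  by rewrite -yE.
by rewrite -yE !subKn //; clear -ab bd; lia.
Qed.

Let type0_dual a b : type0 a b ->
  [/\ type0 (d - b)%N (d - a)%N & E b = perp (E (d - b)%N)].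
Proof.
move=> t0; have nb := type01 t0; have [gab ab Da da] := t0; have bd := gap_le gab.
have zd : (d - b < d)%N by clear -ab bd; lia.
have [y [y' [gyy /andP[yz zy']]]] := gap_at D0 Dd zd.
have [Dy Dy' _ gy] := gyy; have y'd := D_le Dy'.
have y'E : y' = (d - a)%N.
  apply/eqP; rewrite eqn_leq; apply/andP; split.
    rewrite leqNgt; apply/negP => y'a; have := gy (d - a)%N.
    by rewrite y'a Da andbT (leq_ltn_trans yz) => [/(_ isT)//|]; clear -ab bd; lia.
  rewrite leqNgt; apply/negP => y'a.
  have j1 : (a <= d - y' < b)%N by clear -y'a zy' y'd bd ab; lia.
  have Dj : D (d - (d - y'))%N by rewrite subKn.
  have [[jE _]|[jE _]] := gap_hull gab j1 Dj; first by clear -jE y'a ab bd; lia.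
  by case/negP: nb; rewrite -jE /= Dj.
have jb : (y <= d - b < y')%N by rewrite yz.
have [Dja Djb] : D (d - (d - a))%N /\ D (d - (d - b))%N.
  by have [? ? _ _] := gab; rewrite !subKn //; clear -ab bd; lia.
have [[yE dy]|[jE _]] := gap_hull gyy jb Djb; last by clear -jE y'E ab bd; lia.
have t0' : type0 y y'.
  split=> //; [by rewrite y'E -yE; clear -ab bd; lia|by rewrite -yE|by rewrite -{1}yE].
split; first by rewrite yE -y'E.
have Dyb : D (d - b)%N by rewrite yE.
apply/eqP; rewrite eqEdim E_dim; last by case: gab.
rewrite dim_perpE // leqnn andbT -hull_perp //; first by apply: (sub_hull DE) => //; case: gab.
have fb : (floor_dim b < b)%N.
  rewrite ltn_neqAle floor_dim_le andbT; apply/negP => /eqP fb.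
  have [f0|] := floor_dimP b; first by clear -f0 fb ab; lia.
  rewrite fb => /C_sym[b1|/DC Db]; first by clear -b1 ab; lia.
  by case/negP: nb; move: Db; congr (is_true (D _)); clear -ab bd; lia.
apply: (@subv_trans _ _ (E a)).
  have [Df <-] := hull_flag_core DE (core_floor b); case: (gab) => Da' _ _ gab'.
  apply: E_mono => //; rewrite leqNgt; apply/negP => af.
  by have := gab' (floor_dim b); rewrite af fb Df => /(_ isT).
by rewrite (type0_perp t0) perpS // E_mono //; clear -ab; lia.
Qed.

Let type1_dual a b : type1 a b ->
  [/\ type1 (d - b.-1)%N (d - a).+1, (0 < a)%N,
    (perp (E (d - b.-1)%N) + E a = E b)%VS &
    (perp (E (d - b.-1)%N) :&: E a = perp (E (d - a).+1))%VS].
Proof.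
move=> [gab ab Db db]; have bd := gap_le gab; have [Da' Db' _ _] := gab.
have na : ~~ D (d - a)%N.
  apply/negP => Da; have t0 : type0 a b.
    split=> //; have aab : (a <= a < b)%N by clear -ab; lia.
    by have [[]|[bE]] := gap_hull gab aab Da => //; move: ab; rewrite bE ltnn.
  by have := type01 t0; rewrite Db.
have a0 : (0 < a)%N by rewrite lt0n; apply: contraNneq na => ->; rewrite subn0.
have zd : (d - b.-1 < d)%N by clear -ab bd; lia.
have [y [y' [gyy /andP[yz zy']]]] := gap_at D0 Dd zd.
have [Dy Dy' _ gy] := gyy; have y'd := D_le Dy'.
have yE : y = (d - b.-1)%N.
  apply/eqP; rewrite eqn_leq yz leqNgt; apply/negP => yb; have := gy (d - b.-1)%N.
  by rewrite yb zy' Db => /(_ isT).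
have y'a : (d - a < y')%N.
  rewrite ltnNge; apply/negP => y'a.
  have j1 : (a <= d - y' < b)%N by clear -y'a zy' y'd bd ab; lia.
  have Dj : D (d - (d - y'))%N by rewrite subKn.
  have [[jE _]|[jE _]] := gap_hull gab j1 Dj; first by rewrite -jE Dj in na.
  by clear -jE zy' ab bd y'd; lia.
have Dja : D (d - (d - a))%N by rewrite subKn //; clear -ab bd; lia.
have ja : (y <= d - a < y')%N by clear -yz yE y'a ab bd; lia.
have [[jE _]|[jE dE]] := gap_hull gyy ja Dja; first by clear -jE yE ab bd; lia.
have b1d : (b.-1 <= d)%N by clear -bd; lia.
have b1 : (a <= b.-1 < b)%N by clear -ab; lia.
have EbE : (perp (E (d - b.-1)%N) + E a = E b)%VS.
  have bE : E b = hull E b.-1 by rewrite -hull_closed // db.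
  apply/eqP; rewrite eqEsubv subv_add (E_mono Da' Db' (ltnW (ltnW ab))) andbT bE.
  rewrite addvSr /= subv_add addvSl andbT.
  exact: subv_trans (floor_gap gab b1) (addvSr _ _).
split=> //.
  rewrite jE -yE; split=> //; first by clear -yE jE ab bd; lia.
    by rewrite -jE.
  by rewrite -jE /= dE jE.
apply/esym/eqP; rewrite eqEdim subv_cap; apply/andP; split; last first.
  have := dimv_sum_cap (perp (E (d - b.-1)%N)) (E a).
  rewrite EbE dim_perpE // !E_dim // dim_perp E_dim ?jE //.
  by rewrite -/d; clear -ab bd a0 jE; lia.
rewrite perpS /=; last by rewrite E_mono ?jE // -yE; clear -ja; lia.
have Dj : D (d - (d - (d - a).+1))%N by rewrite subKn jE // (gap_le gyy).
have j_lt : (d - (d - a).+1 < a)%N by clear -a0 ab bd; lia.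
apply: subv_trans (hull_sub DE Da' Dj j_lt).
by rewrite /hull subKn ?addvSr // jE (gap_le gyy).
Qed.

(** The negated inclusions of the second case are what [floor_hullE] needs to show that the terms
    inserted in the gaps are hulls again. *)
Lemma closed_gap_dual a b : gap a b -> (a.+1 < b)%N -> exists y y',
  [/\ gap y y', dual_segments (E a) (E b) (E y) (E y') &
   (y = d - b /\ y' = d - a)%N \/
   [/\ y = (d - b.-1)%N, y' = (d - a).+1, (0 < a)%N,
     ~~ (F (floor_dim b.-1) <= perp (E y))%VS &
     ~~ (F (floor_dim y'.-1) <= perp (E a))%VS]].
Proof.
move=> gab ab; have bd := gap_le gab; have [Da' Db' _ _] := gab.
have [bK aK] : (d - (d - b) = b /\ d - (d - a) = a)%N.
  by rewrite !subKn //; clear -ab bd; lia.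
have [t0|t1] := gap_type gab ab.
  have [t0' bE] := type0_dual t0; have [_ aE] := type0_dual t0'.
  have [gyy ayy Dyy _] := t0'; have [Dy Dy' _ _] := gyy.
  exists (d - b)%N, (d - a)%N; split=> //; last by left.
  have aE' := type0_perp t0; have bE' := type0_perp t0'.
  rewrite aK in aE; rewrite bK in bE'; split.
  - by rewrite -bE; apply/addv_idPl/E_mono => //; clear -ab; lia.
  - by rewrite -bE -aE'; apply/capv_idPr/E_mono => //; clear -ab; lia.
  - by rewrite -aE; apply/addv_idPl/E_mono => //; clear -ab; lia.
  - by rewrite -aE -bE'; apply/capv_idPr/E_mono => //; clear -ab; lia.
have [t1' a0 s1 s2] := type1_dual t1; have [_ _ s3 s4] := type1_dual t1'.
rewrite /= aK in s3 s4; rewrite subKn in s4; last by clear -bd; lia.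
rewrite prednK in s4; last by clear -ab; lia.
exists (d - b.-1)%N, (d - a).+1; have [gyy _ _ dy] := t1'.
split=> //; right; split=> //.
  have [_ _ Db db] := t1; apply/negP => Fb.
  have b1d : (b.-1 <= d)%N by clear -bd; lia.
  by have := dim_perpE b1d Db; rewrite -hull_perp // db; clear -ab; lia.
apply/negP; rewrite -[X in perp (E X)]aK => Fa.
have ad : (d - a <= d)%N := leq_subr _ _.
have Da : D (d - (d - a))%N by rewrite aK.
by have := dim_perpE ad Da; rewrite -hull_perp // dy /=; clear; lia.
Qed.

(** Replaces [F (floor_dim j)] by the larger [E a] in a hull. In the second case the right side
    exceeds [W] by at most one dimension, and the left side is already larger than [W]. *)
Lemma floor_hullE a b j W : gap a b -> (a <= j < b)%N ->
  (E a <= W)%VS \/ (~~ (F (floor_dim b.-1) <= W)%VS /\ (\dim (E a + W) <= (\dim W).+1)%N) ->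
  (F (floor_dim j) + W = E a + W)%VS.
Proof.
move=> gab ajb; have /andP[aj jb] := ajb; have Fj := floor_gap gab ajb.
have Fb : (F (floor_dim b.-1) <= F (floor_dim j))%VS.
  have [->|Cf] := floor_dimP b.-1; first by rewrite F0 sub0v.
  apply: core_mono => //; apply: floor_dim_ge => //; apply: leq_trans aj.
  have [_ _ _ gx] := gab; rewrite leqNgt; apply/negP => af.
  have := gx (floor_dim b.-1); rewrite af (DC Cf) => /(_ _)/wrap[] //.
  by move: (floor_dim_le b.-1); clear -jb; lia.
case=> [aW|[nF dW]]; first by rewrite (addv_idPr aW) (addv_idPr (subv_trans Fj aW)).
apply/eqP; rewrite eqEdim addvS //= (leq_trans dW) // ltnNge; apply: contra nF => dF.
have /eqP -> : W == (F (floor_dim j) + W)%VS by rewrite eqEdim addvSr.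
exact: subv_trans Fb (addvSl _ _).
Qed.

End ClosedHullFlag.

(** A hull of a new dimension is added alone. When there is none, every gap of length at least 2 has
    a dual one, and [refine_dual_segments] adds a term at the bottom of the gap and one at the top
    of its dual. *)
Lemma hull_flag_refine D E x : hull_flag D E -> (x <= d)%N -> ~~ D x ->
  exists D' E', [/\ hull_flag D' E', forall y, D y -> D' y &
    exists m, [/\ (m <= d)%N, ~~ D m & D' m]].
Proof.
move=> DE xd nDx.
have [[j [jd Dj nDj]]|cl] := pselect (exists j, [/\ (j <= d)%N, D (d - j)%N &
    ~~ D (\dim (hull E j))]).
  exists (fun y => (y == \dim (hull E j)) || D y).
  exists (fun y => if y == \dim (hull E j) then hull E j else E y); split.
  - exact: hull_flag_extend.
  - by move=> y ->; rewrite orbT.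
  - by exists (\dim (hull E j)); split; rewrite ?eqxx // dimvS ?subvf.
have {cl}D_closed j : (j <= d)%N -> D (d - j)%N -> D (\dim (hull E j)).
  by move=> jd Dj; apply/negPn/negP => nD; apply: cl; exists j.
have [D0 _] := hull_flag_core DE (or_introl (erefl 0%N)).
have [Dd _] := hull_flag_core DE (or_intror (or_introl (erefl d))).
have E_dim := hull_flag_dim DE; have E_mono := hull_flag_mono DE.
have D_le := hull_flag_le DE.
have xd' : (x < d)%N by rewrite ltn_neqAle xd andbT; apply: contraNneq nDx => ->.
have [a [b [gab /andP[ax xb]]]] := gap_at D0 Dd xd'.
have {ax}ax : (a < x)%N.
  rewrite ltn_neqAle ax andbT; apply: contraNneq nDx => <-; by case: gab.
have ab : (a.+1 < b)%N := leq_ltn_trans ax xb.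
have [y [y' [gyy dual yy'E]]] := closed_gap_dual DE D_closed gab ab.
have [Da Db _ gx] := gab; have [Dy Dy' _ gy] := gyy.
have [bd y'd] := (D_le _ Db, D_le _ Dy').
have ab' : ((\dim (E a)).+1 < \dim (E b))%N by rewrite !E_dim.
have [U [U' [/andP[AU UB] /andP[YU' UY'] [dU dU'] [UE UE'] selfU]]] :=
  refine_dual_segments dual ab'.
rewrite !E_dim // in dU dU'.
have len : (y' - y = b - a)%N by case: yy'E => [[-> ->]|[-> -> _ _ _]]; clear -ab bd; lia.
pose m := a.+1; pose m' := y'.-1.
have m'E : m'.+1 = y' by rewrite /m' -dU'.
have {dU'}dU' : \dim U' = m' by rewrite /m' -dU'.
have [mab m'yy] : (a < m < b)%N /\ (y < m' < y')%N by rewrite /m /m'; clear -ab len; lia.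
have [nDm nDm'] : ~~ D m /\ ~~ D m' by split; [apply: gx|apply: gy].
have [md m'd] : (m <= d)%N /\ (m' <= d)%N by clear -mab m'yy bd y'd; lia.
have gaps : [\/ a = y /\ b = y', (b <= y)%N | (y' <= a)%N].
  have [ya|ay] := leqP y a.
    have [y'a|ay'] := leqP y' a; first by constructor 3.
    have {ya}ya : y = a.
      apply/eqP; rewrite eqn_leq ya leqNgt; apply/negP => {}ya.
      by have := gy a; rewrite ya ay' Da => /(_ isT).
    by constructor 1; split=> //; clear -ya len ab ay'; lia.
  have [yb|by_] := ltnP y b; last by constructor 2.
  by have := gx y; rewrite ay yb Dy => /(_ isT).
have UU' : (m <= m')%N -> (U <= U')%VS.
  move=> mm'; case: gaps => [[ay by']|by_|y'a].
  - by apply: selfU; rewrite ?ay ?by'.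
  - exact: subv_trans UB (subv_trans (E_mono _ _ Db Dy by_) YU').
  - by move: y'a mm' m'yy mab; clear; lia.
have U'U : (m' <= m)%N -> (U' <= U)%VS.
  move=> mm'; case: gaps => [[ay by']|by_|y'a].
  (* The gap has length 2 and both new terms have its middle dimension; the inclusion of [U] in [U']
     for equal segments makes them equal. *)
  - have mm : m = m' by rewrite /m in mm' mab *; clear -mm' mab m'yy by' ay; lia.
    suff -> : U = U' by [].
    apply/eqP; rewrite eqEdim dU dU' -/m mm leqnn andbT; apply: UU'.
    by rewrite mm.
  - by move: by_ mm' m'yy mab; clear; lia.
  - exact: subv_trans UY' (subv_trans (E_mono _ _ Dy' Da y'a) AU).
pose D' z := [|| z == m, z == m' | D z].
pose E' z := if z == m then U else if z == m' then U' else E z.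
have D'm : D' m by rewrite /D' eqxx.
have D'm' : D' m' by rewrite /D' eqxx orbT.
have E'm : E' m = U by rewrite /E' eqxx.
have E'm' : E' m' = U'.
  rewrite /E' eqxx; case: eqP => // mm; apply/eqP; rewrite eqEsubv UU' ?U'U //; by rewrite mm.
have DD' z : D z -> D' z by move=> Dz; rewrite /D' Dz !orbT.
have EE' z : D z -> E' z = E z.
  move=> Dz; rewrite /E'; case: eqP => [zm|_]; first by rewrite zm (negPf nDm) in Dz.
  by case: eqP => // zm; rewrite zm (negPf nDm') in Dz.
have D'P z : D' z -> [\/ z = m, z = m' | D z].
  by case/or3P => [/eqP|/eqP|]; [constructor 1|constructor 2|constructor 3].
have mD z : D z -> (z <= m)%N -> (E z <= U)%VS.
  move=> Dz zm; apply: subv_trans AU; apply: E_mono => //.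
  by rewrite -ltnS ltn_neqAle zm andbT; apply: contraTneq Dz => ->.
have Dm z : D z -> (m <= z)%N -> (U <= E z)%VS.
  move=> Dz zm; apply: subv_trans UB _; apply: E_mono => //.
  by rewrite leqNgt; apply/negP => zb; have := gx z; rewrite zb zm Dz => /(_ isT).
have m'D z : D z -> (z <= m')%N -> (E z <= U')%VS.
  move=> Dz zm; apply: subv_trans YU'; apply: E_mono => //.
  rewrite leqNgt; apply/negP => yz; have := gy z.
  by rewrite yz Dz -m'E ltnS zm => /(_ isT).
have Dm' z : D z -> (m' <= z)%N -> (U' <= E z)%VS.
  move=> Dz zm; apply: subv_trans UY' _; apply: E_mono => //.
  by rewrite -m'E ltn_neqAle zm andbT; apply: contraTneq Dz => <-.
(* [U = A + perp U'] becomes a hull through [floor_hullE]. Its index [j] is [m] in the first case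
   and [a = m - 1] in the second, so that [d - j = m'] in both. *)
have hull_m : exists j, [/\ (j <= d)%N, D' (d - j)%N, (j <= m <= j.+1)%N & U = hull E' j].
  have dpU' : \dim (perp U') = (d - m')%N by rewrite dim_perp dU'.
  case: yy'E => [[yE y'E]|[yE y'E a0 nF _]].
    have jm' : (d - m = m')%N by rewrite /m /m' y'E; clear; lia.
    exists m; rewrite jm' leqnn leqnSn; split=> //.
    rewrite /hull jm' E'm' (floor_hullE DE gab) -?UE //; first by rewrite (ltnW _) //; case/andP: mab.
    left; apply: subv_trans (perpS UY'); have [_ s2 _ _] := dual.
    rewrite (_ : E a = perp (E y')) //; apply/esym/eqP.
    by rewrite eqEdim dim_perp !E_dim // -s2 capvSr y'E -/d /=; clear -ab bd; lia.
  have jm' : (d - a = m')%N by rewrite /m' y'E.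
  exists a; rewrite jm' /m leqnn leqnSn; split=> //; first by clear -md; lia.
  rewrite /hull jm' E'm' (floor_hullE DE gab) -?UE //; first by rewrite leqnn; clear -ab; lia.
  right; split; last by rewrite dpU' dU -jm'; clear -md; lia.
  by apply: contra nF => nF; apply: subv_trans nF (perpS YU').
have hull_m' : exists j, [/\ (j <= d)%N, D' (d - j)%N, (j <= m' <= j.+1)%N & U' = hull E' j].
  have dpU : \dim (perp U) = (d - m)%N by rewrite dim_perp dU.
  case: yy'E => [[yE y'E]|[yE y'E a0 _ nF]].
    have jm : (d - m' = m)%N by rewrite /m /m' y'E; clear -ab bd; lia.
    exists m'; rewrite jm leqnn leqnSn; split=> //.
    rewrite /hull jm E'm (floor_hullE DE gyy) -?UE' //; first by case/andP: m'yy => /ltnW -> ->.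
    left; apply: subv_trans (perpS UB); have [_ _ _ s4] := dual.
    rewrite (_ : E y = perp (E b)) //; apply/esym/eqP.
    by rewrite eqEdim dim_perp !E_dim // -s4 capvSr yE -/d /=; clear -ab bd; lia.
  have jm : (d - m'.-1 = m)%N by rewrite /m /m' y'E; clear -ab bd; lia.
  exists m'.-1; rewrite jm; split=> //; first by clear -m'd; lia.
    by clear -m'yy; lia.
  rewrite /hull jm E'm (floor_hullE DE gyy) -?UE' //; first by clear -m'yy; lia.
  right; split; last by rewrite dpU dU' -jm; clear -m'd; lia.
  by apply: contra nF => nF; apply: subv_trans nF (perpS AU).
exists D', E'; split=> //; last by exists m.
split.
- by move=> z cz; have [Dz <-] := hull_flag_core DE cz; rewrite EE' // DD'.
- by move=> z /D'P[->|->|/D_le].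
- by move=> z /D'P[->|->|Dz]; rewrite ?E'm ?E'm' ?EE' ?E_dim.
- move=> z1 z2 /D'P[->|->|Dz1] /D'P[->|->|Dz2] zz;
    rewrite ?E'm ?E'm' ?(EE' _ Dz1) ?(EE' _ Dz2) ?subvv //;
    by [apply: UU'|apply: U'U|apply: mD|apply: Dm|apply: m'D|apply: Dm'|apply: E_mono].
move=> z /D'P[->|->|Dz].
- by right; rewrite E'm.
- by right; rewrite E'm'.
rewrite EE' //; have [|[j [jd Dj jz Ez]]] := hull_flagP DE Dz; [by left|right].
by exists j; rewrite /hull (EE' _ Dj) DD'.
Qed.

Lemma hull_flag_complete D E : hull_flag D E ->
  exists E', hull_flag (fun x => x <= d)%N E'.
Proof.
have [n] := ubnP #|[pred x : 'I_d.+1 | ~~ D x]|.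
elim: n D E => // n IH D E nD DE.
have [[x [xd nDx]]|full] := pselect (exists x, (x <= d)%N /\ ~~ D x); last first.
  have DDE x : D x = (x <= d)%N.
    apply/idP/idP => [/(hull_flag_le DE)//|xd].
    by apply/negPn/negP => nDx; apply: full; exists x.
  by exists E; have -> : (fun x => x <= d)%N = D by apply/funext.
have [D' [E' [DE' DD' [m [md nDm D'm]]]]] := hull_flag_refine DE xd nDx.
apply: (IH D' E') DE'; rewrite -ltnS in md; rewrite ltnS in nD; apply: leq_trans nD.
apply/proper_card/properP; split.
  by apply/fintype.subsetP => z; rewrite !inE; apply: contra => /DD'.
by exists (Ordinal md); rewrite !inE ?nDm // D'm.
Qed.

(* A complete flag E such that perp E, the flag of the perp (E (d - j)%N), is in
   relative position w to E, where w is the increasing product of the s_j such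
   that E j <> perp (E (d - j)%N); the last clause says that w is a minimal
   representative of its class modulo the reflections outside of C. *)
Record adapted_flag (E : nat -> {vspace V}) : Prop := AdaptedFlag {
  adapted_dim : forall x, (x <= d)%N -> \dim (E x) = x;
  adapted_mono : forall x y, (x <= y <= d)%N -> (E x <= E y)%VS;
  adapted_perp : forall j, (j < d)%N -> (perp (E (d - j)%N) <= E j.+1)%VS;
  adapted_initial : forall j, (j < d)%N -> E j != perp (E (d - j)%N) ->
    (0 < j)%N && (C j || (E j.-1 != perp (E (d - j.-1)%N)))
}.

(** In the complete flag, [perp E_(d-j)] is in [hull E j], hence in [E_(j+1)]. If [j] is not in [C]
    and [E_(j-1)] equals its dual, then [F (floor_dim j) <= E_(j-1) = perp E_(d-j+1) <= perp
    E_(d-j)]: the hull of index [j] is [perp E_(d-j)], which contains [E_j] and has the same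
    dimension. *)
Lemma adapted_flag_exists :
  exists2 E, adapted_flag E & forall x, C x -> E x = F x.
Proof.
have init : hull_flag (fun x => [|| x == 0%N, x == d | C x]) F.
  have coreP x : [|| x == 0%N, x == d | C x] -> core x.
    by case/or3P => [/eqP->|/eqP->|?]; [left|right; left|right; right].
  split=> [x cx|x /coreP/core_le//|x /coreP/core_dim//|x y /coreP cx /coreP|y /coreP].
  - by split=> //; case: cx => [->|[->|->]]; rewrite ?eqxx ?orbT.
  - exact: core_mono.
  - by left.
have [E DE] := hull_flag_complete init; exists E; last first.
  by move=> x Cx; have [] := hull_flag_core DE (or_intror (or_intror Cx)).
have E_dim := hull_flag_dim DE; have E_mono := hull_flag_mono DE.
have EF x : core x -> E x = F x by move=> /(hull_flag_core DE)[].
have perp_dim j : (j <= d)%N -> \dim (perp (E (d - j)%N)) = j.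
  by move=> jd; rewrite dim_perp E_dim ?leq_subr // subKn.
split=> [x /E_dim//|x y /andP[xy yd]|j jd|j jd jT].
- by apply: E_mono => //; apply: leq_trans yd.
- by apply: subv_trans (hull_sub DE jd (leq_subr _ _) (ltnSn j)); apply: addvSr.
have j0 : (0 < j)%N.
  rewrite lt0n; apply: contraNneq jT => ->; rewrite subn0 !EF ?F0 ?Fd ?perpf //.
    by right; left.
  by left.
rewrite j0 /=; have [//|nC] := boolP (C j); apply: contraNneq jT => E1.
have jd' := ltnW jd.
have fj : (F (floor_dim j) <= perp (E (d - j)%N))%VS.
  apply: (@subv_trans _ _ (perp (E (d - j.-1)%N))).
    have [_ <-] := hull_flag_core DE (core_floor j); rewrite -E1; apply: E_mono.
    - exact: leq_trans (floor_dim_le j) jd'.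
    - exact: leq_trans (leq_pred _) jd'.
    have := floor_dim_le j; rewrite leq_eqVlt => /predU1P[fj|]; last first.
      by clear -j0; lia.
    by have [|] := floor_dimP j; rewrite fj; [move=> j00; rewrite j00 in j0|rewrite (negPf nC)].
  by rewrite perpS // E_mono ?leq_subr // leq_sub2l // leq_pred.
by rewrite eqEdim perp_dim // E_dim // leqnn andbT -(addv_idPr fj)
  (sub_hull DE) // leq_subr.
Qed.

Section AdaptedFlag.
Variable E : nat -> {vspace V}.
Hypothesis adE : adapted_flag E.

Let perp_dim j : (j <= d)%N -> \dim (perp (E (d - j)%N)) = j.
Proof. by move=> jd; rewrite dim_perp (adapted_dim adE) ?leq_subr // subKn. Qed.

Let adapted_segment a j : (a <= j < d)%N ->
  (forall i, (a <= i <= j)%N -> E i != perp (E (d - i)%N)) ->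
  E j.+1 = (E a + perp (E (d - j)%N))%VS.
Proof.
have step i : (i < d)%N -> E i != perp (E (d - i)%N) ->
    E i.+1 = (E i + perp (E (d - i)%N))%VS.
  move=> id iT; have id' := ltnW id; apply/esym/eqP.
  rewrite eqEdim subv_add (adapted_perp adE) // (adapted_mono adE) ?leqnSn //=.
  rewrite (adapted_dim adE) // ltnNge; apply: contra iT => di.
  have Ei : E i = (E i + perp (E (d - i)%N))%VS.
    by apply/eqP; rewrite eqEdim addvSl (adapted_dim adE).
  have Pi : perp (E (d - i)%N) = (E i + perp (E (d - i)%N))%VS.
    by apply/eqP; rewrite eqEdim addvSr perp_dim.
  by rewrite Pi -Ei.
elim: j => [|j IH] /andP[aj jd] T.
  by move: aj T; rewrite leqn0 => /eqP-> T; rewrite step ?T.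
move: aj; rewrite leq_eqVlt => /predU1P[aj|aj]; first by rewrite aj step // T // aj leqnn.
rewrite step //; last by rewrite T // leqnn ltnW.
rewrite IH; first last.
- by move=> i /andP[ai ij]; rewrite T // ai ltnW.
- by rewrite -ltnS aj ltnW.
rewrite -addvA; congr (_ + _)%VS; apply/addv_idPr/perpS/(adapted_mono adE).
by clear; lia.
Qed.

(** By [adapted_initial], a jump outside of [C] is preceded by a jump: jumps propagate down to the
    start of an interval free of [C]. *)
Lemma adapted_chain (D : pred nat) a j : (forall x, C x -> D x) ->
  (a <= j < d)%N -> (forall x, (a < x <= j)%N -> ~~ D x) ->
  E j != perp (E (d - j)%N) -> forall i, (a <= i <= j)%N -> E i != perp (E (d - i)%N).
Proof.
move=> CD; elim: j => [|j IH] /andP[aj jd] nD jT i /andP[ai ij].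
  by move: ij; rewrite leqn0 => /eqP->.
move: ij; rewrite leq_eqVlt => /predU1P[->//|ij]; rewrite ltnS in ij.
have aj' : (a <= j)%N := leq_trans ai ij.
have /andP[_ /orP[/CD Dj|jT']] := adapted_initial adE jd jT.
  by have := nD j.+1; rewrite ltnS aj' leqnn Dj => /(_ isT).
apply: IH => //; last by rewrite ai.
- by rewrite aj' ltnW.
- by move=> x /andP[ax xj]; apply: nD; rewrite ax ltnW.
Qed.

(** Inside a gap, [E a] and [E (d - j)] alone decide whether [j] is a jump, and they determine
    [E j.+1] if it is. Two adapted flags sharing these two terms therefore go on together. *)
Lemma adapted_next (D : pred nat) a j : (forall x, C x -> D x) ->
  (a <= j < d)%N -> (forall x, (a < x <= j)%N -> ~~ D x) ->
  (E j != perp (E (d - j)%N)) = ~~ (E a <= perp (E (d - j)%N))%VS /\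
  (E j != perp (E (d - j)%N) -> E j.+1 = E a + perp (E (d - j)%N))%VS.
Proof.
move=> CD ajd nD; have /andP[aj jd] := ajd.
have seg : E j != perp (E (d - j)%N) -> E j.+1 = (E a + perp (E (d - j)%N))%VS.
  by move=> jT; apply: adapted_segment => //; apply: (adapted_chain CD ajd nD jT).
split=> //; apply/idP/idP => [jT|]; last first.
  by apply: contra => /eqP <-; apply: (adapted_mono adE); rewrite aj ltnW.
apply/negP => /addv_idPr Ea; have := adapted_dim adE jd.
by rewrite seg // Ea perp_dim ?(ltnW jd) //; clear; lia.
Qed.

End AdaptedFlag.

(* The two flags agree in dimensions D. If they agree in dimension d - j, then j
   is a jump of both or of neither, and they agree in dimension j + 1 or j; so a
   gap of D containing a jump of only one of them would yield a longer gap of D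
   in which the dual argument applies. *)
Lemma adapted_flag_unique E E' : adapted_flag E -> adapted_flag E' ->
  (forall x, C x -> E x = E' x) -> forall j, (j < d)%N ->
  (E j != perp (E (d - j)%N)) = (E' j != perp (E' (d - j)%N)).
Proof.
move=> adE adE' CE.
pose D : pred nat := fun x => E x == E' x.
have CD x : C x -> D x by move=> /CE EE'; apply/eqP.
have E0 G : adapted_flag G -> G 0%N = 0%VS.
  by move=> adG; apply/eqP; rewrite -dimv_eq0 (adapted_dim adG).
have Ed G : adapted_flag G -> G d = fullv.
  by move=> adG; apply/eqP; rewrite eqEdim subvf (adapted_dim adG) // leqnn.
have D0 : D 0%N by apply/eqP; rewrite !E0.
have Dd : D d by apply/eqP; rewrite !Ed.
have step a b j : is_gap D a b -> (a <= j < b)%N -> (b <= d)%N -> D (d - j)%N ->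
    (E j != perp (E (d - j)%N)) = (E' j != perp (E' (d - j)%N)) /\
    if E j != perp (E (d - j)%N) then j.+1 = b else j = a.
  move=> [Da Db ab gx] /andP[aj jb] bd Dj.
  have ajd : (a <= j < d)%N by rewrite aj (leq_trans jb).
  have nD x : (a < x <= j)%N -> ~~ D x.
    by move=> /andP[ax xj]; apply: gx; rewrite ax (leq_ltn_trans xj).
  have [TE nextE] := adapted_next adE CD ajd nD.
  have [TE' nextE'] := adapted_next adE' CD ajd nD.
  have TT' : (E j != perp (E (d - j)%N)) = (E' j != perp (E' (d - j)%N)).
    by rewrite TE TE' -(eqP Da) -(eqP Dj).
  split=> //; case: ifPn => jT.
    have Dj1 : D j.+1 by apply/eqP; rewrite nextE // nextE' -?TT' // (eqP Da) (eqP Dj).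
    apply/eqP; rewrite eqn_leq jb /= leqNgt; apply/negP => j1b.
    by have := gx j.+1; rewrite ltnS aj j1b Dj1 => /(_ isT).
  have Dj1 : D j.
    move: (jT) (jT); rewrite {2}TT' !negbK /D => /eqP -> /eqP ->.
    by rewrite (eqP Dj).
  apply/eqP; rewrite eqn_leq aj andbT leqNgt; apply/negP => ja.
  by have := gx j; rewrite ja jb Dj1 => /(_ isT).
have chain G a b j : adapted_flag G -> is_gap D a b -> (b <= d)%N ->
    (a <= j < b)%N -> G j != perp (G (d - j)%N) ->
    forall i, (a <= i <= j)%N -> G i != perp (G (d - i)%N).
  move=> adG [Da Db ab gx] bd /andP[aj jb]; apply: (adapted_chain adG CD).
    by rewrite aj (leq_trans jb).
  by move=> x /andP[ax xj]; apply: gx; rewrite ax (leq_ltn_trans xj).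
move=> j jd; have [a [b [gab ajb]]] := gap_at D0 Dd jd.
have [aj jb] := andP ajb; have [Da Db ab _] := gab.
have bd : (b <= d)%N.
  rewrite leqNgt; apply/negP => db; have [_ _ _ gx] := gab.
  by have := gx d; rewrite db (leq_ltn_trans aj) // Dd => /(_ isT).
apply: contrapT => neq.
(* A common dimension [d - i] with [i] in the gap would give a common jump at the top of the gap or
   a common non-jump at its bottom; in either case [chain] forces the same answer at [j] for both
   flags. *)
have nDj i : (a <= i < b)%N -> ~~ D (d - i)%N.
  move=> aib; have [ai ib] := andP aib; apply/negP => Di.
  have [TT'] := step a b i gab aib bd Di.
  case: ifPn => [iT ib1|iT iE].
    have ij : (a <= j <= i)%N by rewrite aj -ltnS ib1.
    have iT' : E' i != perp (E' (d - i)%N) by rewrite -TT'.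
    have T1 := chain E a b i adE gab bd aib iT j ij.
    have T2 := chain E' a b i adE' gab bd aib iT' j ij.
    by apply: neq; rewrite T1 T2.
  subst i; have aa : (a <= a <= j)%N by rewrite leqnn.
  have iT' : ~~ (E' a != perp (E' (d - a)%N)) by rewrite -TT'.
  have T1 : (E j != perp (E (d - j)%N)) = false.
    by apply: contraNF iT => Tj; apply: (chain E a b j adE gab bd ajb Tj a aa).
  have T2 : (E' j != perp (E' (d - j)%N)) = false.
    by apply: contraNF iT' => Tj; apply: (chain E' a b j adE' gab bd ajb Tj a aa).
  by apply: neq; rewrite T1 T2.
(* The gap around [d - b] therefore contains [d - a]. As [a] and [b] are in [D], [step] gives a
   non-jump at [d - b] and a jump at [d - a], which contradicts [chain]. *)
have zd : (d - b < d)%N by clear -ab bd; lia.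
have [y [y' [gyy /andP[yz zy']]]] := gap_at D0 Dd zd.
have [Dy Dy' _ gy] := gyy.
have y'd : (y' <= d)%N.
  rewrite leqNgt; apply/negP => dy'.
  by have := gy d; rewrite dy' (leq_ltn_trans yz) // Dd => /(_ isT).
have y'a : (d - a < y')%N.
  rewrite ltnNge; apply/negP => y'a; have := nDj (d - y')%N.
  rewrite subKn // Dy' => /(_ _)/wrap[] //; clear -y'a zy' y'd ab bd; lia.
have bK : (d - (d - b) = b)%N by rewrite subKn.
have aK : (d - (d - a) = a)%N by rewrite subKn //; clear -ab bd; lia.
have ybd : (y <= d - b < y')%N by rewrite yz.
have Dbd : D (d - (d - b))%N by rewrite bK.
have [_] := step y y' (d - b)%N gyy ybd y'd Dbd.
case: ifPn => [_ E1|bT yE]; first by clear -E1 y'a ab bd; lia.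
have yay : (y <= d - a < y')%N by rewrite y'a andbT -yE; clear -ab; lia.
have Dad : D (d - (d - a))%N by rewrite aK.
have [_] := step y y' (d - a)%N gyy yay y'd Dad.
case: ifPn => [aT _|_ E1]; last by clear -E1 yE ab bd; lia.
have yy : (y <= d - b <= d - a)%N by rewrite yE leqnn -yE; clear -ab; lia.
by case/negP: bT; apply: (chain E y y' (d - a)%N adE gyy y'd yay aT _ yy).
Qed.

End SesquilinearForm.

(** * Flags of matrices *)

Section MatrixFlags.
Variables (k : fieldType) (d : nat).
Implicit Types (g h : 'M[k]_d) (w : 'cV[k]_d).

Let col_mul j g h : col j (g *m h) = g *m col j h.
Proof. by rewrite !colE mulmxA. Qed.

(** The span of the first [x] columns of an invertible [g], described by the vanishing of the other
    coordinates in the basis of columns. *)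
Definition flag g (x : nat) : {vspace 'cV[k]_d} :=
  lker (linfun (mulmx (copid_mx x *m invmx g))).

Lemma flagP g x w :
  reflect (forall i : 'I_d, (x <= i)%N -> (invmx g *m w) i 0 = 0) (w \in flag g x).
Proof.
rewrite memv_ker lfunE /= -mulmxA.
have E i : (copid_mx x *m (invmx g *m w)) i 0 =
    if (x <= i)%N then (invmx g *m w) i 0 else 0.
  rewrite [LHS]mxE (bigD1 i) //= big1 => [|j ji].
    by rewrite addr0 !mxE !eqxx /=; case: (ltnP i x) => _; rewrite ?subrr ?mul0r ?subr0 ?mul1r.
  have ij : (i == j :> nat) = false by rewrite eq_sym; apply/negbTE.
  by rewrite !mxE -[i == j]/(i == j :> nat) ij subrr mul0r.
apply: (iffP eqP) => [E0 i xi|E0].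
  by have := E i; rewrite E0 mxE xi.
by apply/colP => i; rewrite E [RHS]mxE; case: ifP => // xi; exact: E0.
Qed.

Lemma dim_cV : \dim {:'cV[k]_d} = d.
Proof. by rewrite dimvf /dim /= muln1. Qed.

Lemma flag_mono g x y : (x <= y)%N -> (flag g x <= flag g y)%VS.
Proof.
move=> xy; apply/subvP => w /flagP wx; apply/flagP => i yi.
by apply: wx; apply: leq_trans yi.
Qed.

Lemma col_decomposition g w : g \in unitmx ->
  w = \sum_j (invmx g *m w) j 0 *: col j g.
Proof.
move=> gU; rewrite -{1}[w](mulKVmx gU); apply/colP => i.
by rewrite summxE mxE; apply: eq_bigr => j _; rewrite [RHS]mxE [col _ _ _ _]mxE mulrC.
Qed.

Lemma col_flag g (j : 'I_d) x : g \in unitmx -> (j < x)%N -> col j g \in flag g x.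
Proof.
move=> gU jx; apply/flagP => i xi; rewrite -col_mul mulVmx // !mxE.
by case: eqP => // ij; move: xi; rewrite ij leqNgt jx.
Qed.

Lemma flag_sum g x w : g \in unitmx -> w \in flag g x ->
  w = \sum_(j < d | (j < x)%N) (invmx g *m w) j 0 *: col j g.
Proof.
move=> gU /flagP wx; rewrite {1}(col_decomposition w gU) (bigID (fun j : 'I_d => (j < x)%N)) /=.
rewrite [X in _ + X]big1 ?addr0 // => j; rewrite -leqNgt => xj.
by rewrite wx // scale0r.
Qed.

(** The dimension grows by at most 1 at each of the [d] steps and goes from 0 to [d], so that it
    grows by exactly 1. *)
Lemma dim_flag g x : g \in unitmx -> (x <= d)%N -> \dim (flag g x) = x.
Proof.
move=> gU.
have step y : (\dim (flag g y.+1) <= (\dim (flag g y)).+1)%N.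
  have [yd|dy] := ltnP y d; last first.
    apply/leqW/dimvS/subvP => w /flagP wy; apply/flagP => i yi.
    by have := leq_trans dy yi; rewrite leqNgt ltn_ord.
  have /dimvS : (flag g y.+1 <= flag g y + <[col (Ordinal yd) g]>)%VS.
    apply/subvP => w wy; rewrite {1}(flag_sum gU wy) (bigD1 (Ordinal yd)) //= addrC.
    apply: memv_add; last by rewrite memvZ ?memv_line.
    apply: rpred_sum => j /andP[jy jn]; apply/rpredZ/col_flag => //.
    by rewrite ltn_neqAle -ltnS jy andbT.
  move/leq_trans; apply; apply: leq_trans (dimv_add_leqif _ _).1 _.
  by rewrite dim_vline; case: (_ != 0); rewrite ?addn1 ?addn0.
have f0 : \dim (flag g 0) = 0%N.
  apply/eqP; rewrite dimv_eq0 -subv0; apply/subvP => w /flagP w0.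
  rewrite memv0 (col_decomposition w gU) big1 // => j _.
  by rewrite w0 // scale0r.
have fd : \dim (flag g d) = d.
  rewrite -[RHS]dim_cV; congr (\dim _); apply/eqP; rewrite eqEsubv subvf /=.
  by apply/subvP => w _; apply/flagP => i; rewrite leqNgt ltn_ord.
have le y : (\dim (flag g y) <= y)%N.
  by elim: y => [|y IH]; rewrite ?f0 // (leq_trans (step y)).
have ge n y : (\dim (flag g (y + n)) <= \dim (flag g y) + n)%N.
  elim: n => [|n IH]; first by rewrite !addn0.
  by rewrite !addnS (leq_trans (step _)).
move=> xd; apply/eqP; rewrite eqn_leq le /=.
by have := ge (d - x)%N x; rewrite subnKC // fd; lia.
Qed.

Lemma flag_sub g h x y : h \in unitmx ->
  reflect (forall i j : 'I_d, (j < x)%N -> (y <= i)%N -> (invmx g *m h) i j = 0)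
    (flag h x <= flag g y)%VS.
Proof.
move=> hU; apply: (iffP subvP) => [hg i j jx yi|hg w wx].
  by have /flagP/(_ i yi) := hg _ (col_flag hU jx); rewrite -col_mul mxE.
rewrite (flag_sum hU wx); apply: rpred_sum => j jx; apply/rpredZ/flagP => i yi.
by rewrite -col_mul mxE hg.
Qed.

Lemma same_flagP J (g h : GL k d) :
  reflect (forall x, (0 < x < d)%N -> x \notin J -> flag (val g) x = flag (val h) x)
    (same_flag J g h).
Proof.
have [gU hU] : val g \in unitmx /\ val h \in unitmx by split; apply: valP.
apply: (iffP (parabolicP _ _)) => [[_ gh] x /andP[x0 xd] xJ|gh].
  apply/esym/eqP; rewrite eqEdim !dim_flag ?(ltnW xd) // leqnn andbT.
  apply/flag_sub => // i j jx xi; apply: (gh (Ordinal xd)) => //.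
  by rewrite /= jx.
split; first by rewrite unitmx_mul unitmx_inv gU.
move=> x x0 xJ i j /andP[jx xi].
have xd : (0 < x < d)%N by rewrite x0 ltn_ord.
have := flag_sub (val g) x x hU; rewrite gh // subvv => /elimT; exact.
Qed.

Lemma exists_flag_basis (E : nat -> {vspace 'cV[k]_d}) :
  (forall x, (x <= d)%N -> \dim (E x) = x) ->
  (forall x y, (x <= y <= d)%N -> (E x <= E y)%VS) ->
  exists2 g, g \in unitmx & forall x, (x <= d)%N -> flag g x = E x.
Proof.
move=> E_dim E_mono.
have exv (x : 'I_d) : exists v, v \in E x.+1 /\ v \notin E x.
  have /subvPn[v vE vx] : ~~ (E x.+1 <= E x)%VS; last by exists v.
  by apply/negP => /dimvS; rewrite !E_dim ?ltnn // ltnW.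
have [v vE] := choice exv.
pose g := \matrix_(i, j) v j i 0.
have colg j : col j g = v j by apply/colP => i; rewrite !mxE.
have gU : g \in unitmx.
  rewrite -unitmx_tr -row_free_unit -kermx_eq0; apply/eqP/row_matrixP => r.
  rewrite row0; move: (row_mul r (kermx g^T) g^T); rewrite mulmx_ker row0.
  move: (row r _) => c c0; apply/rowP => j; rewrite mxE.
  have c_sum : \sum_j c 0 j *: v j = 0.
    apply/colP => i; rewrite summxE mxE; have /rowP/(_ i) := c0; rewrite !mxE => /esym {2}<-.
    by apply: eq_bigr => l _; rewrite !mxE.
  apply/eqP/negPn/negP => cj.
  have [m cm mmax] : exists2 m : 'I_d, c 0 m != 0 & forall i : 'I_d, (m < i)%N -> c 0 i = 0.
    case: (@arg_maxnP _ j (fun m => c 0 m != 0) (fun m => m : nat) cj) => m cm mmax.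
    by exists m => // i mi; apply/eqP/negPn/negP => /mmax /=; rewrite /geq /= leqNgt mi.
  have [_ /negP] := vE m; apply.
  move/eqP: c_sum; rewrite (bigD1 m) //= addr_eq0 => /eqP cmE.
  rewrite -[v m](scalerK cm) cmE; apply: rpredZ; rewrite rpredN.
  apply: rpred_sum => i im; have [mi|mi] := ltnP m i; first by rewrite mmax ?scale0r ?mem0v.
  have {}mi : (i < m)%N by rewrite ltn_neqAle mi andbT; apply: contra im => /eqP/val_inj->.
  apply: rpredZ; have [vi _] := vE i; apply: subvP vi.
  by apply: E_mono; rewrite mi ltnW.
exists g => // x xd; apply/eqP; rewrite eqEdim dim_flag // E_dim // leqnn andbT.
apply/subvP => w wx; rewrite (flag_sum gU wx); apply: rpred_sum => j jx.
apply: rpredZ; rewrite colg; have [vj _] := vE j; apply: subvP vj.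
by apply: E_mono; rewrite jx.
Qed.

End MatrixFlags.

(** * The map [Phi] and orthogonality of flags *)

Section HermitianFlags.
Variables (k : closedFieldType) (d q : nat) (Fr : {rmorphism k -> k}) (H : 'M[k]_d).
Hypotheses (q_gt1 : (1 < q)%N) (FrE : forall x, Fr x = x ^+ q).
Hypotheses (H_unit : H \in unitmx)
  (H_anti : forall i j : 'I_d, ((i + j).+1 < d)%N -> H i j = 0).
Implicit Types (g h : 'M[k]_d).

Definition sesqui (x y : 'cV[k]_d) : k := (x^T *m H *m map_mx Fr y) 0 0.

Lemma sesquiDl z : {morph sesqui^~ z : x y / x + y}.
Proof. by move=> x y; rewrite /sesqui linearD /= !mulmxDl mxE. Qed.
Lemma sesquiZl a x z : sesqui (a *: x) z = a * sesqui x z.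
Proof. by rewrite /sesqui linearZ /= -!scalemxAl mxE. Qed.
Lemma sesquiDr x : {morph sesqui x : y z / y + z}.
Proof. by move=> y z; rewrite /sesqui map_mxD mulmxDr mxE. Qed.
Lemma sesquiZr a x z : sesqui x (a *: z) = Fr a * sesqui x z.
Proof. by rewrite /sesqui map_mxZ -scalemxAr mxE. Qed.
Lemma sesqui_nondeg x : (forall y, sesqui x y = 0) -> x = 0.
Proof.
move=> x0; apply/eqP; rewrite -trmx_eq0 -[x^T](mulmxK H_unit).
rewrite (_ : x^T *m H = 0) ?mul0mx //; apply/rowP => j.
have := x0 (delta_mx j 0); rewrite /sesqui map_delta_mx -colE mxE => ->.
by rewrite mxE.
Qed.

Local Notation perpH := (perp sesqui).
Local Notation Ph := (Phi q H).

Lemma PhiE g : Ph g = invmx H^T *m (map_mx Fr (invmx g))^T *m H^T.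
Proof.
by rewrite /Phi /adjoint (_ : map_mx _ _ = map_mx Fr (invmx g)) //; apply: eq_map_mx => x; rewrite FrE.
Qed.

Lemma Phi_unit g : g \in unitmx -> Ph g \in unitmx.
Proof.
move=> gU; rewrite PhiE !unitmx_mul unitmx_inv !unitmx_tr H_unit /=.
by rewrite map_unitmx unitmx_inv gU.
Qed.

Lemma Phi1 : Ph 1%:M = 1%:M.
Proof. by rewrite PhiE invmx1 map_mx1 trmx1 mulmx1 mulVmx // unitmx_tr. Qed.

Lemma PhiM g h : g \in unitmx -> h \in unitmx -> Ph (g *m h) = Ph g *m Ph h.
Proof.
move=> gU hU; have HtU : H^T \in unitmx by rewrite unitmx_tr.
have -> : Ph g *m Ph h = invmx H^T *m ((map_mx Fr (invmx g))^T *m (map_mx Fr (invmx h))^T) *m H^T.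
  by rewrite !PhiE !mulmxA mulmxK.
rewrite PhiE -trmx_mul -map_mxM; congr (_ *m (map_mx _ _)^T *m _).
have ghU : g *m h \in unitmx by rewrite unitmx_mul gU.
by rewrite -[RHS]mulmx1 -(mulmxV ghU) !mulmxA mulmxKV // mulVmx // mul1mx.
Qed.

Lemma Phi_sesqui g : g \in unitmx -> (Ph g)^T *m H *m map_mx Fr g = H.
Proof.
move=> gU; rewrite PhiE !trmx_mul trmx_inv !trmxK -!mulmxA.
by rewrite [invmx H *m _]mulmxA mulVmx // mul1mx -map_mxM mulVmx // map_mx1 mulmx1.
Qed.

Lemma sesqui_Phi g x y : g \in unitmx -> sesqui (Ph g *m x) (g *m y) = sesqui x y.
Proof.
move=> gU; rewrite /sesqui trmx_mul map_mxM.
have -> : x^T *m (Ph g)^T *m H *m (map_mx Fr g *m map_mx Fr y) =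
    x^T *m ((Ph g)^T *m H *m map_mx Fr g) *m map_mx Fr y by rewrite !mulmxA.
by rewrite Phi_sesqui.
Qed.

Lemma dim_perpH U : \dim (perpH U) = (d - \dim U)%N.
Proof.
by rewrite (dim_perp q_gt1 sesquiDl sesquiZl sesquiDr sesquiZr sesqui_nondeg) dim_cV.
Qed.

(** The pair [(Phi g, g)] preserves the form, which reduces orthogonality to the standard flag:
    there [H_anti] says that the first [x] basis vectors are orthogonal to the first [d - x].
    Dimensions do the rest. *)
Lemma perp_flag g x : g \in unitmx -> (x <= d)%N ->
  perpH (flag g (d - x)) = flag (Ph g) x.
Proof.
move=> gU xd; have PU := Phi_unit gU; apply/esym/eqP.
rewrite eqEdim dim_perpH !dim_flag ?leq_subr // subKn // leqnn andbT.
apply/subvP => w /flagP wx; apply/(perpP sesquiDl sesquiZl sesquiDr sesquiZr) => u /flagP ux.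
rewrite -[w](mulKVmx PU) -[u](mulKVmx gU) sesqui_Phi //.
rewrite /sesqui -mulmxA mxE big1 // => i _; rewrite mxE.
have [xi|ix] := leqP x i; first by rewrite wx // mul0r.
rewrite [X in _ * X]mxE big1 ?mulr0 // => j _; rewrite [map_mx _ _ _ _]mxE.
have [dj|jd] := leqP (d - x) j; first by rewrite ux // rmorph0 mulr0.
by rewrite H_anti ?mul0r //; lia.
Qed.

Lemma hessenberg_flag T g : path ltn 0%N T -> all (gtn d) T -> g \in unitmx ->
  hessenberg T (invmx g *m Ph g) <->
  (forall j, (j < d)%N -> (perpH (flag g (d - j)) <= flag g j.+1)%VS) /\
  (forall j, (j < d)%N -> (flag g j != perpH (flag g (d - j))) = (j \in T)).
Proof.
move=> T0 Td gU; have PU := Phi_unit gU; set A := invmx g *m Ph g.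
have T_gt0 : 0%N \notin T.
  by apply/negP => T00; have /allP/(_ _ T00) := order_path_min ltn_trans T0.
have neqE j : (j < d)%N ->
    (flag g j != perpH (flag g (d - j))) = ~~ (flag (Ph g) j <= flag g j)%VS.
  move=> jd; have jd' := ltnW jd; rewrite perp_flag // eq_sym; congr (~~ _).
  by rewrite eqEdim !dim_flag // leqnn andbT.
split=> [[AU A0 AT]|[P1 PT]].
  split=> j jd.
    rewrite perp_flag ?(ltnW jd) //; apply/flag_sub => // a c cj ja; apply: A0.
    exact: leq_ltn_trans cj ja.
  rewrite neqE //; case: j jd => [|j] jd.
    by rewrite (negPf T_gt0); apply/negbF/flag_sub.
  have jd' : (j < d)%N := ltnW jd.
  rewrite -[j.+1]/(nat_of_ord (Ordinal jd)) -(AT (Ordinal jd) (Ordinal jd')) //.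
  congr (~~ _); apply/flag_sub/eqP => // [E|E a c cj ja].
    by apply: E => //=.
  have [/eqP ac|ac] := boolP (a == c.+1 :> nat); last by apply: A0; lia.
  have -> : a = Ordinal jd by apply: ord_inj; move: (ac) ja cj => /=; clear; lia.
  by have -> : c = Ordinal jd' by apply: ord_inj; move: (ac) ja cj => /=; clear; lia.
have A0 (i j : 'I_d) : (j.+1 < i)%N -> A i j = 0.
  move=> ji; have jd : (j.+1 < d)%N := ltn_trans ji (ltn_ord i).
  have := P1 j.+1 jd; rewrite perp_flag ?(ltnW jd) // => /flag_sub; apply=> //.
split=> // [|i j ij]; first by rewrite unitmx_mul unitmx_inv gU.
rewrite -PT // neqE //; congr (~~ _); apply/eqP/flag_sub => // [E a c cj ja|E].
  have [/eqP ac|ac] := boolP (a == c.+1 :> nat); last by apply: A0; lia.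
  have -> : a = i by apply: ord_inj; move: (ac) ja cj (ij) => /=; clear; lia.
  by have -> : c = j by apply: ord_inj; move: (ac) ja cj (ij) => /=; clear; lia.
by apply: E; rewrite ?ij.
Qed.

End HermitianFlags.

(** * Deformation of solutions of the Lang equation *)

Lemma exists_frobenius (R : comNzRingType) p e : p \in [pchar R] ->
  exists F : {rmorphism R -> R}, forall x, F x = x ^+ (p ^ e)%N.
Proof.
move=> pR; elim: e => [|e [F FE]]; first by exists idfun => x; rewrite expn0 expr1.
exists (pFrobenius_aut pR \o F) => x.
by rewrite /= FE pFrobenius_autE -exprM expnSr.
Qed.

Lemma map_invmx_unit (R S : comUnitRingType) (f : {rmorphism R -> S}) n (M : 'M[R]_n) :
  M \in unitmx -> map_mx f (invmx M) = invmx (map_mx f M).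
Proof.
move=> MU; have fMU : map_mx f M \in unitmx by rewrite unitmxE det_map_mx rmorph_unit.
by rewrite -[LHS]mulmx1 -(mulmxV fMU) mulmxA -map_mxM mulVmx // map_mx1 mul1mx.
Qed.

Section StarEquation.
Variables (q d : nat).

(* The equation G A = Phi G without inverses, hence compatible with all ring
   morphisms. *)
Definition star (R : comNzRingType) (H G A : 'M[R]_d) : 'M[R]_d :=
  (map_mx (fun x => x ^+ q) G)^T *m H^T *m G *m A - H^T.

Lemma map_star (R S : comNzRingType) (f : {rmorphism R -> S}) (H G A : 'M[R]_d) :
  map_mx f (star H G A) = star (map_mx f H) (map_mx f G) (map_mx f A).
Proof.
have E : map_mx f (map_mx (fun x => x ^+ q) G) = map_mx (fun x => x ^+ q) (map_mx f G).
  by apply/matrixP => i j; rewrite !mxE rmorphXn.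
by rewrite /star map_mxB !map_mxM -!map_trmx E.
Qed.

Variables (R : comUnitRingType) (F : {rmorphism R -> R}) (H : 'M[R]_d).
Hypotheses (FE : forall x, F x = x ^+ q) (HU : H \in unitmx) (FH : map_mx F H = H^T).
Implicit Types G A : 'M[R]_d.

Let HtU : H^T \in unitmx. Proof. by rewrite unitmx_tr. Qed.

Let starE G A : star H G A = (map_mx F G)^T *m H^T *m G *m A - H^T.
Proof.
have E : map_mx (fun x => x ^+ q) G = map_mx F G by apply: eq_map_mx => x; rewrite FE.
by rewrite /star E.
Qed.

(* Phi (Phi G) is the square of the Frobenius, so that the equation G A = Phi G
   implies that G is a fixed point of this operator. *)
Definition lang_step A G : 'M[R]_d :=
  map_mx F (map_mx F G) *m (invmx H^T *m (map_mx F A)^T *m H^T *m invmx A).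

(** The equation reads [M G A = H^T] with [M = F(G)^T H^T]; its transposed Frobenius twist reads
    [F(A)^T M F(F(G)) = H^T] and gives the inverse of [M]. *)
Lemma star_lang_step G A : A \in unitmx -> star H G A = 0 -> lang_step A G = G.
Proof.
move=> AU /eqP; rewrite starE subr_eq0 => /eqP sE.
pose M := (map_mx F G)^T *m H^T.
have ME : (map_mx F A)^T *m M *m map_mx F (map_mx F G) = H^T.
  have := congr1 (fun X => map_mx F X^T) sE; rewrite trmxK FH => <-.
  by rewrite !trmx_mul !trmxK !map_mxM FH -!map_trmx /M !mulmxA.
have inv : map_mx F (map_mx F G) *m invmx H^T *m ((map_mx F A)^T *m M) = 1%:M.
  by apply: mulmx1C; rewrite mulmxA ME mulmxV.
have MG : H^T *m invmx A = M *m G by rewrite -sE -/M mulmxK.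
rewrite /lang_step -!mulmxA MG.
by move: inv; rewrite -!mulmxA => inv; rewrite !mulmxA -!mulmxA in inv *; rewrite -[RHS]mul1mx -inv !mulmxA.
Qed.

(** Being a fixed point of [lang_step] is only a consequence of the equation, but the defect [N] of
    a fixed point is a linear expression in its own Frobenius twist: for series, such an [N] is 0
    once its constant term is. *)
Lemma lang_step_star G A : A \in unitmx -> lang_step A G = G ->
  let N := star H G A in
  N = invmx (map_mx F A)^T *m (map_mx F N)^T *m invmx H^T *m (map_mx F A)^T *m H^T.
Proof.
move=> AU GE N.
have FAU : (map_mx F A)^T \in unitmx.
  by rewrite unitmx_tr unitmxE det_map_mx rmorph_unit.
pose S := (map_mx F G)^T *m H^T *m G *m A.
have NE : N = S - H^T := starE G A.
have FS : (map_mx F S)^T = (map_mx F A)^T *m ((map_mx F G)^T *m H^T *m map_mx F (map_mx F G)).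
  by rewrite /S !map_mxM !trmx_mul -!map_trmx !trmxK FH !mulmxA.
have GA : map_mx F (map_mx F G) *m (invmx H^T *m (map_mx F A)^T *m H^T) = G *m A.
  by rewrite -{2}GE /lang_step -!mulmxA mulVmx // mulmx1.
have FSE : (map_mx F S)^T *m invmx H^T *m (map_mx F A)^T *m H^T = (map_mx F A)^T *m S.
  by rewrite FS -!mulmxA; congr (_ *m _); rewrite /S -!mulmxA -GA !mulmxA.
have FN : (map_mx F N)^T = (map_mx F S)^T - H^T.
  by rewrite NE map_mxB linearB /= -map_trmx FH trmxK.
rewrite FN mulmxBr !mulmxBl -!mulmxA [(map_mx F S)^T *m _]mulmxA.
rewrite NE; congr (_ - _).
  have := FSE; rewrite -!mulmxA => ->.
  by rewrite mulKmx.
by rewrite [H^T *m (invmx _ *m _)]mulmxA mulmxV // mul1mx mulKmx.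
Qed.

End StarEquation.

Section SeriesLift.
Variables (k : fieldType) (p e d : nat).
Hypotheses (p_char : p \in [pchar k]) (e_gt0 : (0 < e)%N).
Let q := (p ^ e)%N.

Let p_char_series : p \in [pchar (series k)].
Proof.
apply: (@rmorph_pchar _ _ (@series_poly k \o polyC) p); exact: p_char.
Qed.

Definition vanish n (x : series k) : Prop := forall m, (m < n)%N -> x m = 0.

Lemma vanishB n x y : vanish n x -> vanish n y -> vanish n (x - y).
Proof. by move=> x0 y0 m mn; rewrite series_addE series_oppE x0 // y0 // subr0. Qed.

Lemma vanishM n m x y : vanish n x -> vanish m y -> vanish (n + m) (x * y).
Proof.
move=> x0 y0 i inm; rewrite series_coefM big1 // => j _.
have [jn|nj] := ltnP j n; first by rewrite x0 // mul0r.
rewrite y0 ?mulr0 //; have := ltn_ord j; move: inm nj; clear; lia.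
Qed.

Let vanish_sum n (I : Type) (r : seq I) (P : pred I) (f : I -> series k) :
  (forall i, P i -> vanish n (f i)) -> vanish n (\sum_(i <- r | P i) f i).
Proof.
move=> f0; elim/big_rec: _ => [|i x Pi x0] m mn; first exact: series_0E.
by rewrite series_addE f0 // x0 // addr0.
Qed.

Definition mx_vanish n (M : 'M[series k]_d) : Prop := forall i j, vanish n (M i j).

Lemma mx_vanish_mull n M M' : mx_vanish n M -> mx_vanish n (M *m M').
Proof.
move=> M0 i j; rewrite mxE; apply: vanish_sum => l _.
by rewrite -[n]addn0; apply: vanishM.
Qed.

Lemma mx_vanish_mulr n M M' : mx_vanish n M -> mx_vanish n (M' *m M).
Proof.
move=> M0 i j; rewrite mxE; apply: vanish_sum => l _.
by rewrite -[n]add0n; apply: vanishM.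
Qed.

Lemma mx_vanish0 M : (forall n, mx_vanish n M) -> M = 0.
Proof.
move=> M0; apply/matrixP => i j; apply/funext => n.
by rewrite (M0 n.+1 i j n (ltnSn n)) mxE series_0E.
Qed.

Variable (FR : {rmorphism series k -> series k}).
Hypothesis FRE : forall x, FR x = x ^+ q.

(** Since [q >= 2], the order of vanishing at least doubles, and [n + n > n] for [n > 0]. *)
Let vanish_FR n x : (0 < n)%N -> vanish n x -> vanish n.+1 (FR x).
Proof.
move=> n0 x0; rewrite FRE.
have -> : q = (q - 2).+2.
  have p1 : (1 < p)%N by apply/prime_gt1/(pcharf_prime p_char).
  by have := ltn_expl e p1; rewrite -/q; move: e_gt0; clear; lia.
rewrite exprS exprS mulrA => m mn.
have := @vanishM (n + n) 0 _ (x ^+ (q - 2)) (vanishM x0 x0).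
by move=> /(_ _)/(_ _); apply=> //; rewrite addn0; move: mn n0; clear; lia.
Qed.

Let mx_vanish_FR n M : (0 < n)%N -> mx_vanish n M -> mx_vanish n.+1 (map_mx FR M).
Proof. by move=> n0 M0 i j; rewrite mxE; apply: vanish_FR. Qed.

Variables (F : {rmorphism k -> k}) (H g0 : 'M[k]_d) (AX : 'M[{poly k}]_d).
Hypotheses (FE : forall x, F x = x ^+ q) (HU : H \in unitmx) (FH : map_mx F H = H^T).
Hypotheses (AXU : AX \in unitmx)
  (g0E : star q H g0 (map_mx (horner_eval 0) AX) = 0).

Let const : {rmorphism k -> series k} := @series_poly k \o polyC.
Local Notation coef0 := (@series_coef0 k).

Let vanish1 (M : 'M[series k]_d) : map_mx coef0 M = 0 -> mx_vanish 1 M.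
Proof.
by move=> M0 i j [|//] _; have /matrixP/(_ i j) := M0; rewrite !mxE.
Qed.

(** The iterates of [lang_step] from the constant [g0] converge [t]-adically: [g0] is a fixed point
    modulo [t], and each step gains an order. The limit is a fixed point with constant term [g0],
    and its defect is 0 by [lang_step_star]. *)
Theorem series_lift : exists G : 'M[series k]_d,
  star q (map_mx const H) G (map_mx (@series_poly k) AX) = 0 /\
  map_mx (fun x : series k => x 0%N) G = g0.
Proof.
pose A := map_mx (@series_poly k) AX; pose HR := map_mx const H.
have AU : A \in unitmx by rewrite unitmxE det_map_mx rmorph_unit.
have HRU : HR \in unitmx by rewrite map_unitmx.
have FHR : map_mx FR HR = HR^T.
  rewrite /HR map_trmx -FH; apply/matrixP => i j; rewrite !mxE FRE FE.
  by rewrite -!rmorphXn.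
have A0E : map_mx coef0 A = map_mx (horner_eval 0) AX.
  by apply/matrixP => i j; rewrite !mxE /horner_eval horner_coef0.
have HR0 : map_mx coef0 HR = H.
  by apply/matrixP => i j; rewrite !mxE /series_coef0 /= /series_poly coefC.
have A0U : map_mx (horner_eval 0) AX \in unitmx.
  by rewrite unitmxE det_map_mx rmorph_unit.
pose step := lang_step FR HR A.
have stepB G G' : step G - step G' =
    map_mx FR (map_mx FR (G - G')) *m (invmx HR^T *m (map_mx FR A)^T *m HR^T *m invmx A).
  by rewrite !map_mxB mulmxBl.
have step_vanish n G G' : (0 < n)%N -> mx_vanish n (G - G') -> mx_vanish n.+1 (step G - step G').
  move=> n0 GG'; rewrite stepB; apply: mx_vanish_mull.
  by move=> i j m mn; apply: (mx_vanish_FR (ltn0Sn n) (mx_vanish_FR n0 GG')); apply: ltnW.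
pose G_ n := iter n step (map_mx const g0).
have G_step n : mx_vanish n.+1 (G_ n.+1 - G_ n).
  elim: n => [|n IH]; last exact: step_vanish.
  apply: vanish1; rewrite /G_ /=.
  have -> : map_mx coef0 (step (map_mx const g0) - map_mx const g0) =
      lang_step F H (map_mx (horner_eval 0) AX) g0 - g0.
    have c0 : map_mx coef0 (map_mx const g0) = g0.
      by apply/matrixP => i j; rewrite !mxE /series_coef0 /= /series_poly coefC.
    have cF (M : 'M[series k]_d) : map_mx coef0 (map_mx FR M) = map_mx F (map_mx coef0 M).
      by apply/matrixP => i j; rewrite !mxE FRE FE rmorphXn.
    rewrite map_mxB c0; congr (_ - _).
    have HRtU : HR^T \in unitmx by rewrite unitmx_tr.
    have AE : map_mx coef0 (map_mx FR A)^T = (map_mx F (map_mx (horner_eval 0) AX))^T.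
      by rewrite -map_trmx cF A0E.
    have HE : map_mx coef0 HR^T = H^T by rewrite -map_trmx HR0.
    rewrite /step /lang_step (map_mxM coef0) cF cF c0 (map_mxM coef0) (map_mxM coef0).
    rewrite (map_mxM coef0) (map_invmx_unit coef0 HRtU) (map_invmx_unit coef0 AU).
    by rewrite AE HE A0E.
  by rewrite (star_lang_step FE HU FH A0U g0E) subrr.
have G_stable n m : mx_vanish n.+1 (G_ (n + m)%N - G_ n).
  elim: m => [|m IH] i j l ln; first by rewrite addn0 subrr mxE series_0E.
  have := G_step (n + m)%N i j l; have := IH i j l ln.
  rewrite addnS !mxE !series_addE !series_oppE => /eqP; rewrite subr_eq0 => /eqP <- -> //.
  by apply: leq_trans ln _; rewrite ltnS leq_addr.
(* Diagonal limit: the coefficient [n] no longer changes from the iterate [n] on. *)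
pose G : 'M[series k]_d := \matrix_(i, j) (fun n => G_ n i j n : k).
have GG_ n : mx_vanish n.+1 (G - G_ n).
  move=> i j l ln; have := G_stable l (n - l)%N i j l (ltnSn l).
  rewrite subnKC // !mxE !series_addE !series_oppE => /eqP.
  by rewrite subr_eq0 => /eqP->; rewrite subrr.
have GE : step G = G.
  apply/eqP; rewrite -subr_eq0; apply/eqP/mx_vanish0 => n i j l ln.
  have -> : step G - G = (step G - step (G_ n)) - (G - G_ n.+1).
    by rewrite -[G_ n.+1]/(step (G_ n)) opprB addrA subrK.
  rewrite mxE [in X in _ + X]mxE; apply: (@vanishB n) => //.
    by move=> m mn; apply: (step_vanish _ _ _ (ltn0Sn n) (GG_ n)); apply: ltnW (ltnW _).
  by move=> m mn; apply: (GG_ n.+1); apply: ltnW (ltnW _).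
have G0 : map_mx (fun x : series k => x 0%N) G = g0.
  by apply/matrixP => i j; rewrite !mxE /= /series_poly coefC.
exists G; split=> //.
have NE := lang_step_star FRE HRU FHR AU GE.
apply: mx_vanish0; elim=> [|[|n] IH] //; last first.
  rewrite NE; do 3 apply: mx_vanish_mull; apply: mx_vanish_mulr => i j.
  by rewrite [X in vanish _ X]mxE; apply: mx_vanish_FR.
by apply: vanish1; rewrite map_star HR0 A0E -[map_mx coef0 G]/(map_mx (fun x : series k => x 0%N) G) G0.
Qed.

End SeriesLift.

Lemma rmorph_mmap n (R : comNzRingType) (S S' : comNzRingType) (phi : {rmorphism S -> S'})
    (h : R -> S) (x : 'I_n -> S) (f : mpoly.mpoly n R) :
  phi (mpoly.mmap h x f) = mpoly.mmap (phi \o h) (phi \o x) f.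
Proof.
rewrite /mpoly.mmap rmorph_sum; apply: eq_bigr => m _; rewrite rmorphM; congr (_ * _).
by rewrite /mpoly.mmap1 rmorph_prod; apply: eq_bigr => i _; rewrite rmorphXn.
Qed.

Lemma eq_mmap n (R S : comNzRingType) (h h' : R -> S) (x x' : 'I_n -> S) (f : mpoly.mpoly n R) :
  h =1 h' -> x =1 x' -> mpoly.mmap h x f = mpoly.mmap h' x' f.
Proof.
move=> hh xx; rewrite /mpoly.mmap; apply: eq_bigr => m _; rewrite hh; congr (_ * _).
by rewrite /mpoly.mmap1; apply: eq_bigr => i _; rewrite xx.
Qed.

Section Deformation.
Variables (k : closedFieldType) (p e d : nat).
Hypotheses (p_char : p \in [pchar k]) (e_gt0 : (0 < e)%N).
Let q := (p ^ e)%N.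
Variables (F : {rmorphism k -> k}) (H : 'M[k]_d).
Hypotheses (FE : forall x, F x = x ^+ q) (HU : H \in unitmx) (FH : map_mx F H = H^T).

Let starP (g A : 'M[k]_d) :
  g \in unitmx -> star q H g A = 0 <-> A = invmx g *m Phi q H g.
Proof.
move=> gU; have HtU : H^T \in unitmx by rewrite unitmx_tr.
have FgU : (map_mx F g)^T \in unitmx by rewrite unitmx_tr map_unitmx.
have E : map_mx (fun x => x ^+ q) g = map_mx F g by apply: eq_map_mx => x; rewrite FE.
rewrite /star E (PhiE _ FE) map_invmx trmx_inv.
split=> [/eqP|->]; last first.
  by rewrite -[_ *m g *m _]mulmxA mulKVmx // -!mulmxA mulKVmx // mulKVmx // subrr.
rewrite subr_eq0 => /eqP sE; rewrite -{2}sE -!mulmxA mulKmx // mulKmx //.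
by rewrite mulKmx.
Qed.

Let star_unit (g A : 'M[k]_d) : star q H g A = 0 -> g \in unitmx.
Proof.
rewrite /star => /eqP; rewrite subr_eq0 => /eqP E.
have := HU; rewrite -unitmx_tr -E -mulmxA unitmx_mul => /andP[_].
by rewrite unitmx_mul => /andP[].
Qed.

(** The pair [(t, g)] is a point of the [k]-algebra generated by [t] and the entries of the series
    solution [G], chosen such that [t * f(G)] does not vanish there. This product is nonzero as the
    constant coefficient of [f(G)] is [f(g0)]. *)
Theorem deformation (AX : 'M[{poly k}]_d) (g0 : 'M[k]_d) (f : mpoly.mpoly (d * d) k) :
  AX \in unitmx -> g0 \in unitmx ->
  map_mx (horner_eval 0) AX = invmx g0 *m Phi q H g0 ->
  mpoly.meval (fun i => mxvec g0 0 i) f != 0 ->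
  exists t g, [/\ t != 0, g \in unitmx, mpoly.meval (fun i => mxvec g 0 i) f != 0 &
    map_mx (horner_eval t) AX = invmx g *m Phi q H g].
Proof.
move=> AXU g0U A0 fg0.
pose const : {rmorphism k -> series k} := @series_poly k \o polyC.
have p_char_series : p \in [pchar (series k)] by apply: (rmorph_pchar const).
have [FR FRE] := exists_frobenius e p_char_series.
have g0E : star q H g0 (map_mx (horner_eval 0) AX) = 0 by apply/starP.
have [G [GE G0]] := series_lift p_char e_gt0 FRE FE HU FH AXU g0E.
pose z := series_poly 'X :: [seq mxvec G 0 i | i <- enum 'I_(d * d)].
have [A [c [psi [x [sp psic psix]]]]] := specializable_points const z.
have psix0 : psi (x 0%N) = series_poly 'X by rewrite psix.
have psixS (i : 'I_(d * d)) : psi (x i.+1) = mxvec G 0 i.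
  have iz : (i.+1 < size z)%N by rewrite /= ltnS size_map size_enum_ord.
  by rewrite psix //= (nth_map i) ?size_enum_ord // nth_ord_enum.
pose h := x 0%N * mpoly.mmap c (fun i => x i.+1) f.
have psih : psi h != 0.
  rewrite /h rmorphM psix0 mulf_neq0 //.
    apply/eqP => /(congr1 (fun s : series k => s 1%N)); rewrite series_0E.
    by rewrite /series_poly coefX => /eqP; rewrite oner_eq0.
  rewrite rmorph_mmap; apply: contraNneq fg0.
  move=> /(congr1 (fun s : series k => s 0%N)); rewrite series_0E.
  rewrite -[_ 0%N]/(series_coef0 _) rmorph_mmap => fG; apply/eqP; rewrite -[RHS]fG.
  apply: eq_mmap => [a|i] /=; first by rewrite psic /series_coef0 /= /series_poly coefC.
  by rewrite psixS -G0 -map_mxvec [LHS]mxE.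
have [phi [phic phi0 phih]] := sp _ psih.
pose GA : 'M[A]_d := vec_mx (\row_i x i.+1).
pose evx := horner_eval (x 0%N) \o map_poly c.
pose g : 'M[k]_d := map_mx phi GA; pose t := phi (x 0%N).
have psiG : map_mx psi GA = G.
  apply/matrixP => i j; rewrite !mxE psixS -[RHS](mxvecE G).
  by [].
have gE : star q H g (map_mx (horner_eval t) AX) = 0.
  have phiH : map_mx phi (map_mx c H) = H by apply/matrixP => i j; rewrite !mxE phic.
  have phiA : map_mx phi (map_mx evx AX) = map_mx (horner_eval t) AX.
    apply/matrixP => i j; rewrite !mxE /evx /= /horner_eval -horner_map -map_poly_comp.
    by congr (_.[_]); apply: map_poly_id => a _; rewrite /= phic.
  rewrite -phiH -phiA -map_star; apply/matrixP => i j; rewrite mxE phi0 ?mxE //.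
  have /matrixP/(_ i j) : map_mx psi (star q (map_mx c H) GA (map_mx evx AX)) = 0.
    have psiH : map_mx psi (map_mx c H) = map_mx const H.
      by apply/matrixP => a b; rewrite !mxE psic.
    have psiA : map_mx psi (map_mx evx AX) = map_mx (@series_poly k) AX.
      apply/matrixP => a b; rewrite !mxE /evx /= /horner_eval -horner_map -map_poly_comp psix0.
      have -> : map_poly (psi \o c) (AX a b) = map_poly const (AX a b).
        by apply: eq_map_poly => s /=; rewrite psic.
      rewrite map_poly_comp horner_map /=; congr (series_poly _).
      by rewrite -[RHS]comp_polyXr.
    by rewrite map_star psiG psiH psiA; exact: GE.
  by rewrite !mxE.
have gU := star_unit gE; exists t, g; split=> //.
- by apply: contraNneq phih => t0; rewrite /h rmorphM -/t t0 mul0r.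
- apply: contraNneq phih => fg; rewrite /h rmorphM rmorph_mmap /=.
  rewrite (_ : mpoly.mmap _ _ f = 0) ?mulr0 // -[RHS]fg; apply: eq_mmap => [a|i] /=; first exact: phic.
  by rewrite -map_mxvec mxE vec_mxK mxE.
- exact/starP.
Qed.

End Deformation.

Section Density.
Variables (k : closedFieldType) (p e d : nat).
Hypotheses (p_char : p \in [pchar k]) (e_gt0 : (0 < e)%N).
Let q := (p ^ e)%N.
Variables (F : {rmorphism k -> k}) (H : 'M[k]_d).
Hypotheses (FE : forall x, F x = x ^+ q) (HU : H \in unitmx) (FH : map_mx F H = H^T).

Let low (R : comNzRingType) (j : nat) : 'M[R]_d :=
  \matrix_(i, l) ((i == j :> nat) && (l.+1 == j))%:R.

Let low_sqr (R : comNzRingType) j : low R j *m low R j = 0.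
Proof.
apply/matrixP => i l; rewrite !mxE big1 // => m _; rewrite !mxE.
have [mj|mj] := eqVneq (m.+1) j; last by rewrite andbF mul0r.
have -> : (m == j :> nat) = false by apply/negbTE; rewrite -mj neq_ltn ltnSn.
by rewrite mulr0.
Qed.

(* Replacing a factor s_j of a cell by a transvection 1 + t E_(j, j-1), which
   lies in the cell of s_j if and only if t <> 0. *)
Lemma bruhat_cell_curve (S : seq nat) (tau : pred nat) (A0 : 'M[k]_d) :
  path ltn 0%N S -> all (gtn d) S -> bruhat_cell (word d [seq j <- S | tau j]) A0 ->
  exists AX : 'M[{poly k}]_d, [/\ AX \in unitmx, map_mx (horner_eval 0) AX = A0 &
    forall t, t != 0 -> bruhat_cell (word d S) (map_mx (horner_eval t) AX)].
Proof.
move=> S0 Sd [b [b' [Bb Bb' ->]]].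
pose Y j : 'M[{poly k}]_d :=
  if tau j then perm_mx (simple_refl d j) else 1%:M + 'X *: low {poly k} j.
pose Yt t j : 'M[k]_d := if tau j then perm_mx (simple_refl d j) else 1%:M + t *: low k j.
have transvection_unit (R : comUnitRingType) (t : R) j : 1%:M + t *: low R j \in unitmx.
  suff /mulmx1_unit[] : (1%:M + t *: low R j) *m (1%:M - t *: low R j) = 1%:M by [].
  rewrite mulmxBr mulmx1 mulmxDl mul1mx -scalemxAl -scalemxAr low_sqr !scaler0.
  by rewrite addr0 addrK.
have YU j : Y j \in unitmx by rewrite /Y; case: ifP => _; [exact: unitmx_perm|exact: transvection_unit].
have YtU t j : Yt t j \in unitmx by rewrite /Yt; case: ifP => _; [exact: unitmx_perm|exact: transvection_unit].
have evY t j : map_mx (horner_eval t) (Y j) = Yt t j.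
  rewrite /Y /Yt; case: ifP => _; first exact: map_perm_mx.
  rewrite map_mxD map_mx1; congr (_ + _); apply/matrixP => i l.
  rewrite [LHS]mxE -[LHS]/((('X *: low {poly k} j) i l).[t]) !mxE.
  by case: (_ && _); rewrite ?mulr1 ?mulr0 ?hornerX ?horner0.
have prodU (R : comUnitRingType) (f : nat -> 'M[R]_d) (r : seq nat) :
    (forall j, f j \in unitmx) -> \big[mulmx/1%:M]_(j <- r) f j \in unitmx.
  move=> fU; elim/big_ind: _ => [|x y xU yU|i _]; by rewrite ?unitmx1 ?unitmx_mul ?xU ?fU.
pose c : {rmorphism k -> {poly k}} := polyC.
pose AX := map_mx c b *m (\big[mulmx/1%:M]_(j <- S) Y j) *m map_mx c b'.
have [[bU _] [b'U _]] := (borelP _ Bb, borelP _ Bb').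
have evAX t : map_mx (horner_eval t) AX = b *m (\big[mulmx/1%:M]_(j <- S) Yt t j) *m b'.
  have evc (M : 'M[k]_d) : map_mx (horner_eval t) (map_mx c M) = M.
    by apply/matrixP => i l; rewrite !mxE /= /horner_eval hornerC.
  rewrite /AX !map_mxM !evc; congr (_ *m _ *m _).
  elim: S {S0 Sd AX} => [|j S IH]; first by rewrite !big_nil map_mx1.
  by rewrite !big_cons map_mxM IH evY.
exists AX; split.
- have cU (M : 'M[k]_d) : M \in unitmx -> map_mx c M \in unitmx.
    by rewrite !unitmxE det_map_mx; apply: rmorph_unit.
  by rewrite /AX !unitmx_mul !cU // prodU.
- rewrite evAX perm_mx_word; congr (_ *m _ *m _).
  elim: (S) => [|j r IH]; first by rewrite !big_nil.
  rewrite big_cons /= {1}/Yt; case: ifP => _; first by rewrite big_cons IH.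
  by rewrite scale0r addr0 mul1mx IH.
move=> t t0; apply/bruhatP => //; rewrite evAX; apply: hessenberg_borel => //.
have Sp j : j \in S -> (0 < j < d)%N.
  move=> jS; have /allP/(_ j jS) -> := order_path_min ltn_trans S0.
  by have /allP/(_ j jS) := Sd.
have := @hessenberg_prod _ d (Yt t) S 0 S0 _ (YtU t).
rewrite (_ : [seq j <- S | _] = S); first apply.
  move=> j /Sp /andP[j0 jd]; split=> //; rewrite /Yt; case: ifP => _.
    exact: (@elementary_simple_refl k d (Ordinal jd)).
  split=> [i l li nil|i ij ij']; rewrite !mxE.
    have -> : (i == l) = false by apply/negbTE; apply: contraTneq li => ->; rewrite ltnn.
    case: eqP => [ij|_]; last by rewrite mulr0 addr0.
    by case: eqP => [lj|_]; [case: nil|rewrite mulr0 addr0].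
  by rewrite eqxx (negPf ij) mulr0 addr0 oner_eq0.
apply/all_filterP/allP => j /Sp /andP[j0 jd].
have ad : (j.-1 < d)%N by rewrite (leq_ltn_trans (leq_pred _)).
apply/existsP; exists (Ordinal jd); apply/existsP; exists (Ordinal ad).
rewrite /= prednK // !eqxx /= /Yt; case: ifP => _.
  rewrite -[X in simple_refl _ X]/(nat_of_ord (Ordinal jd)).
  rewrite (@simple_reflE d (Ordinal ad)) /= ?prednK //.
  by rewrite !mxE tpermR eqxx oner_eq0.
have ja : (Ordinal jd == Ordinal ad) = false.
  by apply/negbTE; rewrite -(inj_eq val_inj) /=; move: j0; clear; lia.
by rewrite !mxE ja /= prednK // !eqxx mulr1 add0r.
Qed.

Theorem bruhat_cell_dense (S : seq nat) (tau : pred nat) (g0 : 'M[k]_d)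
    (f : mpoly.mpoly (d * d) k) :
  path ltn 0%N S -> all (gtn d) S -> g0 \in unitmx ->
  bruhat_cell (word d [seq j <- S | tau j]) (invmx g0 *m Phi q H g0) ->
  mpoly.meval (fun i => mxvec g0 0 i) f != 0 ->
  exists g, [/\ g \in unitmx, bruhat_cell (word d S) (invmx g *m Phi q H g) &
    mpoly.meval (fun i => mxvec g 0 i) f != 0].
Proof.
move=> S0 Sd g0U /(bruhat_cell_curve S0 Sd)[AX [AXU A0 AXt]] fg0.
have [t [g [t0 gU fg gE]]] := deformation p_char e_gt0 FE HU FH AXU g0U A0 fg0.
by exists g; split=> //; rewrite -gE; apply: AXt.
Qed.

End Density.

(** * Closure of the stratum *)

Section Strata.
Variables (k : closedFieldType) (p e d : nat).
Hypotheses (p_char : p \in [pchar k]) (e_gt0 : (0 < e)%N).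
Let q := (p ^ e)%N.
Variables (F : {rmorphism k -> k}) (H : 'M[k]_d).
Hypotheses (FE : forall x, F x = x ^+ q) (HU : H \in unitmx) (FH : map_mx F H = H^T)
  (H_anti : forall i j : 'I_d, ((i + j).+1 < d)%N -> H i j = 0).
Variables (C : pred nat) (J : seq nat) (l : nat).
Hypotheses (C_range : forall x, C x -> (0 < x < d)%N)
  (C_sym : forall x, C x -> x = 1%N \/ C (d.+1 - x)%N)
  (C_J : forall x, (0 < x < d)%N -> (x \notin J) = C x)
  (l_gt0 : (0 < l)%N) (C_ge : forall x, C x -> (l <= x)%N).
Implicit Types (g : 'M[k]_d) (T : seq nat).

Let q_gt1 : (1 < q)%N.
Proof.
have p1 : (1 < p)%N by apply/prime_gt1/(pcharf_prime p_char).
by apply: leq_ltn_trans e_gt0 (ltn_expl e p1).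
Qed.

Local Notation Ph := (Phi q H).
Local Notation perpH := (perp (sesqui F H)).
Let lang g := invmx g *m Ph g.

(* The words w_1 ... w_r of the statement, see good_blocksP. *)
Definition good T : Prop :=
  [/\ path ltn 0%N T, all (gtn d) T & forall j, j \in T -> C j || (j.-1 \in T)].

Lemma adapted_flagE g : g \in unitmx -> adapted_flag (sesqui F H) C (flag g) <->
  (forall j, (j < d)%N -> (perpH (flag g (d - j)%N) <= flag g j.+1)%VS) /\
  (forall j, (j < d)%N -> flag g j != perpH (flag g (d - j)%N) ->
     (0 < j)%N && (C j || (flag g j.-1 != perpH (flag g (d - j.-1)%N)))).
Proof.
move=> gU; have dE := dim_cV k d; split=> [ad|[P1 P2]].
  have := adapted_perp ad; have := adapted_initial ad; rewrite dE => P2 P1.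
  by split; [exact: P1|exact: P2].
split; rewrite dE; [by move=> x; apply: dim_flag| |exact: P1|exact: P2].
by move=> x y /andP[xy _]; apply: flag_mono.
Qed.

Lemma good_adapted T g : good T -> g \in unitmx -> bruhat_cell (word d T) (lang g) ->
  adapted_flag (sesqui F H) C (flag g) /\
  forall j, (j < d)%N -> (flag g j != perpH (flag g (d - j)%N)) = (j \in T).
Proof.
move=> [T0 Td TC] gU /(bruhatP _ T0 Td).
case/(hessenberg_flag q_gt1 FE HU H_anti T0 Td gU) => P1 PT; split; last exact: PT.
apply/(adapted_flagE gU); split; first exact: P1.
move=> j jd neq; have jT : j \in T by have := PT j jd; rewrite neq => <-.
have j0 : (0 < j)%N by have /allP/(_ j jT) := order_path_min ltn_trans T0.
have jd' : (j.-1 < d)%N by apply: leq_ltn_trans (leq_pred j) jd.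
by rewrite j0 (PT j.-1 jd') TC.
Qed.

Lemma adapted_good g : g \in unitmx -> adapted_flag (sesqui F H) C (flag g) ->
  exists2 T, good T & bruhat_cell (word d T) (lang g).
Proof.
move=> gU ad; pose P j := flag g j != perpH (flag g (d - j)%N).
have [adP adI] := (adapted_flagE gU).1 ad.
have T0 : path ltn 0%N [seq j <- iota 1 d.-1 | P j].
  apply: path_filter => //; first exact: ltn_trans.
  by rewrite -[path _ _ _]/(sorted ltn (iota 0 d.-1.+1)) iota_ltn_sorted.
have TE j : (j < d)%N -> (j \in [seq j <- iota 1 d.-1 | P j]) = P j.
  move=> jd; rewrite mem_filter mem_iota add1n.
  have [j0|] := posnP j; last by rewrite prednK ?jd ?andbT // (leq_ltn_trans _ jd).
  rewrite andbF; apply/esym/negbTE/negP => /(adI _ jd).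
  by rewrite j0.
have Td : all (gtn d) [seq j <- iota 1 d.-1 | P j].
  apply/allP => j; rewrite mem_filter mem_iota => /and3P[_ j0 jd] /=.
  by move: jd j0; clear; lia.
exists [seq j <- iota 1 d.-1 | P j].
  split; [exact: T0|exact: Td|move=> j jT].
  have jd : (j < d)%N by have /allP/(_ j jT) := Td.
  have jd' : (j.-1 < d)%N by apply: leq_ltn_trans (leq_pred j) jd.
  rewrite (TE j.-1 jd'); rewrite (TE j jd) in jT.
  by have /andP[_] := adI _ jd jT.
apply/(bruhatP _ T0 Td)/(hessenberg_flag q_gt1 FE HU H_anti T0 Td gU).
by split; [exact: adP|move=> j jd; rewrite (TE j jd)].
Qed.

(** The closed condition [perp F_(d+1-x) <= F_x], in terms of the entries of [g^-1 Phi(g)]; the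
    orthogonal has dimension [x - 1], whence the bound [j.+1 < x]. *)
Definition incident g : Prop :=
  forall x (i j : 'I_d), C x -> (j.+1 < x)%N -> (x <= i)%N -> lang g i j = 0.

Lemma incidentP g : g \in unitmx ->
  incident g <-> forall x, C x -> (perpH (flag g (d.+1 - x)%N) <= flag g x)%VS.
Proof.
move=> gU; have PU := Phi_unit FE HU gU.
have E x : C x -> perpH (flag g (d.+1 - x)%N) = flag (Ph g) x.-1.
  move=> /C_range/andP[x0 xd]; rewrite -(perp_flag q_gt1 FE HU H_anti gU).
    by congr (perpH (flag g _)); move: x0 xd; clear; lia.
  by move: xd; clear; lia.
split=> [gi x Cx|gi x i j Cx jx xi].
  rewrite E //; apply/flag_sub => // i j jx xi; apply: (gi x) => //.
  by move: jx; clear; lia.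
by have := gi x Cx; rewrite E // => /flag_sub; apply=> //; move: jx; clear; lia.
Qed.

Lemma incident_exists g0 : g0 \in unitmx -> incident g0 ->
  exists g T, [/\ g \in unitmx, forall x, C x -> flag g x = flag g0 x, good T &
    bruhat_cell (word d T) (lang g)].
Proof.
move=> g0U /(incidentP g0U) gi.
have [|||||||E adE EF] := @adapted_flag_exists _ _ _ q_gt1 FE _ _ (sesquiDl F H)
    (sesquiZl F H) (sesquiDr F H) (sesquiZr F H) (sesqui_nondeg HU) C (flag g0).
- by rewrite dim_cV.
- by rewrite dim_cV.
- by apply/eqP; rewrite -dimv_eq0 dim_flag.
- by apply/eqP; rewrite eqEdim subvf dim_cV dim_flag // leqnn.
- by move=> x /C_range/andP[_ /ltnW xd]; rewrite dim_flag.
- by move=> x y _ _; apply: flag_mono.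
- by rewrite dim_cV; exact: gi.
have E_dim := adapted_dim adE; have E_mono := adapted_mono adE.
rewrite dim_cV in E_dim E_mono.
have [g gU gE] := exists_flag_basis E_dim E_mono.
have gad : adapted_flag (sesqui F H) C (flag g).
  have adP := adapted_perp adE; have adI := adapted_initial adE.
  rewrite dim_cV in adP adI.
  apply/(adapted_flagE gU); split=> j jd.
    by rewrite (gE j.+1 jd) (gE _ (leq_subr _ _)); apply: adP.
  have jd' : (j.-1 <= d)%N := leq_trans (leq_pred j) (ltnW jd).
  rewrite (gE j (ltnW jd)) (gE _ (leq_subr j _)) (gE _ jd') (gE _ (leq_subr j.-1 _)).
  exact: adI.
have [T gT gb] := adapted_good gU gad.
exists g, T; split=> // x Cx; have /andP[_ /ltnW xd] := C_range Cx.
by rewrite gE // EF.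
Qed.

Lemma good_incident T g : good T -> g \in unitmx -> bruhat_cell (word d T) (lang g) ->
  incident g.
Proof.
move=> gT gU /(good_adapted gT gU)[ad _]; apply/(incidentP gU) => x Cx.
have [adP _] := (adapted_flagE gU).1 ad.
have /andP[x0 xd] := C_range Cx; have xd' : (x.-1 < d)%N by move: xd; clear; lia.
have E : (d - x.-1 = d.+1 - x)%N by move: x0 xd; clear; lia.
by have := adP x.-1 xd'; rewrite (prednK x0) E.
Qed.

(** The condition for [x] involves the terms of dimensions [x] and [d + 1 - x], both in [C] except
    for [x = 1], where the second one is the whole space. *)
Lemma incident_same g g' : g \in unitmx -> g' \in unitmx ->
  (forall x, C x -> flag g x = flag g' x) -> incident g -> incident g'.
Proof.
move=> gU g'U gg' /(incidentP gU) gi; apply/(incidentP g'U) => x Cx.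
suff E : flag g' (d.+1 - x) = flag g (d.+1 - x) by rewrite -(gg' x Cx) E; apply: gi.
have [x1|Cx'] := C_sym Cx; last by rewrite (gg' _ Cx').
have full (h : 'M[k]_d) : flag h d = fullv.
  apply/eqP; rewrite eqEsubv subvf /=; apply/subvP => w _; apply/flagP => i.
  by rewrite leqNgt ltn_ord.
by rewrite x1 subn1 !full.
Qed.

Lemma good_unique T T' g g' : good T -> good T' -> g \in unitmx -> g' \in unitmx ->
  (forall x, C x -> flag g x = flag g' x) ->
  bruhat_cell (word d T) (lang g) -> bruhat_cell (word d T') (lang g') -> T = T'.
Proof.
move=> gT gT' gU g'U gg' /(good_adapted gT gU)[ad TE] /(good_adapted gT' g'U)[ad' TE'].
have [[T0 Td _] [T0' Td' _]] := (gT, gT').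
apply: (irr_sorted_eq ltn_trans ltnn (path_sorted T0) (path_sorted T0')) => j.
have [jd|dj] := ltnP j d; last first.
  have out T1 : all (gtn d) T1 -> (j \in T1) = false.
    by move/allP => T1d; apply/negP => /T1d /=; rewrite ltnNge dj.
  by rewrite (out _ Td) (out _ Td').
have := adapted_flag_unique q_gt1 (sesquiDl F H) (sesquiZl F H) (sesquiDr F H)
  (sesquiZr F H) (sesqui_nondeg HU) ad ad' gg'.
by rewrite dim_cV => /(_ j jd); rewrite (TE j jd) (TE' j jd).
Qed.

(** Going down from a letter of a good word leads to an element of [C] and never below [l]. Every
    good word is thus a subword of the longest one, as density requires. *)
Lemma good_sub T : good T -> T = [seq j <- iota l (d - l) | j \in T].
Proof.
move=> [T0 Td TC].
have Tl j : j \in T -> (l <= j)%N.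
  elim: j => [|j IH] jT.
    by have /allP/(_ _ jT) := order_path_min ltn_trans T0.
  by case/orP: (TC _ jT) => [/C_ge|/IH/leqW].
apply: (irr_sorted_eq ltn_trans ltnn (path_sorted T0)).
  by apply: sorted_filter; [exact: ltn_trans|exact: iota_ltn_sorted].
move=> j; rewrite mem_filter mem_iota; have [jT|//] := boolP (j \in T).
have /allP/(_ j jT) /= jd := Td; have := Tl j jT; move: jd; clear; lia.
Qed.

(** Replacing inverses by adjugates multiplies [g^-1 Phi(g)] by the nonzero scalar
    [det g * (det g)^q]. *)
Lemma lang_polynomial (i j : 'I_d) : exists P : mpoly.mpoly (d * d) k,
  forall g, g \in unitmx -> (lang g i j == 0) = (mpoly.meval (fun i => mxvec g 0 i) P == 0).
Proof.
pose X : 'M[mpoly.mpoly (d * d) k]_d :=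
  \matrix_(a, b) mpoly.mpolyX k (mpoly.mnm1 (mxvec_index a b)).
pose c : k -> mpoly.mpoly (d * d) k := @mpoly.mpolyC (d * d) k.
pose Y := \adj X *m map_mx c (invmx H^T) *m (map_mx (fun x => x ^+ q) (\adj X))^T *m map_mx c H^T.
exists (Y i j) => g gU; pose ev := mpoly.meval (fun i => mxvec g 0 i) : mpoly.mpoly (d * d) k -> k.
have evX : map_mx ev X = g.
  by apply/matrixP => a b; rewrite !mxE [LHS]mpoly.mevalXU mxvecE.
have evc (A : 'M[k]_d) : map_mx ev (map_mx c A) = A.
  by apply/matrixP => a b; rewrite !mxE [LHS]mpoly.mevalC.
have evF (A : 'M[mpoly.mpoly (d * d) k]_d) :
    map_mx ev (map_mx (fun x => x ^+ q) A)^T = (map_mx F (map_mx ev A))^T.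
  by apply/matrixP => a b; rewrite !mxE FE; exact: rmorphXn.
have -> : mpoly.meval (fun i => mxvec g 0 i) (Y i j) = map_mx ev Y i j by rewrite [RHS]mxE.
have evY : map_mx ev Y = \adj g *m invmx H^T *m (map_mx F (\adj g))^T *m H^T.
  by rewrite /Y !map_mxM !evc evF map_mx_adj evX.
have gE : lang g = ((\det g)^-1 * (F (\det g))^-1) *: map_mx ev Y.
  rewrite evY /lang (PhiE H FE) /invmx gU map_mxZ linearZ /= -!scalemxAl -!scalemxAr.
  by rewrite -scalemxAl -!scalemxAr scalerA fmorphV !mulmxA.
have g0 : \det g != 0 by move: gU; rewrite unitmxE unitfE.
by rewrite gE mxE mulf_eq0 mulf_eq0 !invr_eq0 fmorph_eq0 (negbTE g0).
Qed.

Local Open Scope quotient_scope.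
Notation flags := (flag_variety k d J).
Let stratum T : set flags := fine_DL q H J (word d T).

Let mkGL g (gU : g \in unitmx) : GL k d := exist (fun g => g \in unitmx) g gU.

Lemma pi_flagP (g g' : GL k d) :
  \pi_flags g = \pi_flags g' <-> forall x, C x -> flag (val g) x = flag (val g') x.
Proof.
have -> : (\pi_flags g = \pi_flags g') <-> same_flag J g g'.
  by split=> [/eqmodP|gg']; [|apply/eqmodP].
split=> [/same_flagP gg' x Cx|gg'].
  by have xd := C_range Cx; apply: gg'; rewrite ?C_J.
by apply/same_flagP => x xd; rewrite C_J //; exact: gg'.
Qed.

(** Replacing [g] by [g x] does not change its flag of type [J] and absorbs the factor [x] of the
    [Phi]-conjugation. *)
Lemma fine_DLP (w : 'S_d) (y : flags) : fine_DL q H J w y <->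
  exists2 g : GL k d, y = \pi_flags g & bruhat_cell w (lang (val g)).
Proof.
split=> [[g [x [b [b' [Jx Bb Bb' gE]]]] <-]|[g -> [b [b' [Bb Bb' gE]]]]]; last first.
  exists g => //; exists 1%:M, b, b'; split=> //; first exact: parabolic1.
  by rewrite (Phi1 FE HU) invmx1 mul1mx mulmx1.
have xU : x \in unitmx by have /parabolicP[] := Jx.
have gxU : val g *m x \in unitmx by rewrite unitmx_mul (valP g).
exists (mkGL gxU).
  by apply/eqmodP; rewrite /= /same_flag /= mulKmx // (valP g).
exists b, b'; split=> //; rewrite -[val (mkGL _)]/(val g *m x).
have PU := Phi_unit FE HU xU; set A := b *m _ *m b' in gE *.
have PE : Ph (val g) = val g *m x *m A *m invmx (Ph x).
  by rewrite -[LHS](mulKVmx (valP g)) gE !mulmxA.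
by rewrite /lang (PhiM FE HU (valP g) xU) PE (mulmxKV PU) (mulKmx gxU).
Qed.

Lemma incident_closed : closed [set \pi_flags g | g in [set g : GL k d | incident (val g)]].
Proof.
set Z := [set _ | _ in _].
have ZE (g : GL k d) : Z (\pi_flags g) <-> incident (val g).
  split=> [[g' g'i /pi_flagP g'g]|gi]; last by exists g.
  exact: (incident_same (valP g') (valP g) g'g g'i).
rewrite -[Z]setCK; apply: open_closedC.
pose R := [set P : mpoly.mpoly (d * d) k | exists x (i j : 'I_d),
  [/\ C x, (j.+1 < x)%N, (x <= i)%N & forall g, g \in unitmx ->
    (lang g i j == 0) = (mpoly.meval (fun i => mxvec g 0 i) P == 0)]].
exists R; apply/seteqP; split=> g /=.
  move=> /ZE gi; apply: contrapT => R0; apply: gi => x i j Cx jx xi.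
  have [P PE] := lang_polynomial i j; apply/eqP; rewrite PE ?(valP g) //.
  apply: contrapT => Pg; apply: R0; exists P; first by exists x, i, j.
  by move=> P0; apply: Pg; apply/eqP.
move=> [P [x [i [j [Cx jx xi PE]]]] /eqP Pg] /ZE /(_ x i j Cx jx xi)/eqP.
by rewrite PE ?(valP g) // (negbTE Pg).
Qed.

Theorem closure_stratum : ((l < d)%N -> C l) ->
  closure (stratum (iota l (d - l))) = [set y | exists2 T, good T & stratum T y].
Proof.
move=> Cl; have [S0 Sd] : path ltn 0%N (iota l (d - l)) /\ all (gtn d) (iota l (d - l)).
  split; last by apply/allP => j; rewrite mem_iota /=; clear; lia.
  case: (d - l)%N => [//|n] /=; rewrite l_gt0.
  exact: (iota_ltn_sorted l n.+1).
have gS : good (iota l (d - l)).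
  split=> // j; rewrite !mem_iota; have [-> /andP[_ ld]|jl] := eqVneq j l.
    by rewrite Cl //; move: ld; clear; lia.
  by move=> jS; apply/orP; right; move: jl jS; clear; lia.
apply/seteqP; split=> [y|y [T gT] /fine_DLP[g -> gb]].
  rewrite closureE => /(_ _ (conj incident_closed _)).
  case=> [x /fine_DLP[g -> gb]|g gi <-]; first by exists g => //; exact: (good_incident gS (valP g) gb).
  have [g' [T [g'U gg' gT gb]]] := incident_exists (valP g) gi.
  exists T => //; apply/fine_DLP; exists (mkGL g'U) => //.
  by apply/pi_flagP => x Cx; rewrite gg'.
move=> B; rewrite nbhsE => -[U [oU Ug] UB].
have [R RE] : zariski_open (\pi_flags @^-1` U) := oU.
have : (\pi_flags @^-1` U) g by exact: Ug.
rewrite RE => -[f Rf /eqP fg]; rewrite (good_sub gT) in gb.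
have [g' [g'U g'b fg']] := bruhat_cell_dense p_char e_gt0 FE HU FH S0 Sd (valP g) gb fg.
exists (\pi_flags (mkGL g'U)); split; first by apply/fine_DLP; exists (mkGL g'U).
apply: UB; have : (\pi_flags @^-1` U) (mkGL g'U) by rewrite RE; exists f => //; apply/eqP.
exact.
Qed.

Lemma stratum_inj T T' y : good T -> good T' -> stratum T y -> stratum T' y -> T = T'.
Proof.
move=> gT gT' /fine_DLP[g -> gb] /fine_DLP[g' /pi_flagP gg' g'b].
exact: good_unique gT gT' (valP g) (valP g') gg' gb g'b.
Qed.

End Strata.

(** * Residue characteristic and Gram matrix *)

Lemma integral_closure_alg (K : fieldType) (A : set K) (L : fieldExtType K) x :
  A 0 -> A 1 -> A (- x) -> integral_closure A L x%:A.
Proof.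
move=> A0 A1 Ax; exists ('X - x%:P); split; first exact: monicXsubC.
  move=> [|[|i]]; rewrite coefB coefX coefC /=.
  - by rewrite sub0r.
  - by rewrite subr0.
  - by rewrite subr0.
by rewrite rmorphB /= map_polyX map_polyC /= root_XsubC.
Qed.

Lemma residue_nat (L : fieldType) (O : set L) pi (kappa : fieldType) (red : L -> kappa) :
  residue_map O pi red -> (forall n, O n%:R) -> forall n, red n%:R = n%:R.
Proof.
move=> rP On; elim=> [|n IH].
  have := residueD rP (On 0%N) (On 0%N); rewrite addr0 => E.
  by apply: (addrI (red 0)); rewrite -E addr0.
by rewrite !mulrS (residueD rP (On 1%N) (On n)) (residue1 rP) IH.
Qed.

Section PadicResidue.
Variables (p : nat) (p_prime : prime p) (K : fieldType) (v : K -> int).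
Hypothesis KP : is_padic_numbers p v.

Lemma padic_p_neq0 : p%:R != 0 :> K.
Proof.
have := padic_char0 KP p; rewrite inE /= p_prime /=.
by move=> /negbT.
Qed.

Let Z := padic_integers v.

Let v1 : v 1 = 0.
Proof.
apply: (addrI (v 1)); have := padic_valM KP (oner_neq0 K) (oner_neq0 K).
by rewrite mulr1 addr0 => <-.
Qed.

Lemma padic_integers1 : Z 1.
Proof. by right; rewrite v1. Qed.

Lemma padic_integersM x y : Z x -> Z y -> Z (x * y).
Proof.
case: (eqVneq x 0) => [->|x0]; first by rewrite mul0r; left.
case: (eqVneq y 0) => [->|y0]; first by rewrite mulr0; left.
case=> [/eqP|vx]; first by rewrite (negbTE x0).
case=> [/eqP|vy]; first by rewrite (negbTE y0).
by right; rewrite (padic_valM KP) // addr_ge0.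
Qed.

Lemma padic_integersN x : Z x -> Z (- x).
Proof.
move=> Zx; rewrite -mulN1r; apply: padic_integersM Zx; right.
have n1 : (-1 : K) != 0 by rewrite oppr_eq0 oner_neq0.
have /esym/eqP := padic_valM KP n1 n1.
by rewrite mulrNN mulr1 v1 -mulr2n mulrn_eq0 /= => /eqP ->.
Qed.

Lemma padic_integersD x y : Z x -> Z y -> Z (x + y).
Proof.
case: (eqVneq x 0) => [->|x0]; first by rewrite add0r.
case: (eqVneq y 0) => [->|y0]; first by rewrite addr0.
case: (eqVneq (x + y) 0) => [->|xy0]; first by left.
case=> [/eqP|vx]; first by rewrite (negbTE x0).
case=> [/eqP|vy]; first by rewrite (negbTE y0).
by right; apply: le_trans (padic_valD KP x0 y0 xy0); rewrite le_min vx.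
Qed.

Lemma padic_integers_nat n : Z n%:R.
Proof.
elim: n => [|n IH]; first by left.
by rewrite mulrS; apply: padic_integersD padic_integers1 IH.
Qed.

Lemma padic_val_inv_p : ~ Z p%:R^-1.
Proof.
have p0 := padic_p_neq0; case=> [/eqP|vp]; first by rewrite invr_eq0 (negbTE p0).
have ip0 : p%:R^-1 != 0 :> K by rewrite invr_eq0.
have := padic_valM KP p0 ip0; rewrite divff // (padic_valp KP) v1 => /esym/eqP; rewrite eq_sym addrC -subr_eq sub0r => /eqP E.
by move: vp; rewrite -E.
Qed.

(** Multiplying an integral equation of degree [n + 1] for [1/p] by [p^n] writes [1/p] as a [p]-adic
    integer. *)
Lemma inv_p_not_integral (L : fieldExtType K) : ~ integral_closure Z L p%:R^-1.
Proof.
case=> P [Pm PZ]; have -> : p%:R^-1 = in_alg L p%:R^-1 by rewrite fmorphV rmorph_nat.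
rewrite fmorph_root => /rootP.
have p0 := padic_p_neq0.
have [n nE] : exists n, size P = n.+1.
  by case: (size P) (monic_neq0 Pm) (size_poly_eq0 P) => [|n] P0; [rewrite (negbTE P0)|exists n].
rewrite horner_coef nE; case: n nE => [|n] nE.
  rewrite big_ord1 expr0 mulr1 => /eqP.
  by have /monicP := Pm; rewrite /lead_coef nE => ->; rewrite (negbTE (oner_neq0 _)).
rewrite big_ord_recr /=; have /monicP := Pm; rewrite /lead_coef nE => -> /eqP.
rewrite mul1r addr_eq0 => /eqP S.
apply: padic_val_inv_p.
have -> : p%:R^-1 = - \sum_(i < n.+1) P`_i * p%:R ^+ (n - i).
  apply: (mulIf (expf_neq0 n (invr_neq0 p0))); rewrite -exprS mulNr mulr_suml -[LHS]opprK -S.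
  congr (- _); apply: eq_bigr => i _; rewrite -mulrA; congr (_ * _).
  have -> : p%:R^-1 ^+ n = p%:R^-1 ^+ (n - i) * p%:R^-1 ^+ i :> K.
    by rewrite -exprD subnK // -ltnS.
  by rewrite mulrA -exprMn mulfV // expr1n mul1r.
apply: padic_integersN; elim/big_ind: _ => [|x y|i _]; first by left.
  exact: padic_integersD.
by apply: padic_integersM (PZ i) _; rewrite -natrX; apply: padic_integers_nat.
Qed.

Variables (F : fieldExtType K) (E : fieldExtType F) (pi : F).
Let OF := integral_closure Z F.
Let OE := integral_closure OF E.
Hypothesis pi_unif : uniformizer OF pi.
Variables (kF kE : fieldType) (redF : F -> kF) (redE : E -> kE).
Hypotheses (redFP : residue_map OF pi redF) (redEP : residue_map OE pi%:A redE).

Let OF_int x : Z x -> OF x%:A.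
Proof.
move=> Zx; apply: integral_closure_alg; [by left|exact: padic_integers1|].
exact: padic_integersN.
Qed.

Let OF_nat n : OF n%:R.
Proof. by rewrite -(rmorph_nat (in_alg F)); apply/OF_int/padic_integers_nat. Qed.

Let OFN_nat n : OF (- n%:R).
Proof.
rewrite -(rmorph_nat (in_alg F)) -rmorphN.
exact/OF_int/padic_integersN/padic_integers_nat.
Qed.

Lemma residue_char : p \in [pchar kF].
Proof.
rewrite inE /= p_prime -(residue_nat redFP OF_nat); apply/eqP/(residue_ker redFP) => //.
have [_ /(_ _ (OF_nat p)) [_ U]] := pi_unif.
apply: contrapT => /U [_]; exact: inv_p_not_integral.
Qed.

Let OE_int x : OF (- x) -> OE x%:A.
Proof. exact: integral_closure_alg (OF_nat 0) (OF_nat 1). Qed.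

Let OE_nat n : OE n%:R.
Proof. by rewrite -(rmorph_nat (in_alg E)); apply: OE_int. Qed.

Lemma residue_char_ext : p \in [pchar kE].
Proof.
rewrite inE /= p_prime -(residue_nat redEP OE_nat); apply/eqP/(residue_ker redEP) => //.
(* Starting from [- p = pi y] avoids opposites in [OF]: the quotient of [p] by [pi] is [- y], a root
   of [X + y], whose coefficients are in [OF]. *)
have redNp : redF (- p%:R) = 0.
  have := residueD redFP (OF_nat p) (OFN_nat p).
  rewrite subrr -[0]/(0%:R) !(residue_nat redFP OF_nat) (pcharf0 residue_char).
  by rewrite add0r.
have [y Oy yE] := (residue_ker redFP (OFN_nat p)).1 redNp.
exists (- y)%:A; first by apply: OE_int; rewrite opprK.
rewrite -[RHS](rmorphM (in_alg E)) mulrN -yE opprK.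
by rewrite rmorph_nat.
Qed.

End PadicResidue.

Section GramMatrix.
Variables (kappa : fieldType) (theta : {rmorphism kappa -> kappa}) (V : vectType kappa).
Variables (form : {hermitian V for false & theta}) (d : nat) (e : d.-tuple V).
Hypothesis eP : self_dual_flag_basis form e.

Definition gram : 'M[kappa]_d := \matrix_(i, j) form (tnth e i) (tnth e j).

Let tnth_take (i : 'I_d) n : (i < n <= d)%N -> tnth e i \in <<take n e>>%VS.
Proof.
move=> /andP[ni nd]; apply: memv_span; rewrite (tnth_nth 0) -(nth_take _ ni) mem_nth //.
by rewrite size_takel ?size_tuple.
Qed.

Lemma gram_anti (i j : 'I_d) : ((i + j).+1 < d)%N -> gram i j = 0.
Proof.
move=> ijd; rewrite mxE; have jd := ltn_ord j.
have : tnth e i \in orthov form <<take j.+1 e>>.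
  by rewrite eP.2 //; apply: tnth_take; move: ijd; clear; lia.
by move/mem_orthovP; apply; apply: tnth_take; rewrite ltnSn jd.
Qed.

(** A relation between the rows gives a vector orthogonal to the whole basis, hence in the
    orthogonal of the last term of the flag, which is its zeroth term. *)
Lemma gram_unit : gram \in unitmx.
Proof.
have [eb eo] := eP; have efree := basis_free eb.
rewrite -row_free_unit -kermx_eq0; apply/rowV0P => u /sub_kermxP uG.
pose x := \sum_(i < d) u 0 i *: e`_i.
have x0 : x = 0.
  apply/eqP; rewrite -memv0 -span_nil -(take0 (e : seq V)) -[0%N](subnn d) -eo //.
  rewrite take_oversize ?size_tuple // mem_orthov_sym; apply/span_subvP => y.
  move=> /tnthP[j ->]; rewrite mem_orthov1 herm_eq0C.
  have /rowP/(_ j) := uG; rewrite !mxE => uGj.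
  rewrite linear_sumlz -[X in _ == X]uGj; apply/eqP/eq_bigr => i _.
  by rewrite linearZl_LR /= mxE (tnth_nth 0 e i).
have /freeP := efree; move/(_ (fun i => u 0 i)) => u0.
by apply/rowP => i; rewrite mxE u0.
Qed.

End GramMatrix.

(** * Words and flag dimensions *)

Section Blocks.
Variables (d : nat) (K : seq nat).
Hypotheses (K_sorted : sorted ltn K) (K_lt : forall x, x \in K -> (x.+1 < d)%N).
Let n := size K.
Let a i := nth 0%N K i.
Let b i := if (i.+1 < n)%N then a i.+1 else d.-1.
Implicit Types t : nat -> nat.

Definition blocks t : seq nat := flatten [seq iota (nth 0%N K i).+1 (t i) | i <- iota 0 (size K)].

Let a_lt i j : (i < j < n)%N -> (a i < a j)%N.
Proof.
move=> /andP[ij jn]; rewrite (sorted_ltn_nth ltn_trans 0%N K_sorted) ?inE //.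
exact: ltn_trans jn.
Qed.

Let b_le_a i j : (i < j < n)%N -> (b i <= a j)%N.
Proof.
move=> /andP[ij jn]; rewrite /b (leq_ltn_trans ij jn).
move: ij; rewrite leq_eqVlt => /orP[/eqP->|ij] //.
by apply/ltnW/a_lt; rewrite ij.
Qed.

Let a_lt_b i : (i < n)%N -> (a i < b i < d)%N.
Proof.
move=> i_n; rewrite /b; have aid := K_lt (mem_nth 0%N i_n); case: ifP => i1n.
  by rewrite a_lt ?ltnSn //=; have := K_lt (mem_nth 0%N i1n); apply: ltn_trans.
by move: aid; rewrite -/(a i); clear; lia.
Qed.

Lemma mem_blocks t j :
  reflect (exists2 i, (i < n)%N & (a i < j <= a i + t i)%N) (j \in blocks t).
Proof.
apply: (iffP flatten_mapP) => [[i]|[i i_n jP]].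
  by rewrite !mem_iota add0n => i_n jP; exists i => //; move: jP; rewrite addSn ltnS.
by exists i; rewrite mem_iota ?add0n // addSn ltnS.
Qed.

Section Admissible.
Variable t : nat -> nat.
Hypothesis t_adm : forall i, (i < n)%N -> (t i <= b i - a i)%N.

Let t_le i j : (i < n)%N -> (j <= a i + t i)%N -> (j <= b i)%N.
Proof. by move=> i_n; have := t_adm i_n; have := a_lt_b i_n; clear; lia. Qed.

Lemma mem_block i j : (i < n)%N -> (a i < j <= b i)%N ->
  (j \in blocks t) = (j <= a i + t i)%N.
Proof.
move=> i_n /andP[aj jb]; apply/mem_blocks/idP => [[i' i'n /andP[aj' jt']]|jt]; last first.
  by exists i; rewrite // aj.
have jb' := t_le i'n jt'; have [ii'|i'i|->] := ltngtP i i' => //.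
  by have := b_le_a (i := i) (j := i'); rewrite ii' i'n => /(_ isT); move: jb aj'; clear; lia.
by have := b_le_a (i := i') (j := i); rewrite i'i i_n => /(_ isT); move: jb' aj; clear; lia.
Qed.

Lemma blocks_sorted : sorted ltn (blocks t).
Proof.
suff: forall m, (m <= n)%N ->
    sorted ltn (flatten [seq iota (a i).+1 (t i) | i <- iota 0 m]).
  exact.
elim=> [//|m IH] mn; rewrite -addn1 iotaD map_cat flatten_cat /= cats0 add0n.
rewrite !(sorted_pairwise ltn_trans) pairwise_cat -!(sorted_pairwise ltn_trans).
rewrite IH ?(ltnW mn) // iota_ltn_sorted !andbT; apply/allrelP => x y.
move=> /flatten_mapP[i]; rewrite !mem_iota add0n => im /andP[_ xi] /andP[my _].
have i_n := ltn_trans im mn.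
have xb : (x <= b i)%N by apply: (t_le i_n); move: xi; rewrite addSn ltnS.
by apply: leq_ltn_trans xb (leq_ltn_trans _ my); apply: b_le_a; rewrite mn andbT.
Qed.

Lemma good_blocks : good d (fun x => (0 < x)%N && (x.-1 \in K)) (blocks t).
Proof.
have jn j : j \in blocks t -> (0 < j < d)%N.
  move=> /mem_blocks[i i_n /andP[aj /(t_le i_n) jb]].
  by have := a_lt_b i_n; move: aj jb; clear; lia.
split.
- rewrite path_min_sorted; first exact: blocks_sorted.
  by apply/allP => j /jn/andP[].
- by apply/allP => j /jn/andP[].
move=> j jt; have /andP[-> _] := jn j jt; move: jt => /mem_blocks[i i_n /andP[aj jt]].
have [->|ja] := eqVneq j (a i).+1; first by rewrite /= mem_nth.
apply/orP; right; apply/mem_blocks; exists i => //; move: aj jt ja; clear; lia.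
Qed.

End Admissible.

(** A good word meets each interval from [a i + 1] to [b i] in an initial run: after a missing
    letter, the next one would have to be some [k_j + 1], and only the first letter of the interval
    is of that form. *)
Lemma good_blocksP T : good d (fun x => (0 < x)%N && (x.-1 \in K)) T ->
  exists2 t, (forall i, (i < n)%N -> (t i <= b i - a i)%N) & T = blocks t.
Proof.
move=> [T0 Td TK].
(* The length of the initial run; [find] returns the full length [b i - a i] when no letter is
   missing. *)
pose t i := find (fun m => (a i + m).+1 \notin T) (iota 0 (b i - a i)).
have t_adm i : (i < n)%N -> (t i <= b i - a i)%N.
  by move=> _; apply: leq_trans (find_size _ _) _; rewrite size_iota.
have in_t i m : (m < t i)%N -> (a i + m).+1 \in T.
  move=> mt; have := before_find 0%N mt; rewrite nth_iota ?add0n; last first.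
    by apply: leq_trans mt _; apply: leq_trans (find_size _ _) _; rewrite size_iota.
  by move/negbFE.
have out_t i j : (i < n)%N -> (a i + t i < j <= b i)%N -> j \notin T.
  move=> i_n; elim: j => [//|j IH] /andP[tj jb].
  have [E|tj'] := eqVneq j (a i + t i)%N.
    have tb : (t i < b i - a i)%N by move: jb; rewrite E; clear; lia.
    have := nth_find 0%N (a := fun m => (a i + m).+1 \notin T) (s := iota 0 (b i - a i)).
    rewrite has_find size_iota => /(_ tb).
    by rewrite nth_iota // add0n E.
  apply/negP => /TK; rewrite /= (negbTE (IH _)) ?orbF; last by move: tj tj' jb; clear; lia.
  move=> /(nthP 0%N)[i' i'n /= E].
  have [ii'|i'i|ii'] := ltngtP i i'.
  - have := b_le_a (i := i) (j := i'); rewrite ii' i'n => /(_ isT).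
    by rewrite /a E; move: jb; clear; lia.
  - have := a_lt (i := i') (j := i); rewrite i'i i_n => /(_ isT).
    by rewrite /a E -/(a i); move: tj; clear; lia.
  by move: tj tj'; rewrite -E -ii' -/(a i); clear; lia.
exists t => //.
apply: (irr_sorted_eq ltn_trans ltnn (path_sorted T0) (blocks_sorted t_adm)) => j.
apply/idP/mem_blocks => [jT|[i i_n /andP[aj jt]]]; last first.
  have -> : j = (a i + (j - (a i).+1)).+1 by move: aj; clear; lia.
  by apply: in_t; move: aj jt; clear; lia.
have jd : (j < d)%N by have /allP/(_ j jT) := Td.
(* Going down from [j] leads to some [k_i + 1]; going back up, a letter past [b i] starts the next
   interval. *)
have [i i_n ij] : exists2 i, (i < n)%N & (a i < j <= b i)%N.
  move: jd; elim: j jT => [|j IH] jT jd.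
    by have /allP/(_ _ jT) := order_path_min ltn_trans T0.
  have := TK _ jT; rewrite /= => /orP[/(nthP 0%N)[i i_n /= E]|/IH].
    by exists i => //; have := a_lt_b i_n; rewrite /a E; clear; lia.
  move=> /(_ (ltnW jd))[i i_n /andP[aj jb]].
  have [E|jb'] := eqVneq j (b i); last by exists i => //; move: aj jb jb'; clear; lia.
  have [i1n|ni1] := ltnP i.+1 n.
    exists i.+1 => //; have := a_lt_b i1n.
    by move: E; rewrite /b i1n => ->; clear; lia.
  by move: E jd; rewrite /b ltnNge ni1 /=; clear; lia.
exists i => //; move: ij => /andP[aj jb]; rewrite aj /= leqNgt; apply/negP => tj.
by have := out_t i j i_n; rewrite tj jb jT => /(_ isT).
Qed.

Lemma blocks_inj t t' : (forall i, (i < n)%N -> (t i <= b i - a i)%N) ->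
  (forall i, (i < n)%N -> (t' i <= b i - a i)%N) -> blocks t = blocks t' ->
  forall i, (i < n)%N -> t i = t' i.
Proof.
suff le t1 t2 i : (forall i, (i < n)%N -> (t1 i <= b i - a i)%N) ->
    (forall i, (i < n)%N -> (t2 i <= b i - a i)%N) -> blocks t1 = blocks t2 ->
    (i < n)%N -> (t1 i <= t2 i)%N.
  move=> tP t'P E i i_n; apply/eqP; rewrite eqn_leq (le t t') //=.
  exact: (le t' t).
move=> t1P t2P E i_n; have [//|lt] := leqP (t1 i) (t2 i).
have ab : (a i < a i + t1 i <= b i)%N.
  by have := t1P i i_n; have := a_lt_b i_n; move: lt; clear; lia.
have := mem_block t1P i_n ab; rewrite E (mem_block t2P i_n ab) leqnn.
by rewrite leq_add2l leqNgt lt.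
Qed.

Lemma word_blocks t : word d (blocks t) = (\prod_(i < size K) refl_word d (nth 0%N K i).+1 (t i))%g.
Proof.
rewrite /word big_flatten big_map -(big_mkord xpredT (fun i => refl_word d (nth 0%N K i).+1 (t i))).
rewrite /index_iota subn0; apply: eq_bigr => i _.
by rewrite /refl_word /index_iota addnC addnK.
Qed.

Lemma word_tuplesP (w : (size K).-tuple 'S_d) : word_tuples d K d.-1 w <->
  exists2 t, (forall i, (i < n)%N -> (t i <= b i - a i)%N) &
    forall i : 'I_(size K), tnth w i = refl_word d (nth 0%N K i).+1 (t i).
Proof.
split=> [/fin_all_exists2[t t_adm wE]|[t t_adm wE] i]; last first.
  by exists (t i); rewrite ?wE //; apply: t_adm.
exists (fun i => oapp t 0%N (insub i)) => [i i_n|i]; last by rewrite valK wE.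
by rewrite (insubT (fun i => i < n)%N i_n) /=; apply: (t_adm (Ordinal i_n)).
Qed.

End Blocks.

Section FlagDimensions.
Variables (d : nat) (h : seq nat) (i1 l : nat).
Hypotheses (h_sorted : sorted ltn h) (h_parity : forall i j, i \in h -> j \in h -> odd i = odd j).
Hypotheses (i1P : (0 < i1 <= size h)%N) (l_gt0 : (1 <= l)%N).
Hypothesis d_def : d = (2 * (l - 1) + hidx h i1 + 1)%N.
Let D := flag_dims d h i1 l.

Let mem_D x : reflect ((0 < x < d)%N /\ exists2 i, (0 < i <= i1)%N &
    x = (l + (hidx h i1 - hidx h i)./2)%N \/ x = (l + (hidx h i1 + hidx h i)./2)%N) (x \in D).
Proof.
rewrite /D /flag_dims mem_sort mem_undup mem_filter mem_cat.
apply: (iffP andP) => [[xd]|[xd [i ii1 xE]]]; last first.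
  have ii : i \in iota 1 i1 by rewrite mem_iota add1n ltnS.
  split=> //; apply/orP; case: xE => ->; [left|right]; exact: map_f.
by case/orP => /mapP[i]; rewrite mem_iota add1n ltnS => ii xE; split=> //; exists i;
  rewrite // xE; [left|right].
Qed.

Let D_sorted : sorted ltn D.
Proof. by rewrite ltn_sorted_uniq_leq sort_uniq undup_uniq sort_sorted //; apply: leq_total. Qed.

(** The common parity of the [h_i] makes both halvings exact. This is the symmetry [x -> d + 1 - x]
    of the set of dimensions. *)
Let dims_sum i : (0 < i <= i1)%N ->
  (l + (hidx h i1 - hidx h i)./2 + (l + (hidx h i1 + hidx h i)./2) = d.+1)%N.
Proof.
move=> /andP[i0 ii1]; have /andP[_ i1h] := i1P.
have pi : (i.-1 < size h)%N by move: i0 ii1 i1h; clear; lia.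
have pi1 : (i1.-1 < size h)%N by move: i0 ii1 i1h; clear; lia.
have ii : (i.-1 <= i1.-1)%N by move: i0 ii1; clear; lia.
have le : (hidx h i <= hidx h i1)%N.
  have /andP[_ hs] : uniq h && sorted leq h by rewrite -ltn_sorted_uniq_leq.
  by rewrite /hidx (sorted_leq_nth leq_trans leqnn 0%N hs).
have par : odd (hidx h i) = odd (hidx h i1) by apply: h_parity; apply: mem_nth.
rewrite d_def; move: le par l_gt0; clear; lia.
Qed.

Let C x := (0 < x)%N && (x.-1 \in [seq x.-1 | x <- D]).

Lemma mem_flag_dims x : C x = (x \in D).
Proof.
apply/andP/idP => [[x0 /mapP[y yD E]]|xD].
  by have [/andP[y0 _] _] := mem_D _ yD; rewrite (_ : x = y) //; move: x0 y0 E; clear; lia.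
by have [/andP[-> _] _] := mem_D _ xD; split=> //; apply: map_f.
Qed.

Lemma flag_dims_range x : C x -> (0 < x < d)%N.
Proof. by rewrite mem_flag_dims => /mem_D[]. Qed.

Lemma flag_dims_ge x : C x -> (l <= x)%N.
Proof. by rewrite mem_flag_dims => /mem_D[_ [i _ [->|->]]]; apply: leq_addr. Qed.

Lemma flag_dims_min : (l < d)%N -> C l.
Proof.
move=> ld; rewrite mem_flag_dims; apply/mem_D; rewrite ld l_gt0; split=> //.
by exists i1; [move: i1P; clear; lia|left; rewrite subnn addn0].
Qed.

Lemma flag_dims_sym x : C x -> x = 1%N \/ C (d.+1 - x).
Proof.
rewrite !mem_flag_dims => /mem_D[/andP[x0 xd] [i ii xE]].
have [x1|x1] := eqVneq x 1%N; [by left|right].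
have S := dims_sum ii; apply/mem_D; split; first by move: x0 xd x1; clear; lia.
exists i => //; case: xE => ->; [right|left]; move: S; clear; lia.
Qed.

Lemma notin_type_J x : (0 < x < d)%N -> (x \notin type_J d h i1 l) = C x.
Proof.
move=> /andP[x0 xd]; rewrite mem_flag_dims mem_filter mem_iota x0 add1n prednK ?xd ?andbT ?negbK //.
exact: leq_ltn_trans xd.
Qed.

Lemma pred_flag_dims_sorted : sorted ltn [seq x.-1 | x <- D].
Proof.
rewrite sorted_map; apply: (sub_in_sorted _ (allss D) D_sorted) => x y /mem_D[/andP[x0 _] _] _ /=.
by move: x0; clear; lia.
Qed.

Lemma pred_flag_dims_lt x : x \in [seq x.-1 | x <- D] -> (x.+1 < d)%N.
Proof. by move=> /mapP[y /mem_D[/andP[y0 yd] _] ->]; rewrite prednK. Qed.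

End FlagDimensions.

Theorem proposition3p18
  (* F / Q_p finite, E / F unramified quadratic, with their residue fields *)
  (p : nat) (p_prime : prime p) (p_odd : odd p)
  (Qp : fieldType) (v : Qp -> int) (QpP : is_padic_numbers p v)
  (F : fieldExtType Qp) (E : fieldExtType F)
  (OF : set F) (OF_def : OF = integral_closure (padic_integers v) F)
  (OE : set E) (OE_def : OE = integral_closure OF E)
  (pi : F) (pi_unif : uniformizer OF pi)
  (E_quadratic : \dim {:E} = 2%N) (E_unramified : uniformizer OE pi%:A)
  (sigma : {lrmorphism E -> E}) (sigma_nontrivial : exists x, sigma x <> x)
  (kF : finFieldType) (redF : F -> kF) (redFP : residue_map OF pi redF)
  (kE : finFieldType) (redE : E -> kE) (redEP : residue_map OE pi%:A redE)
  (* the hermitian space C *)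
  (C : vectType E) (n : nat) (n_gt0 : (0 < n)%N) (dimC : \dim {:C} = n)
  (form : {hermitian C for false & sigma}) (form_nondeg : nondegenerate form)
  (* a Bruhat-Tits index *)
  (m : nat) (m_gt0 : (0 < m)%N) (h : seq nat) (hP : admissible_h n m h)
  (I : seq nat) (L0 L1 : nat -> set C)
  (btP : bruhat_tits_index OE pi%:A form n m h I L0 L1)
  (i1 : nat) (i1_def : i1 = head 0%N I) (i1_neq0 : i1 <> 0%N)
  (* the hermitian space V = Lambda_0^{i_1} / pi (Lambda_0^{i_1})^dual *)
  (V : vectType kE) (prV : C -> V)
  (prVP : quotient_map OE redE (L0 i1)
            (scale_set pi%:A (dual OE form (L0 i1))) prV)
  (theta : {rmorphism kE -> kE}) (theta_def : forall x, theta x = x ^+ #|kF|)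
  (formV : {hermitian V for false & theta})
  (formVP : forall x y, L0 i1 x -> L0 i1 y ->
              formV (prV x) (prV y) = redE (form x y))
  (d l : nat) (dimV : \dim {:V} = d) (l_gt0 : (1 <= l)%N)
  (d_def : d = (2 * (l - 1) + hidx h i1 + 1)%N)
  (* the unitary group over an algebraic closure of the residue field of E *)
  (k : closedFieldType) (iota : {rmorphism kE -> k})
  (k_algebraic : forall x : k, algebraicOver iota x)
  (e : d.-tuple V) (eP : self_dual_flag_basis formV e)
  (X : forall J : seq nat, 'S_d -> set (flag_variety k d J))
  (X_def : X = fine_DL #|kF|
                 (\matrix_(i, j) iota (formV (tnth e i) (tnth e j))))
  (J : seq nat) (J_def : J = type_J d h i1 l)
  (K : seq nat) (K_def : K = [seq x.-1 | x <- flag_dims d h i1 l]) :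
  let T := word_tuples d K (2 * (l - 1) + hidx h i1) in
  let XT := fun w : (size K).-tuple 'S_d =>
    X J (\prod_(i < size K) tnth w i)%g in
  closure (X J (\prod_(l <= j < (2 * (l - 1) + hidx h i1).+1)
                  simple_refl d j)%g) = \bigcup_(w in T) XT w
  /\ trivIset T XT.
Proof.
move=> T XT; subst OF OE.
have kF_char := residue_char p_prime QpP pi_unif redFP.
have kE_char := residue_char_ext p_prime QpP pi_unif redFP redEP.
have k_char : p \in [pchar k] by apply: (rmorph_pchar iota) kE_char.
(* The residue fields have characteristic [p], so that [#|kF|] is a power of [p] and the
   corresponding power map is a ring morphism on [k]. *)
have [a a_gt0 qE] : exists2 a, (0 < a)%N & #|kF| = (p ^ a)%N.
  exists (logn p #|kF|); last exact: (card_pprimeChar kF_char).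
  have : (1 < #|kF|)%N by exact: finRing_gt1.
  by rewrite {1}(card_pprimeChar kF_char : #|kF| = _); case: logn.
have [Fr FrE] := exists_frobenius a k_char.
pose H := map_mx iota (gram formV e).
have HU : H \in unitmx by rewrite map_unitmx gram_unit.
have FH : map_mx Fr H = H^T.
  apply/matrixP => i j; rewrite !mxE FrE -qE -rmorphXn /= -theta_def.
  by rewrite [in RHS]hermC expr0 mul1r.
have H_anti (i j : 'I_d) : ((i + j).+1 < d)%N -> H i j = 0.
  by move=> ij; rewrite mxE (gram_anti eP ij) rmorph0.
have XE w : X J w = fine_DL (p ^ a) H J w.
  have HE : \matrix_(i, j) iota (formV (tnth e i) (tnth e j)) = H.
    by apply/matrixP => i j; rewrite !mxE.
  by rewrite X_def qE HE.
have [h_size h_sorted _ h_par] := hP.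
have i1P : (0 < i1 <= size h)%N.
  have := bt_nonempty btP; have := bt_le btP; move: i1_neq0; rewrite h_size i1_def.
  case: (I) => [//|i I'] /= i0 le _; rewrite lt0n (introN eqP i0) le //.
  exact: mem_head.
pose A x := (0 < x)%N && (x.-1 \in K).
have A_range x : A x -> (0 < x < d)%N by rewrite /A K_def; apply: flag_dims_range.
have A_J x : (0 < x < d)%N -> (x \notin J) = A x.
  by rewrite /A K_def J_def; apply: notin_type_J.
have A_ge x : A x -> (l <= x)%N by rewrite /A K_def; apply: flag_dims_ge.
have A_min : (l < d)%N -> A l by rewrite /A K_def; apply: flag_dims_min.
have A_sym x : A x -> x = 1%N \/ A (d.+1 - x)%N.
  by rewrite /A K_def; apply: flag_dims_sym.
have K_sorted : sorted ltn K by rewrite K_def; apply: pred_flag_dims_sorted.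
have K_lt x : x \in K -> (x.+1 < d)%N by rewrite K_def; apply: pred_flag_dims_lt.
have d1 : (2 * (l - 1) + hidx h i1)%N = d.-1 by rewrite d_def addn1.
have d_gt0 : (0 < d)%N by rewrite d_def addn1.
have XTE w (t : nat -> nat) : (forall i : 'I_(size K), tnth w i = refl_word d (nth 0%N K i).+1 (t i)) ->
    XT w = fine_DL (p ^ a) H J (word d (blocks K t)).
  by move=> wE; rewrite /XT XE word_blocks; under eq_bigr do rewrite wE.
have TP w : T w <-> exists2 t, (forall i, (i < size K)%N ->
    (t i <= (if i.+1 < size K then nth 0 K i.+1 else d.-1) - nth 0 K i)%N) &
    forall i : 'I_(size K), tnth w i = refl_word d (nth 0%N K i).+1 (t i).
  by rewrite /T d1; apply: word_tuplesP.
(* A point common to two strata determines the word, the word determines the block lengths, and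
   these determine the tuple. *)
split; last first.
  move=> w w' /TP[t tP wE] /TP[t' t'P w'E] [y []]; rewrite (XTE _ _ wE) (XTE _ _ w'E) => yt yt'.
  have tt' := stratum_inj k_char a_gt0 FrE HU H_anti A_range A_J
    (good_blocks K_sorted K_lt tP) (good_blocks K_sorted K_lt t'P) yt yt'.
  apply: eq_from_tnth => i.
  by rewrite wE w'E (blocks_inj K_sorted K_lt tP t'P tt').
have -> : (\prod_(l <= j < (2 * (l - 1) + hidx h i1).+1) simple_refl d j)%g =
    word d (seq.iota l (d - l)).
  by rewrite /word /index_iota d1 prednK.
rewrite XE; have := closure_stratum k_char a_gt0 FrE HU FH H_anti A_range A_sym A_J l_gt0 A_ge A_min.
rewrite /= => ->; apply/seteqP; split=> [y [S gS Sy]|y [w /TP[t tP wE]]].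
  have [t tP SE] := good_blocksP K_sorted K_lt gS.
  have wE (i : 'I_(size K)) : tnth [tuple refl_word d (nth 0%N K i).+1 (t i) | i < size K] i
    = refl_word d (nth 0%N K i).+1 (t i) by rewrite tnth_mktuple.
  exists [tuple refl_word d (nth 0%N K i).+1 (t i) | i < size K].
    by apply/TP; exists t.
  by rewrite (XTE _ _ wE) -SE.
rewrite (XTE _ _ wE) => yt; exists (blocks K t) => //.
exact: (good_blocks K_sorted K_lt tP).
Qed.
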